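(* Let $M=(M_n)_{n\in\mathbb Z}$ be a stationary ergodic Markov chain on a countable state space with exponential return times. Then $M$ is a finitary factor of an i.i.d.\ process, with a coding window which has exponential tails.
   Context: A process $X=(X_n)_{n\in\mathbb Z}$ is a factor of a process $Y=(Y_n)_{n\in\mathbb Z}$ if there is a measurable function $\varphi$ such that $X_n=\varphi(\dots,Y_{n-1},Y_n,Y_{n+1},\dots)$ for all $n$, where $\varphi$ applied at time $n$ means applying it to the sequence shifted so that $Y_n$ is at the origin (i.e. the factor map commutes with the shift). The factor is finitary if there is an almost surely finite stopping time $R$ with respect to the filtration $(\mathcal F_r)_{r\ge 0}$, $\mathcal F_r=\sigma(Y_n: |n|\le r)$, such that $X_0$ is $\mathcal F_R$-measurable; such an $R$ is called a coding window. The coding window has exponential tails if there are $C,c>0$ with $\mathbb P(R\ge r)\le Ce^{-cr}$ for all $r\ge1$. A Markov chain on a countable state space is called ergodic if it is irreducible, aperiodic and positive recurrent. It has exponential return times if for some (equivalently every) state $s$, the return time $T$ to $s$ of the chain started at $s$ satisfies $\mathbb P(T\ge n)\le Ce^{-cn}$ for some $C,c>0$ and all $n$. *)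

(* Defs.v *)
From Stdlib Require Import Reals ZArith List.
Open Scope R_scope.

Definition is_sigma {O : Type} (Sig : (O -> Prop) -> Prop) : Prop :=
  Sig (fun _ => True) /\
  (forall E, Sig E -> Sig (fun x => ~ E x)) /\
  (forall E : nat -> (O -> Prop), (forall k, Sig (E k)) -> Sig (fun x => exists k, E k x)).

Definition generated {O : Type} (G : (O -> Prop) -> Prop) (E : O -> Prop) : Prop :=
  forall Sig, is_sigma Sig -> (forall B, G B -> Sig B) -> Sig E.

Definition discrete {S : Type} (B : S -> Prop) : Prop := True.

Definition is_prob {O : Type} (Sig : (O -> Prop) -> Prop) (P : (O -> Prop) -> R) : Prop :=
  is_sigma Sig /\
  (forall E, Sig E -> 0 <= P E) /\
  P (fun _ => True) = 1 /\
  (forall E : nat -> (O -> Prop),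
      (forall k, Sig (E k)) ->
      (forall i j x, i <> j -> E i x -> E j x -> False) ->
      infinite_sum (fun k => P (E k)) (P (fun x => exists k, E k x))).

Definition measurable {O A : Type} (SigO : (O -> Prop) -> Prop) (SigA : (A -> Prop) -> Prop)
  (f : O -> A) : Prop :=
  forall B, SigA B -> SigO (fun x => B (f x)).

Definition prod_sigma {A : Type} (SigA : (A -> Prop) -> Prop) : ((Z -> A) -> Prop) -> Prop :=
  generated (fun E => exists (n : Z) (C : A -> Prop), SigA C /\ forall y, E y <-> C (y n)).

Definition window_sigma {A : Type} (SigA : (A -> Prop) -> Prop) (r : nat)
  : ((Z -> A) -> Prop) -> Prop :=
  generated (fun E => exists (n : Z) (C : A -> Prop),
                 (Z.abs n <= Z.of_nat r)%Z /\ SigA C /\ forall y, E y <-> C (y n)).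

Definition countable_type (S : Type) : Prop := exists f : S -> nat, forall x y, f x = f y -> x = y.

Definition iid {O A : Type} (Sig : (O -> Prop) -> Prop) (P : (O -> Prop) -> R)
  (SigA : (A -> Prop) -> Prop) (Y : Z -> O -> A) : Prop :=
  (forall n, measurable Sig SigA (Y n)) /\
  (forall n B, SigA B -> P (fun w => B (Y n w)) = P (fun w => B (Y 0%Z w))) /\
  (forall (ns : list Z) (Bs : Z -> (A -> Prop)), NoDup ns -> (forall n, SigA (Bs n)) ->
      P (fun w => Forall (fun n => Bs n (Y n w)) ns)
      = fold_right Rmult 1 (map (fun n => P (fun w => Bs n (Y n w))) ns)).

Definition stationary {O S : Type} (P : (O -> Prop) -> R) (M : Z -> O -> S) : Prop :=
  forall B, prod_sigma (@discrete S) B ->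
    P (fun w => B (fun n => M n w)) = P (fun w => B (fun n => M (n + 1)%Z w)).

(* Markov property: P(M_{n+1}=t | M_n=s, M_{n-1}=ss 0, ..., M_{n-k}=ss (k-1))
   = P(M_{n+1}=t | M_n=s), written without division. *)
Definition markov {O S : Type} (P : (O -> Prop) -> R) (M : Z -> O -> S) : Prop :=
  forall (n : Z) (k : nat) (ss : nat -> S) (s t : S),
    let past := fun w => forall i : nat, (i < k)%nat -> M (n - 1 - Z.of_nat i)%Z w = ss i in
    P (fun w => past w /\ M n w = s /\ M (n + 1)%Z w = t) * P (fun w => M n w = s)
    = P (fun w => past w /\ M n w = s) * P (fun w => M n w = s /\ M (n + 1)%Z w = t).

Definition trans_prob {O S : Type} (P : (O -> Prop) -> R) (M : Z -> O -> S)
  (n : nat) (s t : S) : R :=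
  P (fun w => M 0%Z w = s /\ M (Z.of_nat n) w = t) / P (fun w => M 0%Z w = s).

Definition irreducible {O S : Type} (P : (O -> Prop) -> R) (M : Z -> O -> S) : Prop :=
  forall s t : S, exists n : nat, 0 < trans_prob P M n s t.

Definition aperiodic {O S : Type} (P : (O -> Prop) -> R) (M : Z -> O -> S) : Prop :=
  forall s : S, forall d : nat,
    (forall n : nat, (1 <= n)%nat -> 0 < trans_prob P M n s s -> Nat.divide d n) -> d = 1%nat.

(* P_s(T >= n), T = return time to s of the chain started at s:
   T >= n  iff  M_1, ..., M_{n-1} are all different from s *)
Definition ret_tail {O S : Type} (P : (O -> Prop) -> R) (M : Z -> O -> S) (s : S) (n : nat) : R :=
  P (fun w => M 0%Z w = s /\
              forall i : nat, (1 <= i)%nat -> (i < n)%nat -> M (Z.of_nat i) w <> s)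
  / P (fun w => M 0%Z w = s).

(* E_s[T] = sum_{n>=1} P_s(T >= n) < infinity, for every state s *)
Definition positive_recurrent {O S : Type} (P : (O -> Prop) -> R) (M : Z -> O -> S) : Prop :=
  forall s : S, exists L : R, infinite_sum (fun n => ret_tail P M s (Datatypes.S n)) L.

Definition ergodic_chain {O S : Type} (P : (O -> Prop) -> R) (M : Z -> O -> S) : Prop :=
  irreducible P M /\ aperiodic P M /\ positive_recurrent P M.

Definition exp_return_times {O S : Type} (P : (O -> Prop) -> R) (M : Z -> O -> S) : Prop :=
  exists (s : S) (C c : R), 0 < C /\ 0 < c /\
    forall n : nat, ret_tail P M s n <= C * exp (- c * INR n).

(* R >= r, with None standing for R = infinity *)
Definition ge_opt (x : option nat) (r : nat) : Prop :=
  match x with None => True | Some k => (r <= k)%nat end.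
Definition le_opt (x : option nat) (r : nat) : Prop :=
  match x with None => False | Some k => (k <= r)%nat end.

Definition finitary_iid_factor_exp {O S : Type} (P : (O -> Prop) -> R) (M : Z -> O -> S) : Prop :=
  exists (O' : Type) (Sig' : (O' -> Prop) -> Prop) (P' : (O' -> Prop) -> R)
         (A : Type) (SigA : (A -> Prop) -> Prop) (Y : Z -> O' -> A)
         (phi : (Z -> A) -> S) (Rw : (Z -> A) -> option nat) (C c : R),
    is_prob Sig' P' /\ is_sigma SigA /\ iid Sig' P' SigA Y /\
    measurable (prod_sigma SigA) (@discrete S) phi /\
    (forall B, prod_sigma (@discrete S) B ->
       P' (fun w => B (fun n => phi (fun k => Y (n + k)%Z w)))
       = P (fun w => B (fun n => M n w))) /\
    (forall r : nat, window_sigma SigA r (fun y => le_opt (Rw y) r)) /\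
    (* phi is F_R-measurable *)
    (forall (B : S -> Prop) (r : nat),
       window_sigma SigA r (fun y => B (phi y) /\ le_opt (Rw y) r)) /\
    P' (fun w => Rw (fun k => Y k w) = None) = 0 /\
    0 < C /\ 0 < c /\
    (forall r : nat, (1 <= r)%nat -> P' (fun w => ge_opt (Rw (fun k => Y k w)) r) <= C * exp (- c * INR r)).

(* Main.v *)
(* Idea. A stationary Markov chain is cut into i.i.d. cycles by its returns to a state. If the return
   times have hazard rates that are eventually bounded below and tails that never vanish, the renewal
   process can be run from i.i.d. uniform variables so that some finite pattern of variables forces a
   renewal whatever the past: the first two patterns around the origin then determine the cycle covering
   it, which is filled in from the variable at its end. A general return time need not have such hazard
   rates, so the returns are first thinned: the chain is paired with independent coins, and only the
   returns with coin [true] count. For the probability [q] of [false] equal to the inverse of the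
   generating function of the return time at some [exp lam > 1], the unmarked returns, tilted by
   [exp lam], form a proper renewal sequence. It is bounded below by aperiodicity, so the marked return
   time has density and tail both of order [exp (- lam t)].
   The two laws agree up to a factor [scale] on cylinders that start and end at the cycle state, hence on
   all cylinders since that state is visited in the past and in the future; the total mass gives
   [scale = 1]. *)

Require Import Defs.
From Stdlib Require Import Reals ZArith List Lra Lia Classical ClassicalEpsilon
  FunctionalExtensionality PropExtensionality Cantor.
From HB Require structures.
From mathcomp Require all_boot all_order all_algebra lra.
From mathcomp Require boolp classical_sets reals ereal normedtype sequences measure
  lebesgue_measure lebesgue_integral Rstruct_topology.
Open Scope R_scope.

(** * Product measures and fair bits, from MathComp-Analysis *)

(** The age of a renewal process at a site can be arbitrarily large, so a finite block of variables
    overrides the past only if all large ages renew with probability at least a fixed [eps]. A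
    return time carried by a sparse set of lengths has zero hazard at infinitely many ages, and one
    with bounded support leaves no room to forbid renewals. Thinning repairs both. Unmarked returns
    satisfy a renewal equation whose weights are [q] times the gap probabilities; multiplying by
    [exp (lam * t)] keeps the equation and turns the total mass into [q] times the generating
    function at [exp lam]. Mass one keeps the tilted sequence between two positive constants, and
    [lam > 0] makes the survival probability, a sum dominated by a geometric series, of the same
    order as a single term. The lower bound uses no limit theorem: exponential tails put a large
    value into every window of fixed length, and [u m * u n <= u (m + n)] carries it to every later
    index. The coins are independent of the chain, so marking one end of an excursion only changes
    its weight by [(1 - q) / q]; this transports the estimates from unmarked to marked returns. *)

Module MC.
Import structures.
Import all_boot all_order all_algebra lra.
Import boolp classical_sets reals ereal normedtype sequences measure
  lebesgue_measure lebesgue_integral Rstruct_topology.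
Import Order.TTheory GRing.Theory Num.Theory.
Import numFieldNormedType.Exports.
Local Open Scope classical_set_scope.
Local Open Scope ring_scope.

(** [sum_f_R0 f n] has [n + 1] terms and the MathComp sum has [n], hence the shift by one in both
    directions. *)
Lemma infinite_sumP (f : nat -> R) (l : R) :
  infinite_sum f l <-> (fun n => \sum_(0 <= k < n) f k) @ \oo --> (l : R^o).
Proof.
split=> [H|H].
- apply/(@cvgrPdist_lt R R^o) => e /RltP e0; have [N HN] := H e e0.
  exists N.+1 => // -[//|n] /= Nn.
  apply/RltP; rewrite -sum_f_R0E -RabsE Rabs_minus_sym.
  exact: HN n (ssrnat.leP (Nn : (N <= n)%N)).
- move/(@cvgrPdist_lt R R^o) : H => H e /Rgt_lt/RltP e0; have [N _ HN] := H e e0.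
  exists N => n /ssrnat.leP Nn; rewrite /Rdist Rabs_minus_sym RabsE sum_f_R0E.
  apply/RltP; apply: HN => /=; exact: leqW.
Qed.

Lemma bigcup_existsE {T : Type} (E : nat -> set T) :
  (fun x => exists k, E k x) = \bigcup_k E k.
Proof. by apply/seteqP; split=> [x [k Ek]|x [k _ Ek]]; exists k. Qed.

Lemma measurable_is_sigma d (T : measurableType d) : is_sigma (@measurable d T).
Proof.
split; first exact: measurableT.
split=> [E mE|E mE]; first exact: (measurableC mE).
by rewrite bigcup_existsE; exact: bigcup_measurable.
Qed.

Lemma probability_is_prob d (T : measurableType d) (mu : probability T R) :
  is_prob (@measurable d T) (fun E => fine (mu E)).
Proof.
split; first exact: measurable_is_sigma.
split=> [E mE|]; first by apply/RleP; exact: fine_ge0.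
split; first by rewrite [fun _ => _](_ : _ = setT) ?probability_setT //; apply/seteqP.
move=> E mE tE; rewrite bigcup_existsE; apply/infinite_sumP.
have tr : trivIset setT E.
  apply/trivIsetP => i j _ _ ij; apply/seteqP; split=> // x [Ei Ej].
  by apply: (tE i j x _ Ei Ej); exact/eqP.
have mU : measurable (\bigcup_k E k) by exact: bigcup_measurable.
have /fine_cvgP [_] : (fun n => (\sum_(0 <= i < n) mu (E i))%E) @ \oo -->
    (fine (mu (\bigcup_k E k)))%:E.
  by rewrite fineK ?fin_num_measure //; exact: measure_semi_sigma_additive.
apply: cvg_trans; apply: near_eq_cvg; near=> n => /=.
rewrite sum_fine //= => i _; exact: fin_num_measure.
Unshelve. all: by end_near.
Qed.


(** A copy of [O] whose type mentions [isP] and [x0], so that canonical structures can recover the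
    sigma-algebra, the measure and a point from the type alone. *)
Definition space {O : Type} {Sig : (O -> Prop) -> Prop} {P : (O -> Prop) -> R}
  (isP : is_prob Sig P) (x0 : O) : Type := O.

Section space.
Context {O : Type} {Sig : (O -> Prop) -> Prop} {P : (O -> Prop) -> R}.
Context (isP : is_prob Sig P) (x0 : O).
Local Notation T := (space isP x0).

HB.instance Definition _ := gen_eqMixin T.
HB.instance Definition _ := gen_choiceMixin T.
HB.instance Definition _ := isPointed.Build T x0.

Let sigma0 : Sig (set0 : set O).
Proof.
have [[ST [SC _]] _] := isP.
have -> : set0 = (fun x : O => ~ True) :> set O by apply/seteqP; split => x.
exact: SC ST.
Qed.

Let sigmaC (A : set O) : Sig A -> Sig (~` A).
Proof. by have [[_ [SC _]] _] := isP; exact: SC. Qed.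

Let sigmaU (F : (set O)^nat) : (forall i, Sig (F i)) -> Sig (\bigcup_i (F i)).
Proof. by have [[_ [_ SU]] _] := isP; move=> /SU; rewrite bigcup_existsE. Qed.

HB.instance Definition _ :=
  @isMeasurable.Build default_measure_display T Sig sigma0 sigmaC sigmaU.

(* MathComp asks for nonnegativity on all sets, but P is arbitrary outside Sig. *)
Definition mu (E : set T) : \bar R := (Num.max 0 (P E))%:E.

Lemma muE (E : set T) : Sig E -> mu E = (P E)%:E.
Proof. by move=> SE; rewrite /mu max_r //; apply/RleP; case: isP => _ [/(_ E SE)]. Qed.

Let mu0 : mu set0 = 0%E.
Proof.
rewrite muE //; congr EFin.
have [_ [_ [_ Pa]]] := isP.
have := Pa (fun _ => set0) (fun _ => sigma0) (fun _ _ _ _ => False_rect _).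
rewrite bigcup_existsE bigcup0 // => /infinite_sumP H.
have := @cvg_series_cvg_0 R R^o (fun => P set0).
rewrite /series /= => /(_ (cvgP _ H)) /cvg_lim; rewrite lim_cst // => -> //.
Qed.

Let mu_ge0 E : (0 <= mu E)%E.
Proof. by rewrite lee_fin le_max lexx. Qed.

Let mu_sigma_additive : semi_sigma_additive mu.
Proof.
move=> F mF tF mU.
have [_ [_ [_ Pa]]] := isP.
have := Pa F mF _; rewrite bigcup_existsE muE // => H.
have {}H := H _.
have -> : (fun n => (\sum_(0 <= i < n) mu (F i))%E) =
          EFin \o (fun n => \sum_(0 <= i < n) P (F i)).
  by apply/funext => n /=; rewrite -sumEFin; apply: eq_bigr => i _; rewrite muE //; exact: mF.
apply: cvg_comp; [apply/infinite_sumP/H|exact: cvg_refl].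
move=> i j x ij Fi Fj; apply: ij; apply: (tF i j) => //; by exists x.
Qed.

HB.instance Definition _ := isMeasure.Build _ T R mu mu0 mu_ge0 mu_sigma_additive.

Let mu_setT : mu setT = 1%E.
Proof. by have [[ST _] [_ [P1 _]]] := isP; rewrite muE // P1. Qed.

HB.instance Definition _ := Measure_isProbability.Build _ T R mu mu_setT.
End space.

Lemma product_prob {O1 O2 : Type} (Sig1 : (O1 -> Prop) -> Prop) (P1 : (O1 -> Prop) -> R)
  (Sig2 : (O2 -> Prop) -> Prop) (P2 : (O2 -> Prop) -> R) (x1 : O1) (x2 : O2) :
  is_prob Sig1 P1 -> is_prob Sig2 P2 ->
  exists (Sig : (O1 * O2 -> Prop) -> Prop) (P : (O1 * O2 -> Prop) -> R),
    is_prob Sig P /\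
    forall E1 E2, Sig1 E1 -> Sig2 E2 ->
      Sig (fun x => E1 (fst x) /\ E2 (snd x)) /\
      P (fun x => E1 (fst x) /\ E2 (snd x)) = Rmult (P1 E1) (P2 E2).
Proof.
move=> isP1 isP2.
pose m1 : probability _ R := mu isP1 x1; pose m2 : probability _ R := mu isP2 x2.
pose m : probability _ R := (m1 \x m2)%E.
exists (@measurable _ (space isP1 x1 * space isP2 x2)%type), (fun E => fine (m E)); split; first exact: probability_is_prob.
move=> E1 E2 S1 S2.
have mE1 : measurable (E1 : set (space isP1 x1)) by [].
have mE2 : measurable (E2 : set (space isP2 x2)) by [].
have -> : (fun x : O1 * O2 => E1 x.1 /\ E2 x.2) = (E1 `*` E2) by [].
split; first exact: measurableX.
have -> : m (E1 `*` E2) = (m1 E1 * m2 E2)%E by exact: product_measure1E.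
have -> : m1 E1 = (P1 E1)%:E by exact: muE.
by have -> : m2 E2 = (P2 E2)%:E by exact: muE.
Qed.

Section dyadic.
Context {K : realType}.
Implicit Types (x : K) (i j k m : nat).

(** For [x >= 0] this says that the integer part of [x * 2^(k+1)] is odd: it is binary digit [k] of
    [x] after the point. *)
Definition dyadic_bit k x : bool :=
  `[< exists j, j%:R * 2 + 1 <= x * 2 ^+ k.+1 < j%:R * 2 + 2 >].

Lemma nat_interval_unique x i j :
  i%:R <= x < i%:R + 1 -> j%:R <= x < j%:R + 1 -> i = j.
Proof.
move=> /andP[ix xi] /andP[jx xj]; apply/eqP; rewrite eqn_leq.
rewrite -(ltnS i) -(ltnS j) -!(ltr_nat K) -!natr1.
by rewrite (le_lt_trans ix xj) (le_lt_trans jx xi).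
Qed.

Lemma dyadic_bitE m k x : k%:R <= x * 2 ^+ m < k%:R + 1 ->
  dyadic_bit m x = (k%:R * 2 + 1 <= x * 2 ^+ m.+1).
Proof.
move=> xk; have [x1 x2] := andP xk.
apply/asboolP/idP => [[j]|]; rewrite exprSr mulrA => x3.
  have -> : k = j by apply: (nat_interval_unique _ _ _ xk); move/andP: x3 => [? ?]; apply/andP; split; lra.
  by case/andP: x3.
by exists k; rewrite x3 /=; have [? ?] := andP xk; lra.
Qed.

(** Each further digit keeps one half of a dyadic interval, so [m] prescribed digits leave an
    interval of length [2^-m]; [k < 2^m] keeps it inside [[0, 1)]. *)
Lemma dyadic_cylinder (e : nat -> bool) m :
  exists2 k, (k < 2 ^ m)%N &
  forall x, 0 <= x < 1 ->
    (forall i, (i < m)%N -> dyadic_bit i x = e i) <-> k%:R <= x * 2 ^+ m < k%:R + 1.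
Proof.
elim: m => [|m [k km IH]].
  by exists 0%N => // x x01; rewrite expr0 mulr1 add0r; split.
exists (k.*2 + e m)%N => [|x x01].
  rewrite expnS mul2n; move: km; rewrite -leq_double; case: (e m) => /=; rewrite ?addn1 ?addn0 => km.
    by apply: leq_trans km; rewrite doubleS.
  by apply: leq_trans km; rewrite doubleS.
have step : (forall i, (i < m.+1)%N -> dyadic_bit i x = e i) <->
  (k%:R <= x * 2 ^+ m < k%:R + 1) /\ dyadic_bit m x = e m.
  split=> [H|[/IH H1 H2] i].
    by split; [apply/IH => // i im; exact: H (leqW im)|exact: H].
  by rewrite ltnS leq_eqVlt => /orP[/eqP->|/(H1 x01)].
rewrite {}step natrD -mul2n natrM.
have E := exprSr (2 : K) m; have bE := dyadic_bitE m k x.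
split=> [[xk]|/andP[x1 x2]].
  have [y1 y2] := andP xk; rewrite (bE xk) E mulrA.
  case: (e m) => /= [H|/negbT]; first by apply/andP; split; lra.
  by rewrite -ltNge => H; apply/andP; split; lra.
rewrite E mulrA in x1 x2.
have xk : k%:R <= x * 2 ^+ m < k%:R + 1.
  by case: (e m) x1 x2 => /= x1 x2; apply/andP; split; lra.
split=> //; rewrite (bE xk) E mulrA.
case: (e m) x1 x2 => /= x1 x2; first lra.
by apply/negbTE; rewrite -ltNge; lra.
Qed.
End dyadic.


Local Notation T := (measurableTypeR R).
Definition unit_itv : set T := `[0, 1[%classic.
Lemma measurable_unit_itv : measurable unit_itv. Proof. exact: measurable_itv. Qed.
Definition unif : set T -> \bar R := mrestr lebesgue_measure measurable_unit_itv.
HB.instance Definition _ := Measure.on unif.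
Lemma unif_setT : unif setT = 1%E.
Proof.
by rewrite /unif /mrestr setTI /unit_itv lebesgue_measure_itv /= lte_fin ltr01 oppr0 adde0.
Qed.
HB.instance Definition _ := Measure_isProbability.Build _ _ _ unif unif_setT.

Lemma measurable_dyadic_bit (k : nat) (e : bool) :
  measurable [set x : T | dyadic_bit k x = e].
Proof.
have mt : measurable [set x : T | dyadic_bit k x].
  have -> : [set x : R | dyadic_bit k x] =
      \bigcup_j `[(j%:R * 2 + 1) / 2 ^+ k.+1, (j%:R * 2 + 2) / 2 ^+ k.+1[%classic.
    apply/seteqP; split=> x /=.
      move/asboolP => [j jx]; exists j => //=; rewrite in_itv /=.
      by rewrite ler_pdivrMr ?exprn_gt0 // ltr_pdivlMr ?exprn_gt0.
    move=> [j _] /=; rewrite in_itv /= ler_pdivrMr ?exprn_gt0 // ltr_pdivlMr ?exprn_gt0 // => jx.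
    by apply/asboolP; exists j.
  by apply: bigcup_measurable => j _; exact: measurable_itv.
case: e => //.
have -> : [set x : R | dyadic_bit k x = false] = ~` [set x : R | dyadic_bit k x].
  by apply/seteqP; split=> x /=; [move=> -> | move=> /negP/negbTE].
exact: measurableC.
Qed.

Lemma fair_bits : exists (O : Type) (Sig : (O -> Prop) -> Prop) (P : (O -> Prop) -> R)
    (b : nat -> O -> bool),
  is_prob Sig P /\ (forall k e, Sig (fun x => b k x = e)) /\
  forall (m : nat) (e : nat -> bool),
    P (fun x => forall k, (k < m)%coq_nat -> b k x = e k) = pow (Rinv 2) m.
Proof.
exists T, measurable, (fun E => fine (unif E)), (@dyadic_bit R).
split; first exact: (probability_is_prob _ _ unif).
split; first exact: measurable_dyadic_bit.
move=> m e; have [k km H] := dyadic_cylinder (K := R) e m.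
have p0 : 0 < 2 ^+ m :> R by exact: exprn_gt0.
rewrite /unif /mrestr.
have -> : (fun x : R => forall i : nat, (i < m)%coq_nat -> dyadic_bit i x = e i) `&` unit_itv =
    `[k%:R / 2 ^+ m, (k%:R + 1) / 2 ^+ m[%classic.
  apply/seteqP; split=> x /=.
    rewrite /unit_itv /= !in_itv /= => -[Hx x01].
    have /(H x x01) : forall i, (i < m)%N -> dyadic_bit i x = e i by move=> i /ssrnat.ltP; exact: Hx.
    by rewrite ler_pdivrMr // ltr_pdivlMr.
  rewrite in_itv /= ler_pdivrMr // ltr_pdivlMr // => /andP[x1 x2].
  have x01 : 0 <= x < 1.
    apply/andP; split.
      by rewrite -(pmulr_lge0 _ p0); exact: le_trans (ler0n _ _) x1.
    rewrite -(ltr_pM2r p0) mul1r; apply: (lt_le_trans x2).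
    by rewrite natr1 -natrX ler_nat.
  split; last by rewrite /unit_itv /= in_itv.
  by move=> i /ssrnat.ltP im; apply: ((H x x01).2 _ i im); rewrite x1.
rewrite lebesgue_measure_itv /= lte_fin ltr_pM2r ?invr_gt0 // ltrDl ltr01 /=.
rewrite -mulrBl addrAC subrr add0r mul1r RpowE exprVn.
by congr (_ ^- m); rewrite -[LHS]INRE.
Qed.

End MC.

Lemma ev_ext {O : Type} (E F : O -> Prop) : (forall x, E x <-> F x) -> E = F.
Proof.
  intros H. apply functional_extensionality. intros x.
  apply propositional_extensionality, H.
Qed.

Lemma ev_transfer {O : Type} (L : (O -> Prop) -> Prop) (E F : O -> Prop) :
  (forall x, E x <-> F x) -> L E -> L F.
Proof. intros H. now rewrite (ev_ext _ _ H). Qed.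

(** * Countable types *)

Lemma countable_nat : countable_type nat.
Proof. exists (fun n => n). auto. Qed.

Lemma countable_bool : countable_type bool.
Proof. exists (fun b : bool => if b then 1%nat else 0%nat). intros [] []; congruence. Qed.

Lemma countable_Z : countable_type Z.
Proof.
  exists (fun z => if Z.leb 0 z then (2 * Z.to_nat z)%nat else (2 * Z.to_nat (- z) + 1)%nat).
  intros x y; destruct (Z.leb_spec 0 x), (Z.leb_spec 0 y); intros H1; lia.
Qed.

Lemma countable_prod (T U : Type) :
  countable_type T -> countable_type U -> countable_type (T * U).
Proof.
  intros [f Hf] [g Hg]. exists (fun x => to_nat (f (fst x), g (snd x))).
  intros [x u] [y v] H. apply to_nat_inj in H. simpl in H. injection H as H1 H2.
  f_equal; auto.
Qed.

Lemma countable_list (T : Type) : countable_type T -> countable_type (list T).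
Proof.
  intros [f Hf].
  exists (fix enc l := match l with
                      | nil => 0%nat
                      | x :: l' => S (to_nat (f x, enc l'))
                      end).
  induction x as [|x l IH]; intros [|y l']; try discriminate; auto.
  intros H. apply eq_add_S, to_nat_inj in H. injection H as H1 H2.
  f_equal; auto.
Qed.

(** * Measurable events *)

Lemma least_element (A : nat -> Prop) :
  (exists n, A n) -> exists n, A n /\ forall m, A m -> (n <= m)%nat.
Proof.
  intros H. destruct (dec_inh_nat_subset_has_unique_least_element A) as (n & Hn & _); eauto.
  intros; apply classic.
Qed.

Section sigma_algebra.
Context {O : Type} {Sig : (O -> Prop) -> Prop} (HS : is_sigma Sig).

Lemma sig_iff (E F : O -> Prop) : (forall x, E x <-> F x) -> Sig E -> Sig F.
Proof. intros H. now rewrite (ev_ext _ _ H). Qed.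

Lemma sig_not (E : O -> Prop) : Sig E -> Sig (fun x => ~ E x).
Proof. apply HS. Qed.

Lemma sig_const (A : Prop) : Sig (fun _ => A).
Proof.
  destruct (classic A) as [a|a].
  - apply (sig_iff (fun _ => True)); [tauto | apply HS].
  - apply (sig_iff (fun _ => ~ True)); [tauto |]. apply HS, HS.
Qed.

Lemma sig_ex_nat (E : nat -> O -> Prop) : (forall k, Sig (E k)) -> Sig (fun x => exists k, E k x).
Proof. apply HS. Qed.

Lemma sig_ex (T : Type) (E : T -> O -> Prop) :
  countable_type T -> (forall t, Sig (E t)) -> Sig (fun x => exists t, E t x).
Proof.
  intros [f Hf] HE.
  apply (sig_iff (fun x => exists k, (fun k x => exists t, f t = k /\ E t x) k x)).
  - intros x; split; [intros (k & t & _ & H) | intros (t & H)]; eauto.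
  - apply sig_ex_nat. intros k.
    destruct (classic (exists t, f t = k)) as [[t0 H0]|H0].
    + apply (sig_iff (E t0)); [|auto]. intros x; split; [eauto|].
      intros (t & H1 & H2). rewrite <- H0 in H1. now apply Hf in H1; subst.
    + apply (sig_iff (fun _ => False)); [|apply sig_const].
      intros x; split; [tauto|]. intros (t & H1 & H2). apply H0. eauto.
Qed.

Lemma sig_all (T : Type) (E : T -> O -> Prop) :
  countable_type T -> (forall t, Sig (E t)) -> Sig (fun x => forall t, E t x).
Proof.
  intros HT HE. apply (sig_iff (fun x => ~ exists t, ~ E t x)).
  - intros x; split; [|firstorder]. intros H t. apply NNPP. firstorder.
  - apply sig_not, sig_ex; auto. intros t. now apply sig_not.
Qed.

Lemma sig_or (E F : O -> Prop) : Sig E -> Sig F -> Sig (fun x => E x \/ F x).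
Proof.
  intros HE HF. apply (sig_iff (fun x => exists b : bool, (if b then E else F) x)).
  - intros x; split; [intros [[] H]; tauto|].
    intros [H|H]; [exists true|exists false]; auto.
  - apply (sig_ex bool (fun b => if b then E else F)); [apply countable_bool|]. intros []; auto.
Qed.

Lemma sig_and (E F : O -> Prop) : Sig E -> Sig F -> Sig (fun x => E x /\ F x).
Proof.
  intros HE HF. apply (sig_iff (fun x => ~ (~ E x \/ ~ F x))); [intros; tauto|].
  apply sig_not, sig_or; now apply sig_not.
Qed.

Lemma sig_imp (E F : O -> Prop) : Sig E -> Sig F -> Sig (fun x => E x -> F x).
Proof.
  intros HE HF. apply (sig_iff (fun x => ~ E x \/ F x)); [intros; tauto|].
  apply sig_or; auto. now apply sig_not.
Qed.

(* Quantification over a proposition [A] occurs for bounded quantifiers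
   [forall i, i < n -> E i x]. *)
Lemma sig_guard (A : Prop) (E : O -> Prop) : (A -> Sig E) -> Sig (fun x => A -> E x).
Proof.
  intros HE. destruct (classic A) as [a|a].
  - apply (sig_iff E); [intros; tauto|auto].
  - apply (sig_iff (fun _ => True)); [intros; tauto|apply sig_const].
Qed.

Lemma sig_guard_and (A : Prop) (E : O -> Prop) : (A -> Sig E) -> Sig (fun x => A /\ E x).
Proof.
  intros HE. destruct (classic A) as [a|a].
  - apply (sig_iff E); [intros; tauto|auto].
  - apply (sig_iff (fun _ => False)); [intros; tauto|apply sig_const].
Qed.
End sigma_algebra.

Ltac cty := solve [eauto using countable_nat, countable_Z, countable_bool,
  countable_prod, countable_list].

(** The guard rules precede [sig_and] and [sig_imp], so that a side condition free of the sample
    point becomes available as a hypothesis for what it guards. *)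
Ltac meas_step HS :=
  match goal with
  | |- forall _, _ => intro
  | |- _ (fun _ => ?A) => apply (sig_const HS A)
  | |- _ (fun _ => ?A -> _) => apply (sig_guard HS A)
  | |- _ (fun _ => ?A /\ _) => apply (sig_guard_and HS A)
  | |- _ (fun _ => _ /\ _) => apply (sig_and HS)
  | |- _ (fun _ => _ \/ _) => apply (sig_or HS)
  | |- _ (fun _ => ~ _) => apply (sig_not HS)
  | |- _ (fun _ => exists _, _) => apply (sig_ex HS); [cty|]
  | |- _ (fun x => @?E x -> @?F x) => apply (sig_imp HS E F)
  | |- _ (fun _ => forall _, _) => apply (sig_all HS); [cty|]
  end.

Ltac meas HS := repeat first [assumption | solve [auto] | meas_step HS].

Lemma is_sigma_generated {O : Type} (G : (O -> Prop) -> Prop) : is_sigma (generated G).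
Proof.
  split; [|split].
  - intros Sg H _. apply H.
  - intros E HE Sg H HG. apply H. now apply HE.
  - intros E HE Sg H HG. apply H. intros k. now apply HE.
Qed.

Lemma generated_base {O : Type} (G : (O -> Prop) -> Prop) E : G E -> generated G E.
Proof. intros H Sg _ HG. auto. Qed.

Lemma generated_sub {O : Type} (G H : (O -> Prop) -> Prop) :
  (forall E, G E -> generated H E) -> forall E, generated G E -> generated H E.
Proof. intros GH E HE. apply HE; auto. apply is_sigma_generated. Qed.

(** The sets whose preimage lies in [Sg] form a sigma-algebra, so generators suffice. *)
Lemma generated_preimage {O U : Type} (f : O -> U) (G : (U -> Prop) -> Prop) Sg :
  is_sigma Sg -> (forall E, G E -> Sg (fun x => E (f x))) ->
  forall E, generated G E -> Sg (fun x => E (f x)).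
Proof.
  intros HS HG E HE. apply (HE (fun E => Sg (fun x => E (f x)))); auto.
  split; [|split].
  - apply HS.
  - intros F HF. apply (sig_not HS); auto.
  - intros F HF. apply (sig_ex_nat HS); auto.
Qed.

(** * Dynkin's lemma *)

Definition is_lambda {O : Type} (L : (O -> Prop) -> Prop) : Prop :=
  L (fun _ => True) /\
  (forall E, L E -> L (fun x => ~ E x)) /\
  (forall E : nat -> (O -> Prop), (forall k, L (E k)) ->
     (forall i j x, i <> j -> E i x -> E j x -> False) -> L (fun x => exists k, E k x)).

Section dynkin.
Context {O : Type}.
Implicit Types (L : (O -> Prop) -> Prop) (E F : O -> Prop).

Lemma lambda_or L E F : is_lambda L -> L E -> L F -> (forall x, E x -> F x -> False) ->
  L (fun x => E x \/ F x).
Proof.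
  intros (L1 & L2 & L3) HE HF D.
  assert (H : L (fun x => exists k, (fun k => match k with 0 => E | 1 => F | _ => fun _ => ~ True end)%nat k x)).
  { apply L3.
    - intros [|[|k]]; auto.
    - intros [|[|i]] [|[|j]] x; simpl; try tauto; try lia; eauto. }
  eapply ev_transfer; [|exact H]. intros x; split.
  - intros [[|[|k]] Hk]; simpl in Hk; tauto.
  - intros [Hx|Hx]; [exists 0%nat|exists 1%nat]; auto.
Qed.

Lemma lambda_diff L E F : is_lambda L -> L E -> L F -> (forall x, F x -> E x) ->
  L (fun x => E x /\ ~ F x).
Proof.
  intros HL HE HF D.
  assert (H : L (fun x => ~ (~ E x \/ F x))).
  { apply (proj1 (proj2 HL)), lambda_or; auto. now apply (proj1 (proj2 HL)). }
  eapply ev_transfer; [|exact H]. intros x; tauto.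
Qed.

(** The least lambda-system [l] over [PI] is stable under intersection, first with members of [PI]
    and then with its own members; this makes it a sigma-algebra. *)
Lemma dynkin (PI L : (O -> Prop) -> Prop) :
  (forall E F, PI E -> PI F -> PI (fun x => E x /\ F x)) ->
  is_lambda L -> (forall E, PI E -> L E) -> forall E, generated PI E -> L E.
Proof.
  intros HPI HL HPL.
  set (l := fun E => forall L', is_lambda L' -> (forall F, PI F -> L' F) -> L' E).
  assert (ll : is_lambda l).
  { split; [|split].
    - intros L' H' _. apply H'.
    - intros E HE L' H' P'. apply H'. now apply HE.
    - intros E HE D L' H' P'. apply H'; auto. intros k. now apply HE. }
  assert (lPI : forall E, PI E -> l E) by (intros E HE L' _ H'; auto).
  assert (sec : forall A, l A -> is_lambda (fun E => l (fun x => A x /\ E x))).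
  { intros A HA. split; [|split].
    - eapply ev_transfer; [|exact HA]. tauto.
    - intros E HE. eapply ev_transfer; [|apply (lambda_diff l A _ ll HA HE); tauto]. tauto.
    - intros E HE D.
      eapply ev_transfer; [|apply (proj2 (proj2 ll) (fun k x => A x /\ E k x) HE)].
      + firstorder.
      + intros i j x ij [_ H1] [_ H2]. eauto. }
  assert (cap1 : forall A E, PI A -> l E -> l (fun x => A x /\ E x)).
  { intros A E HA HE. apply HE; [apply sec; auto|]. intros F HF. apply lPI; auto. }
  assert (cap : forall A E, l A -> l E -> l (fun x => A x /\ E x)).
  { intros A E HA HE. apply HE; [apply sec; auto|]. intros F HF.
    eapply ev_transfer; [|apply (cap1 F A HF HA)]. tauto. }
  intros E HE. apply (HE l); auto.
  split; [apply ll|]. split; [apply ll|].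
  intros F HF.
  (* Removing all earlier sets from [F k] makes the family disjoint, as a lambda-system requires,
     without changing the union. *)
  assert (prev : forall n, l (fun x => forall j, (j < n)%nat -> ~ F j x)).
  { induction n.
    - eapply ev_transfer; [|apply (proj1 ll)]. intros x; split; auto. intros; lia.
    - eapply ev_transfer; [|apply (cap _ _ IHn (proj1 (proj2 ll) _ (HF n)))]. intros x; split.
      + intros [H1 H2] j Hj. destruct (Nat.eq_dec j n) as [->|]; auto. apply H1. lia.
      + intros H; split; auto. }
  eapply ev_transfer;
    [|apply (proj2 (proj2 ll) (fun k x => F k x /\ forall j, (j < k)%nat -> ~ F j x))].
  - intros x; split; [firstorder|].
    intros [k Hk].
    destruct (least_element (fun n => F n x)) as (m & [Hm Hm']).
    + eauto.
    + exists m. split; auto. intros j Hj HF'. apply Hm' in HF'. lia.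
  - intros k. apply cap; auto.
  - intros i j x ij [Hi Hi'] [Hj Hj'].
    destruct (Nat.lt_total i j) as [|[|]]; [eapply Hj'|tauto|eapply Hi']; eauto.
Qed.
End dynkin.

(** * Finite measures *)

(** Real values make such a measure finite. The total mass is left free so that restrictions and
    multiples of a law qualify. *)
Definition is_measure {O : Type} (Sig : (O -> Prop) -> Prop) (m : (O -> Prop) -> R) : Prop :=
  is_sigma Sig /\
  (forall E, Sig E -> 0 <= m E) /\
  (forall E : nat -> (O -> Prop),
      (forall k, Sig (E k)) ->
      (forall i j x, i <> j -> E i x -> E j x -> False) ->
      infinite_sum (fun k => m (E k)) (m (fun x => exists k, E k x))).

Lemma prob_measure {O : Type} (Sig : (O -> Prop) -> Prop) P : is_prob Sig P -> is_measure Sig P.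
Proof. intros (H1 & H2 & H3 & H4). repeat split; auto; apply H1. Qed.

Lemma infinite_sum_ext f g l : (forall n, f n = g n) -> infinite_sum f l -> infinite_sum g l.
Proof. intros H. apply functional_extensionality in H. now subst. Qed.

Lemma infinite_sum_unique f l l' : infinite_sum f l -> infinite_sum f l' -> l = l'.
Proof. apply uniqueness_sum. Qed.

Section measure.
Context {O : Type} {Sig : (O -> Prop) -> Prop} {m : (O -> Prop) -> R} (Hm : is_measure Sig m).
Implicit Types (E F : O -> Prop).

Let HS : is_sigma Sig := proj1 Hm.

Lemma meas_ge0 E : Sig E -> 0 <= m E.
Proof. apply Hm. Qed.

(** The empty set is a countable disjoint union of copies of itself, and a series with constant
    positive terms does not converge. *)
Lemma meas_empty : m (fun _ => False) = 0.
Proof.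
  assert (H : infinite_sum (fun _ => m (fun _ => False)) (m (fun x : O => exists k : nat, False))).
  { apply (proj2 (proj2 Hm) (fun _ _ => False)); [|tauto]. intros _. apply (sig_const HS). }
  replace (fun x : O => exists k : nat, False) with (fun _ : O => False) in H
    by (apply ev_ext; firstorder).
  assert (H0 := meas_ge0 _ (sig_const HS False)).
  set (a := m (fun _ => False)) in *.
  destruct (Req_dec a 0) as [|Ha]; auto. exfalso.
  destruct (H a) as [N HN]; [lra|].
  specialize (HN (S N) ltac:(lia)).
  rewrite sum_cte, !S_INR in HN. unfold Rdist in HN.
  assert (HI := pos_INR N). rewrite Rabs_right in HN; nra.
Qed.

Lemma meas_or E F : Sig E -> Sig F -> (forall x, E x -> F x -> False) ->
  m (fun x => E x \/ F x) = m E + m F.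
Proof.
  intros HE HF D.
  pose (G := fun k : nat => match k with 0 => E | 1 => F | _ => fun _ => False end%nat).
  assert (H : infinite_sum (fun k => m (G k)) (m (fun x => exists k, G k x))).
  { apply Hm.
    - intros [|[|k]]; simpl; auto. apply (sig_const HS).
    - intros [|[|i]] [|[|j]] x; simpl; try tauto; try lia; eauto. }
  replace (fun x => exists k, G k x) with (fun x => E x \/ F x) in H.
  2:{ apply ev_ext. intros x; split.
      - intros [Hx|Hx]; [exists 0%nat|exists 1%nat]; auto.
      - intros [[|[|k]] Hk]; simpl in Hk; tauto. }
  apply (infinite_sum_unique _ _ _ H).
  intros eps He. exists 1%nat. intros n Hn.
  replace (sum_f_R0 (fun k => m (G k)) n) with (m E + m F).
  { unfold Rdist. rewrite Rminus_diag, Rabs_R0. lra. }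
  induction n as [|[|n] IH]; [lia|reflexivity|].
  rewrite tech5, <- IH by lia. simpl. rewrite meas_empty. lra.
Qed.

Lemma meas_split E F : Sig E -> Sig F ->
  m E = m (fun x => E x /\ F x) + m (fun x => E x /\ ~ F x).
Proof.
  intros HE HF. rewrite <- meas_or; [|meas HS..|tauto].
  f_equal. apply ev_ext. intros x; tauto.
Qed.

Lemma meas_mono E F : Sig E -> Sig F -> (forall x, E x -> F x) -> m E <= m F.
Proof.
  intros HE HF H. rewrite (meas_split F E) by auto.
  replace (fun x => F x /\ E x) with E by (apply ev_ext; firstorder).
  assert (0 <= m (fun x => F x /\ ~ E x)); [|lra]. apply meas_ge0. meas HS.
Qed.

Lemma meas_union_le E F : Sig E -> Sig F -> m (fun x => E x \/ F x) <= m E + m F.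
Proof.
  intros HE HF.
  replace (fun x => E x \/ F x) with (fun x => E x \/ (F x /\ ~ E x))
    by (apply ev_ext; intros; tauto).
  rewrite meas_or; [|meas HS..|tauto].
  assert (m (fun x => F x /\ ~ E x) <= m F); [|lra].
  apply meas_mono; [meas HS..|tauto].
Qed.

Lemma meas_null_sub E F : Sig E -> Sig F -> (forall x, E x -> F x) -> m F = 0 -> m E = 0.
Proof.
  intros HE HF H H0. apply Rle_antisym; [|now apply meas_ge0].
  rewrite <- H0. now apply meas_mono.
Qed.

Lemma meas_countable (T : Type) (f : T -> nat) (E : T -> O -> Prop) :
  (forall x y, f x = f y -> x = y) ->
  (forall t, Sig (E t)) -> (forall s t x, s <> t -> E s x -> E t x -> False) ->
  infinite_sum (fun k => m (fun x => exists t, f t = k /\ E t x)) (m (fun x => exists t, E t x)).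
Proof.
  intros Hf HE D.
  replace (fun x => exists t, E t x) with (fun x => exists k, (fun k x => exists t, f t = k /\ E t x) k x).
  2:{ apply ev_ext. intros x; split; [intros (k & t & _ & H)|intros (t & H)]; eauto. }
  apply Hm.
  - intros k. assert (countable_type T) by (now exists f). meas HS.
  - intros i j x ij (s & Hs & Es) (t & Ht & Et). apply (D s t x); congruence.
Qed.

Lemma meas_increasing (A : nat -> O -> Prop) : (forall n : nat, Sig (A n)) -> (forall n x, A n x -> A (S n) x) ->
  Un_cv (fun n => m (A n)) (m (fun x => exists n, A n x)).
Proof.
  intros HE Hinc.
  assert (Hmon : forall i j x, (i <= j)%nat -> A i x -> A j x).
  { intros i j x Hij. induction Hij; auto. }
  (* The increments of the sequence: their partial sums are the values [m (A n)]. *)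
  pose (G := fun k x => A k x /\ forall j, (j < k)%nat -> ~ A j x).
  assert (HG : forall k, Sig (G k)) by (intros k; unfold G; meas HS).
  assert (H : infinite_sum (fun k => m (G k)) (m (fun x => exists k, G k x))).
  { apply Hm; auto. intros i j x ij [Hi Hi'] [Hj Hj'].
    destruct (Nat.lt_total i j) as [|[|]]; [eapply Hj'|tauto|eapply Hi']; eauto. }
  replace (fun x => exists k, G k x) with (fun x => exists k, A k x) in H.
  2:{ apply ev_ext. intros x; split; [|firstorder].
      intros [k Hk].
      destruct (least_element (fun n => A n x)) as (p & [Hp Hp']).
      - eauto.
      - exists p. split; auto. intros j Hj HF'. apply Hp' in HF'. lia. }
  intros eps He. destruct (H eps He) as [N HN]. exists N. intros n Hn.
  replace (m (A n)) with (sum_f_R0 (fun k => m (G k)) n); [now apply HN|].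
  clear N HN Hn. induction n.
  - simpl. f_equal. apply ev_ext. unfold G. intros x; split; [tauto|].
    intros Hx; split; auto. intros; lia.
  - rewrite tech5, IHn, <- meas_or; [|auto|auto|].
    + f_equal. apply ev_ext. intros x. unfold G. split.
      * intros [Hx|[Hx _]]; auto.
      * intros Hx. destruct (classic (A n x)) as [Hn|Hn]; auto. right. split; auto.
        intros j Hj Hx'. apply Hn, (Hmon j n); [lia|auto].
    + intros x Hx [_ Hx']. apply (Hx' n); auto.
Qed.

Lemma meas_decreasing (A : nat -> O -> Prop) : (forall n : nat, Sig (A n)) -> (forall n x, A (S n) x -> A n x) ->
  Un_cv (fun n => m (A n)) (m (fun x => forall n, A n x)).
Proof.
  intros HE Hdec.
  assert (H := meas_increasing (fun n x => ~ A n x) (fun n => sig_not HS _ (HE n)) ltac:(firstorder)).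
  assert (HT : forall E, Sig E -> m E = m (fun _ => True) - m (fun x => ~ E x)).
  { intros E SE. rewrite (meas_split (fun _ => True) E); [|meas HS..].
    replace (fun x => True /\ E x) with E by (apply ev_ext; tauto).
    replace (fun x => True /\ ~ E x) with (fun x => ~ E x) by (apply ev_ext; tauto). lra. }
  rewrite HT by meas HS.
  replace (fun x => ~ forall n, A n x) with (fun x => exists n, ~ A n x).
  2:{ apply ev_ext. intros x; split; [firstorder|]. apply not_all_ex_not. }
  intros eps He. destruct (H eps He) as [N HN]. exists N. intros n Hn.
  rewrite HT by auto. specialize (HN n Hn). unfold Rdist in *.
  replace (_ - _ - _) with (-(m (fun x => ~ A n x) - m (fun x => exists n, ~ A n x))) by lra.
  now rewrite Rabs_Ropp.
Qed.

Lemma meas_scale c : 0 <= c -> is_measure Sig (fun E => c * m E).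
Proof.
  intros Hc. split; [auto|]. split.
  - intros E HE. apply Rmult_le_pos; auto. now apply meas_ge0.
  - intros E HE D. assert (H := proj2 (proj2 Hm) E HE D).
    intros eps He.
    destruct (H (eps / (c + 1))) as [N HN].
    { apply Rdiv_lt_0_compat; lra. }
    exists N. intros n Hn. specialize (HN n Hn). unfold Rdist in *.
    replace (sum_f_R0 (fun k => c * m (E k)) n) with (c * sum_f_R0 (fun k => m (E k)) n)
      by (apply scal_sum_l || (rewrite scal_sum; apply sum_eq; intros; lra)).
    rewrite <- Rmult_minus_distr_l, Rabs_mult, (Rabs_right c) by lra.
    assert (Hp := Rabs_pos (sum_f_R0 (fun k => m (E k)) n - m (fun x => exists k, E k x))).
    apply Rle_lt_trans with (c * (eps / (c + 1))); [apply Rmult_le_compat_l; lra|].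
    apply Rlt_le_trans with ((c + 1) * (eps / (c + 1))).
    + apply Rmult_lt_compat_r; [|lra]. apply Rdiv_lt_0_compat; lra.
    + right. field. lra.
Qed.

Lemma meas_restrict F : Sig F -> is_measure Sig (fun E => m (fun x => E x /\ F x)).
Proof.
  intros HF. split; [auto|]. split.
  - intros E HE. apply meas_ge0. meas HS.
  - intros E HE D.
    replace (fun x => (exists k, E k x) /\ F x) with (fun x => exists k, (fun k x => E k x /\ F x) k x)
      by (apply ev_ext; firstorder).
    apply Hm; [intros; meas HS|]. intros i j x ij [H1 _] [H2 _]. eauto.
Qed.

Lemma meas_image {U : Type} (SU : (U -> Prop) -> Prop) (f : O -> U) :
  is_sigma SU -> (forall E : U -> Prop, SU E -> Sig (fun x => E (f x))) ->
  is_measure SU (fun E : U -> Prop => m (fun x => E (f x))).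
Proof.
  intros H1 H2. split; [auto|]. split.
  - intros E HE. apply meas_ge0; auto.
  - intros E HE D. apply (proj2 (proj2 Hm) (fun k x => E k (f x))); [auto|].
    intros i j x ij Hi Hj. eauto.
Qed.
End measure.

(** Transfers equality from the cells of two countable partitions, possibly on different spaces, to
    the unions. Both sums run over codes; a code without an index contributes an empty set on either
    side. *)
Lemma meas_partition {O1 O2 T : Type} {Sig1 : (O1 -> Prop) -> Prop} {m1}
  {Sig2 : (O2 -> Prop) -> Prop} {m2} (E : T -> O1 -> Prop) (F : T -> O2 -> Prop) :
  is_measure Sig1 m1 -> is_measure Sig2 m2 -> countable_type T ->
  (forall t, Sig1 (E t)) -> (forall s t x, s <> t -> E s x -> E t x -> False) ->
  (forall t, Sig2 (F t)) -> (forall s t x, s <> t -> F s x -> F t x -> False) ->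
  (forall t, m1 (E t) = m2 (F t)) ->
  m1 (fun x => exists t, E t x) = m2 (fun x => exists t, F t x).
Proof.
  intros H1 H2 [f Hf] HE DE HF DF H.
  apply (infinite_sum_unique (fun k => m1 (fun x => exists t, f t = k /\ E t x))).
  - now apply (meas_countable H1).
  - eapply infinite_sum_ext; [|apply (meas_countable H2 _ f); eauto].
    intros k. simpl. destruct (classic (exists t, f t = k)) as [[t0 H0]|H0].
    + replace (fun x => exists t, f t = k /\ E t x) with (E t0).
      * replace (fun x => exists t, f t = k /\ F t x) with (F t0); [now rewrite H|].
        apply ev_ext. intros x; split; [eauto|]. intros (t & Ht & Hx).
        rewrite <- H0 in Ht. now apply Hf in Ht; subst.
      * apply ev_ext. intros x; split; [eauto|]. intros (t & Ht & Hx).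
        rewrite <- H0 in Ht. now apply Hf in Ht; subst.
    + replace (fun x => exists t, f t = k /\ E t x) with (fun _ : O1 => False)
        by (apply ev_ext; firstorder).
      replace (fun x => exists t, f t = k /\ F t x) with (fun _ : O2 => False)
        by (apply ev_ext; firstorder).
      now rewrite (meas_empty H1), (meas_empty H2).
Qed.

Lemma meas_null_countable {O T : Type} {Sig : (O -> Prop) -> Prop} {m} (E : T -> O -> Prop) :
  is_measure Sig m -> countable_type T -> (forall t, Sig (E t)) ->
  (forall t, m (E t) = 0) -> m (fun x => exists t, E t x) = 0.
Proof.
  intros Hm [f Hf] HE H0. assert (HS := proj1 Hm).
  assert (HT : countable_type T) by (now exists f).
  (* Additivity needs disjoint sets: each point is assigned to the index with the smallest code. *)
  pose (G := fun t x => E t x /\ forall s, (f s < f t)%nat -> ~ E s x).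
  assert (HG : forall t, Sig (G t)) by (intros t; unfold G; meas HS).
  replace (fun x => exists t, E t x) with (fun x => exists t, G t x).
  - transitivity (m (fun x => exists t : T, False)).
    + apply (meas_partition G (fun _ _ => False) Hm Hm HT); auto; try tauto.
      * intros s t x st [Hs Hs'] [Ht Ht'].
        destruct (Nat.lt_total (f s) (f t)) as [|[|]]; [eapply Ht'|auto|eapply Hs']; eauto.
      * intros _. apply (sig_const HS).
      * intros t. rewrite (meas_empty Hm). apply (meas_null_sub Hm _ (E t)); auto. firstorder.
    + replace (fun _ : O => exists t : T, False) with (fun _ : O => False)
        by (apply ev_ext; firstorder).
      apply (meas_empty Hm).
  - apply ev_ext. intros x; split; [firstorder|]. intros [t Ht].
    destruct (least_element (fun n => exists s, f s = n /\ E s x))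
      as (p & [(s & Hs & Es) Hp']).
    + eauto.
    + exists s. split; auto. intros s' Hs' Es'.
      assert (p <= f s')%nat by eauto. lia.
Qed.

Lemma meas_unique {O : Type} (PI : (O -> Prop) -> Prop) Sig (m1 m2 : (O -> Prop) -> R) :
  is_measure Sig m1 -> is_measure Sig m2 ->
  (forall E, PI E -> Sig E) ->
  (forall E F, PI E -> PI F -> PI (fun x => E x /\ F x)) ->
  m1 (fun _ => True) = m2 (fun _ => True) ->
  (forall E, PI E -> m1 E = m2 E) -> forall E, generated PI E -> m1 E = m2 E.
Proof.
  intros H1 H2 HPS HPI HT HE E GE. assert (HS := proj1 H1).
  enough (H : Sig E /\ m1 E = m2 E) by apply H.
  apply (dynkin PI (fun E => Sig E /\ m1 E = m2 E)); auto.
  split; [|split].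
  - split; auto. apply HS.
  - intros F [HF HF']. split; [meas HS|].
    assert (A1 := meas_split H1 (fun _ => True) F ltac:(meas HS) HF).
    assert (A2 := meas_split H2 (fun _ => True) F ltac:(meas HS) HF).
    cbv beta in A1, A2.
    replace (fun x => True /\ F x) with F in A1, A2 by (apply ev_ext; tauto).
    replace (fun x => True /\ ~ F x) with (fun x => ~ F x) in A1, A2 by (apply ev_ext; tauto). lra.
  - intros F HF D. split; [apply (sig_ex_nat HS); firstorder|].
    apply (infinite_sum_unique (fun k => m1 (F k))).
    + apply H1; firstorder.
    + apply (infinite_sum_ext (fun k => m2 (F k))); [intros; symmetry; apply HF|].
      apply H2; firstorder.
Qed.

(** * Independent fair bits *)

Definition bit_weight (B : bool -> Prop) : R :=
  ((if excluded_middle_informative (B true) then 1 else 0) +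
   (if excluded_middle_informative (B false) then 1 else 0)) / 2.

Fixpoint rprod (f : nat -> R) (n : nat) : R :=
  match n with 0%nat => 1 | S n => rprod f n * f n end.

Lemma rprod_ext f g n : (forall k, (k < n)%nat -> f k = g k) -> rprod f n = rprod g n.
Proof. induction n; simpl; intros H; auto. rewrite H, IHn; auto. Qed.

Lemma rprod_update f g j c n : (j < n)%nat -> g j = c * f j ->
  (forall k, k <> j -> g k = f k) -> rprod g n = c * rprod f n.
Proof.
  induction n; intros H1 H2 H3; [lia|]. simpl.
  destruct (Nat.eq_dec j n) as [->|].
  - rewrite H2, (rprod_ext g f); [ring|]. intros; apply H3; lia.
  - rewrite IHn, H3 by (auto; lia). ring.
Qed.


Definition coord_sigma {A : Type} (SigA : (A -> Prop) -> Prop) (D : Z -> Prop)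
  : ((Z -> A) -> Prop) -> Prop :=
  generated (fun E => exists (n : Z) (C : A -> Prop), D n /\ SigA C /\ forall y, E y <-> C (y n)).

Definition stream_sigma : ((nat -> bool) -> Prop) -> Prop :=
  generated (fun E => exists j (B : bool -> Prop), forall a, E a <-> B (a j)).

Fixpoint stream_partial (m : nat) (a : nat -> bool) : R :=
  match m with
  | 0%nat => 0
  | S m => (if a 0%nat then / 2 else 0) + / 2 * stream_partial m (fun j => a (S j))
  end.

Lemma stream_partial_step m a :
  stream_partial m a <= stream_partial (S m) a <= stream_partial m a + (/ 2) ^ (S m).
Proof.
  revert a. induction m; intros a.
  - simpl. destruct (a 0%nat); lra.
  - specialize (IHm (fun j => a (S j))). simpl in *. lra.
Qed.

Lemma stream_partial_mono m k a : (m <= k)%nat ->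
  stream_partial m a <= stream_partial k a <= stream_partial m a + (/ 2) ^ m - (/ 2) ^ k.
Proof.
  induction 1; [lra|]. assert (H1 := stream_partial_step m0 a). simpl pow in H1. simpl pow. lra.
Qed.

(** The real number with binary digits [a]: [epsilon] picks the limit of the partial sums, which
    converge by monotonicity. *)
Definition stream_value (a : nat -> bool) : R :=
  epsilon (inhabits 0) (Un_cv (fun m => stream_partial m a)).

Lemma stream_value_cv a : Un_cv (fun m => stream_partial m a) (stream_value a).
Proof.
  apply (epsilon_spec (inhabits 0) (Un_cv (fun m => stream_partial m a))).
  destruct (growing_cv (fun m => stream_partial m a)) as [l Hl]; [| |eauto].
  - intros m. apply stream_partial_step.
  - exists 1. intros x [m ->]. assert (H := stream_partial_mono 0 m a ltac:(lia)).
    assert (0 < (/ 2) ^ m) by (apply pow_lt; lra). simpl in H. lra.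
Qed.

Lemma stream_value_bounds m a :
  stream_partial m a <= stream_value a <= stream_partial m a + (/ 2) ^ m.
Proof.
  assert (H := stream_value_cv a). split.
  - apply Rnot_lt_le. intros H1. destruct (H (stream_partial m a - stream_value a)) as [N HN]; [lra|].
    specialize (HN (m + N)%nat ltac:(lia)). apply Rabs_def2 in HN.
    assert (H2 := stream_partial_mono m (m + N) a ltac:(lia)). lra.
  - apply Rnot_lt_le. intros H1.
    destruct (H (stream_value a - (stream_partial m a + (/ 2) ^ m))) as [N HN]; [lra|].
    specialize (HN (m + N)%nat ltac:(lia)). apply Rabs_def2 in HN.
    assert (H2 := stream_partial_mono m (m + N) a ltac:(lia)).
    assert (0 < (/ 2) ^ (m + N)) by (apply pow_lt; lra). lra.
Qed.

Lemma stream_value_ge0 a : 0 <= stream_value a.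
Proof. apply (stream_value_bounds 0). Qed.

Lemma stream_partial_measurable m y : stream_sigma (fun a => stream_partial m a < y).
Proof.
  assert (HS : is_sigma stream_sigma) by apply is_sigma_generated.
  (* The recursion in [stream_partial] shifts the stream, so the induction must allow every offset
     [o]. *)
  enough (H : forall o y, stream_sigma (fun a => stream_partial m (fun j => a (o + j)%nat) < y))
    by apply (H 0%nat).
  clear y. induction m; intros o y; simpl; [apply (sig_const HS)|].
  apply (sig_iff (fun a : nat -> bool =>
    (a o = true /\ stream_partial m (fun j => a (S o + j)%nat) < 2 * y - 1) \/
    (a o = false /\ stream_partial m (fun j => a (S o + j)%nat) < 2 * y))).
  - intros a. rewrite Nat.add_0_r.
    replace (fun j => a (o + S j)%nat) with (fun j => a (S o + j)%nat)
      by (apply functional_extensionality; intros j; now rewrite Nat.add_succ_r).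
    destruct (a o); intuition (try congruence; lra).
  - assert (Hbit : forall e, stream_sigma (fun a => a o = e)).
    { intros e. apply generated_base. exists o, (fun e' => e' = e). tauto. }
    apply (sig_or HS); apply (sig_and HS); auto.
Qed.

Lemma stream_value_measurable x : stream_sigma (fun a => stream_value a < x).
Proof.
  assert (HS : is_sigma stream_sigma) by apply is_sigma_generated.
  apply (sig_iff (fun a => exists m, stream_partial m a < x - (/ 2) ^ m)).
  - intros a. split.
    + intros [m Hm]. assert (H := stream_value_bounds m a). lra.
    + intros Ha. destruct (pow_lt_1_zero (/ 2)) with (y := x - stream_value a) as [m Hm'].
      { rewrite Rabs_right; lra. }
      { lra. }
      specialize (Hm' m (Nat.le_refl _)).
      assert (Hp : 0 < (/ 2) ^ m) by (apply pow_lt; lra).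
      rewrite Rabs_right in Hm' by lra.
      exists m. assert (H := stream_value_bounds m a). lra.
  - apply (sig_ex HS); [cty|]. intros m. apply stream_partial_measurable.
Qed.

(** The distribution function of the uniform law on [[0, 1]]. *)
Definition clamp (x : R) : R := Rmax 0 (Rmin 1 x).

Lemma clamp_low x : x <= 0 -> clamp x = 0.
Proof. intros. unfold clamp. rewrite (Rmin_right 1 x), Rmax_left; lra. Qed.

Lemma clamp_high x : 1 <= x -> clamp x = 1.
Proof. intros. unfold clamp. rewrite (Rmin_left 1 x), Rmax_right; lra. Qed.

Lemma clamp_mid x : 0 <= x <= 1 -> clamp x = x.
Proof. intros. unfold clamp. rewrite (Rmin_right 1 x), Rmax_right; lra. Qed.

Lemma clamp_ge x : x <= 1 -> x <= clamp x.
Proof. intros. unfold clamp. rewrite (Rmin_right 1 x) by lra. apply Rmax_r. Qed.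

Lemma clamp_le x : 0 <= x -> clamp x <= x.
Proof. intros. unfold clamp. apply Rmax_lub; [lra|apply Rmin_r]. Qed.

(** Self-similarity of the uniform law: given its first binary digit, twice the variable, minus one
    if that digit is one, is uniform again. *)
Lemma clamp_halves x : clamp x = / 2 * clamp (2 * x - 1) + / 2 * clamp (2 * x).
Proof.
  destruct (Rle_dec x 0); [rewrite !clamp_low; lra|].
  destruct (Rle_dec 1 x); [rewrite !clamp_high; lra|].
  destruct (Rle_dec (2 * x) 1).
  - rewrite (clamp_low (2 * x - 1)), !clamp_mid; lra.
  - rewrite (clamp_high (2 * x)), !clamp_mid; lra.
Qed.

Section bits.
Context {O : Type} {Sig : (O -> Prop) -> Prop} {P : (O -> Prop) -> R} {b : nat -> O -> bool}.
Context (HP : is_prob Sig P) (Hb : forall k e, Sig (fun x => b k x = e)).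
Context (Hfair : forall (m : nat) (e : nat -> bool),
  P (fun x => forall k, (k < m)%nat -> b k x = e k) = (/ 2) ^ m).

Let HS : is_sigma Sig := proj1 HP.
Let Hm : is_measure Sig P := prob_measure Sig P HP.

Lemma bit_measurable k (B : bool -> Prop) : Sig (fun x => B (b k x)).
Proof.
  apply (sig_iff (fun x => exists e, b k x = e /\ B e)).
  - intros x; split; [intros (e & He & HB); now subst|eauto].
  - meas HS.
Qed.

Lemma segment_measurable (B : nat -> bool -> Prop) m :
  Sig (fun x => forall k, (k < m)%nat -> B k (b k x)).
Proof. apply (sig_all HS); [cty|]. intros k. apply (sig_guard HS). intros _. apply bit_measurable. Qed.

(** Induction on the number [j] of leading coordinates whose constraint may be arbitrary, all others
    being singletons. For [j = 0] this is the fairness hypothesis; freeing one more coordinate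
    splits the event according to the value of that bit. *)
Lemma segment_prob (B : nat -> bool -> Prop) m :
  P (fun x => forall k, (k < m)%nat -> B k (b k x)) = rprod (fun k => bit_weight (B k)) m.
Proof.
  enough (H : forall j B, (forall k, (j <= k)%nat -> exists e, B k = eq e) ->
    P (fun x => forall k, (k < m)%nat -> B k (b k x)) = rprod (fun k => bit_weight (B k)) m).
  (* Coordinates from [m] on do not enter the event, so they may be frozen to a singleton. *)
  { pose (B' := fun k => if lt_dec k m then B k else eq true).
    rewrite (rprod_ext _ (fun k => bit_weight (B' k))).
    - rewrite <- (H m).
      + f_equal. apply ev_ext. intros x; split; intros H1 k Hk; specialize (H1 k Hk);
          unfold B' in *; destruct (lt_dec k m); auto; lia.
      + intros k Hk. exists true. unfold B'. destruct (lt_dec k m); auto; lia.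
    - intros k Hk. unfold B'. destruct (lt_dec k m); auto; lia. }
  clear B. induction j as [|j IH]; intros B HB.
  - assert (HB' : forall k, exists e, B k = eq e) by (intros; apply HB; lia).
    apply (ClassicalEpsilon.choice (fun k e => B k = eq e)) in HB' as [e He].
    replace (fun x => forall k, (k < m)%nat -> B k (b k x))
      with (fun x => forall k, (k < m)%nat -> b k x = e k).
    + rewrite Hfair. clear HB. induction m; simpl; auto. rewrite IHm, He.
      unfold bit_weight. destruct (e m);
      repeat destruct (excluded_middle_informative _); try congruence; lra.
    + apply ev_ext. intros x; split; intros H k Hk; specialize (H k Hk); rewrite He in *; auto.
  - destruct (le_lt_dec m j) as [Hjm|Hjm].
    { pose (B' := fun k => if lt_dec k m then B k else eq true).
      rewrite (rprod_ext _ (fun k => bit_weight (B' k))).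
      - rewrite <- (IH B').
        + f_equal. apply ev_ext. intros x; split; intros H1 k Hk; specialize (H1 k Hk);
            unfold B' in *; destruct (lt_dec k m); auto; lia.
        + intros k Hk. exists true. unfold B'. destruct (lt_dec k m); auto; lia.
      - intros k Hk. unfold B'. destruct (lt_dec k m); auto; lia. }
    pose (Be := fun e k => if Nat.eq_dec k j then eq e else B k).
    assert (HBe : forall e, P (fun x => forall k, (k < m)%nat -> Be e k (b k x)) =
                  rprod (fun k => bit_weight (Be e k)) m).
    { intros e. apply IH. intros k Hk. unfold Be. destruct (Nat.eq_dec k j); eauto.
      apply HB. lia. }
    pose (g := fun k => if Nat.eq_dec k j then 1 else bit_weight (B k)).
    assert (Hsing : forall e, bit_weight (eq e) = / 2).
    { intros []; unfold bit_weight; repeat destruct (excluded_middle_informative _); try congruence; lra. }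
    assert (HBe' : forall e, rprod (fun k => bit_weight (Be e k)) m = / 2 * rprod g m).
    { intros e. apply (rprod_update _ _ j); auto.
      - unfold Be, g. destruct (Nat.eq_dec j j); [|lia]. rewrite Hsing. lra.
      - intros k Hk. unfold Be, g. now destruct (Nat.eq_dec k j). }
    rewrite (rprod_update g _ j (bit_weight (B j))); auto.
    2:{ unfold g. destruct (Nat.eq_dec j j); [lra|lia]. }
    2:{ intros k Hk. unfold g. now destruct (Nat.eq_dec k j). }
    pose (Ge := fun e x => B j e /\ forall k, (k < m)%nat -> Be e k (b k x)).
    assert (SG : forall e, Sig (Ge e)).
    { intros e. apply (sig_guard_and HS). intros _. apply segment_measurable. }
    replace (fun x => forall k, (k < m)%nat -> B k (b k x))
      with (fun x => Ge true x \/ Ge false x).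
    2:{ apply ev_ext. intros x. unfold Ge, Be. split.
        - intros [[H1 H2]|[H1 H2]] k Hk; specialize (H2 k Hk);
            destruct (Nat.eq_dec k j); subst; auto; congruence.
        - intros H. destruct (b j x) eqn:E; [left|right]; (split; [rewrite <- E; auto|]);
            intros k Hk; destruct (Nat.eq_dec k j); subst; auto. }
    rewrite (meas_or Hm); auto.
    2:{ unfold Ge, Be. intros x [_ H1] [_ H2]. specialize (H1 j Hjm). specialize (H2 j Hjm).
        destruct (Nat.eq_dec j j); [congruence|lia]. }
    assert (HGe : forall e, P (Ge e) = (if excluded_middle_informative (B j e) then 1 else 0) * (/ 2 * rprod g m)).
    { intros e. unfold Ge. destruct (excluded_middle_informative (B j e)) as [HBj|HBj].
      - rewrite <- (HBe' e), <- (HBe e), Rmult_1_l. f_equal. apply ev_ext. tauto.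
      - rewrite Rmult_0_l, <- (meas_empty Hm). f_equal. apply ev_ext. tauto. }
    rewrite !HGe. unfold bit_weight. lra.
Qed.

Definition bits_sigma (D : nat -> Prop) : (O -> Prop) -> Prop :=
  generated (fun E => exists k B, D k /\ forall x, E x <-> B (b k x)).

(** A pi-system of finite cylinders generating [bits_sigma D]; coordinates outside [D] are
    unconstrained. *)
Definition segments (D : nat -> Prop) (E : O -> Prop) : Prop :=
  exists m (B : nat -> bool -> Prop), (forall k e, ~ D k -> B k e) /\
    forall x, E x <-> forall k, (k < m)%nat -> B k (b k x).

Lemma bits_sigma_Sig D E : bits_sigma D E -> Sig E.
Proof.
  intros H. apply H; auto. intros F (k & B & _ & HF).
  apply (sig_iff (fun x => B (b k x))); [firstorder|apply bit_measurable].
Qed.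

Lemma bits_sigma_mono (D D' : nat -> Prop) E :
  (forall k, D k -> D' k) -> bits_sigma D E -> bits_sigma D' E.
Proof.
  intros H. apply generated_sub. intros F (k & B & Hk & HF). apply generated_base.
  exists k, B. auto.
Qed.

Lemma bits_sigma_bit (D : nat -> Prop) k (B : bool -> Prop) : D k -> bits_sigma D (fun x => B (b k x)).
Proof. intros H. apply generated_base. exists k, B. tauto. Qed.

Lemma bits_sigma_segments D E : bits_sigma D E -> generated (segments D) E.
Proof.
  apply generated_sub. intros F (k & B & Hk & HF). apply generated_base.
  exists (S k), (fun j e => j = k -> B e). split.
  - intros j e Hj ->. tauto.
  - intros x. rewrite HF. split; [intros H j _ ->; auto|]. intros H. apply (H k); auto.
Qed.

Lemma segments_Sig D E : segments D E -> Sig E.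
Proof.
  intros (m & B & _ & H).
  apply (sig_iff (fun x => forall k, (k < m)%nat -> B k (b k x))); [firstorder|apply segment_measurable].
Qed.

Lemma segments_cap D E F : segments D E -> segments D F -> segments D (fun x => E x /\ F x).
Proof.
  intros (m & B & HB & HE) (m' & B' & HB' & HF).
  exists (m + m')%nat, (fun k e => ((k < m)%nat -> B k e) /\ ((k < m')%nat -> B' k e)).
  split; [auto|]. intros x. rewrite HE, HF. split.
  - intros [H1 H2] k _. auto.
  - intros H. split; intros k Hk; apply H; lia.
Qed.

Lemma bit_weight_ge0 B : 0 <= bit_weight B.
Proof. unfold bit_weight. repeat destruct (excluded_middle_informative _); lra. Qed.

Lemma bit_weight_full (B : bool -> Prop) : (forall e, B e) -> bit_weight B = 1.
Proof. intros H. unfold bit_weight. repeat destruct (excluded_middle_informative _); try lra; exfalso; auto. Qed.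

Lemma prob_bit k B : P (fun x => B (b k x)) = bit_weight B.
Proof.
  pose (B' := fun j e => j = k -> B e).
  replace (fun x => B (b k x)) with (fun x => forall j, (j < S k)%nat -> B' j (b j x)).
  - rewrite segment_prob. simpl. rewrite (rprod_ext _ (fun _ => 1)).
    + replace (rprod (fun _ => 1) k) with 1 by (clear; induction k; simpl; lra).
      rewrite Rmult_1_l. f_equal. apply functional_extensionality. intros e.
      apply propositional_extensionality. unfold B'. tauto.
    + intros j Hj. apply bit_weight_full. unfold B'. intros; lia.
  - apply ev_ext. intros x. unfold B'. split; [intros H; apply (H k); auto|].
    intros H j _ ->. auto.
Qed.

Lemma bit_independent D n E (C : bool -> Prop) : ~ D n -> bits_sigma D E ->
  P (fun x => E x /\ C (b n x)) = P E * bit_weight C.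
Proof.
  intros Hn HE. rewrite Rmult_comm.
  assert (HT : P (fun _ => True) = 1) by apply HP.
  apply (meas_unique (segments D) Sig (fun E => P (fun x => E x /\ C (b n x)))
    (fun E => bit_weight C * P E)).
  - apply (meas_restrict Hm). apply bit_measurable.
  - apply (meas_scale Hm). apply bit_weight_ge0.
  - apply segments_Sig.
  - apply segments_cap.
  - rewrite HT. replace (fun x => True /\ C (b n x)) with (fun x => C (b n x)) by (apply ev_ext; tauto).
    rewrite prob_bit. lra.
  - intros F (m & B & HB & HF). rewrite (ev_ext _ _ HF).
    (* Both cylinders are padded to the common length [m + S n], so that coordinate [n] lies in the
       product and only its factor differs. *)
    pose (B1 := fun k e => (k < m)%nat -> B k e).
    pose (B2 := fun k e => ((k < m)%nat -> B k e) /\ (k = n -> C e)).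
    replace (fun x => forall k, (k < m)%nat -> B k (b k x))
      with (fun x => forall k, (k < m + S n)%nat -> B1 k (b k x)).
    2:{ apply ev_ext. intros x. unfold B1. split; auto. intros H k Hk. apply H; lia. }
    replace (fun x => _ /\ C (b n x))
      with (fun x => forall k, (k < m + S n)%nat -> B2 k (b k x)).
    2:{ apply ev_ext. intros x. unfold B1, B2. split.
        - intros H. split; [intros k Hk; apply H; lia|]. apply (H n); lia.
        - intros [H1 H2] k Hk. split; [auto|]. now intros ->. }
    rewrite !segment_prob. apply (rprod_update _ _ n); [lia| |].
    + replace (bit_weight (B1 n)) with 1.
      * rewrite Rmult_1_r. f_equal. apply functional_extensionality. intros e.
        apply propositional_extensionality. unfold B2. split; [tauto|]. auto.
      * symmetry. apply bit_weight_full. unfold B1. auto.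
    + intros k Hk. f_equal. apply functional_extensionality. intros e.
      apply propositional_extensionality. unfold B1, B2. split; [tauto|]. intros H; split; [auto|lia].
  - now apply bits_sigma_segments.
Qed.

(** The uniqueness of measures reduces [F] to a cylinder over [D']; its bits are then peeled off one
    at a time with [bit_independent]. *)
Lemma bits_independent D D' E F : (forall k, D k -> D' k -> False) ->
  bits_sigma D E -> bits_sigma D' F -> P (fun x => E x /\ F x) = P E * P F.
Proof.
  intros HD HE HF.
  assert (SE := bits_sigma_Sig _ _ HE).
  assert (HT : P (fun _ => True) = 1) by apply HP.
  transitivity (P (fun x => F x /\ E x)); [f_equal; apply ev_ext; tauto|].
  apply (meas_unique (segments D') Sig (fun F => P (fun x => F x /\ E x)) (fun F => P E * P F)).
  - apply (meas_restrict Hm); auto.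
  - apply (meas_scale Hm). now apply (meas_ge0 Hm).
  - apply segments_Sig.
  - apply segments_cap.
  - rewrite HT. replace (fun x => True /\ E x) with E by (apply ev_ext; tauto). lra.
  - intros G (m & B & HB & HG). rewrite (ev_ext _ _ HG). clear G HG.
    (* The coordinates used by [E] together with the first [m] bits of the cylinder: bit [m] of [D']
       is still outside. *)
    pose (Dm := fun m k => D k \/ (D' k /\ (k < m)%nat)).
    assert (HX : forall m, bits_sigma (Dm m) (fun x => (forall k, (k < m)%nat -> B k (b k x)) /\ E x)).
    { intros j. assert (HS' := is_sigma_generated (fun E => exists k B, Dm j k /\ forall x, E x <-> B (b k x))).
      apply (sig_and HS').
      - apply (sig_all HS'); [cty|]. intros k. apply (sig_guard HS'). intros Hk.
        destruct (classic (D' k)) as [Hk'|Hk'].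
        + apply bits_sigma_bit. right; auto.
        + apply (sig_iff (fun _ => True)); [|apply (sig_const HS')].
          intros x; split; auto.
      - apply (bits_sigma_mono D); auto. unfold Dm. auto. }
    assert (HX0 : forall m, bits_sigma (fun k => D' k /\ (k < m)%nat)
                    (fun x => forall k, (k < m)%nat -> B k (b k x))).
    { intros j.
      assert (HS' := is_sigma_generated
        (fun E => exists k B, (D' k /\ (k < j)%nat) /\ forall x, E x <-> B (b k x))).
      apply (sig_all HS'); [cty|]. intros k. apply (sig_guard HS'). intros Hk.
      destruct (classic (D' k)) as [Hk'|Hk'].
      - apply bits_sigma_bit. auto.
      - apply (sig_iff (fun _ => True)); [|apply (sig_const HS')]. intros x; split; auto. }
    pose (seg := fun m x => forall k, (k < m)%nat -> B k (b k x)).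
    change (P (fun x => seg m x /\ E x) = P E * P (seg m)).
    induction m.
    + replace (seg 0%nat) with (fun _ : O => True)
        by (apply ev_ext; intros x; split; auto; intros _ k Hk; lia).
      rewrite HT, Rmult_1_r. f_equal. apply ev_ext. tauto.
    + replace (seg (S m)) with (fun x => seg m x /\ B m (b m x)).
      2:{ apply ev_ext. intros x; split; [|intros H; split; [intros k Hk|]; apply H; lia].
          intros [H1 H2] k Hk. destruct (Nat.eq_dec k m); subst; auto. apply H1; lia. }
      destruct (classic (D' m)) as [Hk'|Hk'].
      * rewrite (bit_independent (fun k => D' k /\ (k < m)%nat) m (seg m)); [|lia|apply HX0].
        transitivity (P (fun x => (seg m x /\ E x) /\ B m (b m x))).
        { f_equal. apply ev_ext. intros; tauto. }
        rewrite (bit_independent (Dm m) m (fun x => seg m x /\ E x)); [|unfold Dm|apply HX].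
        -- rewrite IHm. lra.
        -- intros [H|H]; [eauto|lia].
      * transitivity (P (fun x => seg m x /\ E x)).
        { f_equal. apply ev_ext. intros x. assert (B m (b m x)) by auto. tauto. }
        rewrite IHm. do 2 f_equal. apply ev_ext. intros x. assert (B m (b m x)) by auto. tauto.
  - now apply bits_sigma_segments.
Qed.

Context {code : Z * nat -> nat} (Hcode : forall p q, code p = code q -> p = q).

(** A single sequence of fair bits supplies every site with its own infinite stream: [code] is
    injective, so no bit is used twice. *)
Definition bit_stream (x : O) : Z -> nat -> bool := fun n j => b (code (n, j)) x.

Lemma coord_bits D E : coord_sigma stream_sigma D E ->
  bits_sigma (fun k => exists n j, D n /\ k = code (n, j)) (fun x => E (bit_stream x)).
Proof.
  apply (generated_preimage bit_stream); [apply is_sigma_generated|].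
  intros F (n & C & Hn & HC & HF).
  apply (ev_transfer _ (fun x => C (bit_stream x n))); [firstorder|].
  revert HC. apply (generated_preimage (fun x => bit_stream x n)); [apply is_sigma_generated|].
  intros G (j & B & HG).
  apply (ev_transfer _ (fun x => B (b (code (n, j)) x))); [intros x; now rewrite HG|].
  apply bits_sigma_bit. eauto.
Qed.

Lemma coord_sigma_all (A : Type) (SigA : (A -> Prop) -> Prop) D E :
  coord_sigma SigA D E -> prod_sigma SigA E.
Proof.
  apply generated_sub. intros F (n & C & _ & HC & HF). apply generated_base. eauto.
Qed.

Lemma prod_sigma_coord (A : Type) (SigA : (A -> Prop) -> Prop) E :
  prod_sigma SigA E -> coord_sigma SigA (fun _ => True) E.
Proof.
  apply generated_sub. intros F (n & C & HC & HF). apply generated_base. exists n, C; auto.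
Qed.

Definition stream_prob (E : (Z -> nat -> bool) -> Prop) : R := P (fun x => E (bit_stream x)).

Lemma stream_measurable E : prod_sigma stream_sigma E -> Sig (fun x => E (bit_stream x)).
Proof.
  intros HE. apply prod_sigma_coord in HE. eapply bits_sigma_Sig. apply coord_bits. eauto.
Qed.

Lemma stream_prob_is_prob : is_prob (prod_sigma stream_sigma) stream_prob.
Proof.
  destruct (meas_image Hm (prod_sigma stream_sigma) bit_stream) as (H1 & H2 & H3).
  - apply is_sigma_generated.
  - apply stream_measurable.
  - split; [auto|]. split; [auto|]. split; [|auto]. apply HP.
Qed.

Definition boxes (E : (Z -> nat -> bool) -> Prop) : Prop :=
  exists m (B : Z -> nat -> bool -> Prop),
    forall y, E y <-> forall n j, (code (n, j) < m)%nat -> B n j (y n j).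

Lemma boxes_prod E : boxes E -> prod_sigma stream_sigma E.
Proof.
  intros (m & B & HE). eapply ev_transfer; [intros y; symmetry; apply HE|].
  assert (H1 : is_sigma (prod_sigma (@stream_sigma))) by apply is_sigma_generated.
  unfold prod_sigma. apply (sig_all H1); [cty|]. intros n. apply (sig_all H1); [cty|]. intros j.
  apply (sig_guard H1). intros _. apply generated_base.
  exists n, (fun a => B n j (a j)). split; [|tauto].
  apply generated_base. exists j, (B n j). tauto.
Qed.

Lemma prod_boxes E : prod_sigma stream_sigma E -> generated boxes E.
Proof.
  apply generated_sub. intros F (n & C & HC & HF).
  apply (ev_transfer _ (fun y => C (y n))); [firstorder|].
  revert HC. apply (generated_preimage (fun y : Z -> nat -> bool => y n)); [apply is_sigma_generated|].
  intros G (j & B & HG). apply generated_base.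
  exists (S (code (n, j))), (fun n' j' e => (n', j') = (n, j) -> B e).
  intros y. rewrite HG. split.
  - intros H n' j' _ Hj. injection Hj as -> ->. auto.
  - intros H. apply (H n j); auto.
Qed.

(** Bits are added in the order of their codes; a value that is no code contributes the factor 1.
    The right-hand side does not mention [s], which is shift invariance on boxes. *)
Lemma box_prob (B : Z -> nat -> bool -> Prop) (s : Z) m :
  P (fun x => forall n j, (code (n, j) < m)%nat -> B n j (bit_stream x (s + n)%Z j)) =
  rprod (fun k => bit_weight (fun e => forall n j, code (n, j) = k -> B n j e)) m.
Proof.
  induction m.
  - simpl. replace 1 with (P (fun _ => True)) by apply HP. f_equal. apply ev_ext.
    intros x; split; auto. intros _ n j H; lia.
  - simpl. rewrite <- IHm.
    pose (seg := fun m x => forall n j, (code (n, j) < m)%nat -> B n j (bit_stream x (s + n)%Z j)).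
    fold (seg m). change (P (seg (S m)) =
      P (seg m) * bit_weight (fun e => forall n j, code (n, j) = m -> B n j e)).
    destruct (classic (exists p, code p = m)) as [[[n j] Hp]|Hp].
    + pose (D := fun k => exists n' j', (code (n', j') < m)%nat /\ k = code ((s + n')%Z, j')).
      rewrite <- (bit_independent D (code ((s + n)%Z, j))).
      * f_equal. apply ev_ext. intros x. split.
        -- intros H. split; [intros n' j' Hj; apply H; lia|].
           intros n' j' Hj. rewrite <- Hp in Hj. apply Hcode in Hj. injection Hj as -> ->.
           apply H; lia.
        -- intros [H1 H2] n' j' Hj.
           destruct (Nat.eq_dec (code (n', j')) m) as [Hj'|Hj']; [|apply H1; lia].
           assert (E := H2 n' j' Hj'). rewrite <- Hp in Hj'. apply Hcode in Hj'.
           now injection Hj' as -> ->.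
      * intros (n' & j' & H1 & H2). apply Hcode in H2. injection H2 as H2 ->.
        replace n' with n in H1 by lia. lia.
      * assert (HS' : is_sigma (bits_sigma D)) by apply is_sigma_generated.
        apply (sig_all HS'); [cty|]. intros n'. apply (sig_all HS'); [cty|]. intros j'.
        apply (sig_guard HS'). intros Hk. unfold bit_stream.
        apply (bits_sigma_bit D (code ((s + n')%Z, j')) (B n' j')). exists n', j'; auto.
    + rewrite bit_weight_full; [|intros e n j H; exfalso; eauto].
      rewrite Rmult_1_r. f_equal. apply ev_ext. intros x. split.
      * intros H n j Hj. apply H; lia.
      * intros H n j Hj. apply H. destruct (Nat.eq_dec (code (n, j)) m); [exfalso; eauto|lia].
Qed.

Lemma stream_shift s E : prod_sigma stream_sigma E ->
  stream_prob (fun y => E (fun n => y (s + n)%Z)) = stream_prob E.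
Proof.
  intros HE.
  assert (Hsh : forall E, prod_sigma stream_sigma E ->
    prod_sigma stream_sigma (fun y => E (fun n => y (s + n)%Z))).
  { apply (generated_preimage (fun (y : Z -> nat -> bool) n => y (s + n)%Z));
      [apply is_sigma_generated|].
    intros F (n & C & HC & HF). apply generated_base. exists (s + n)%Z, C. split; auto. }
  apply (meas_unique boxes (prod_sigma stream_sigma)
    (fun E => stream_prob (fun y => E (fun n => y (s + n)%Z))) stream_prob).
  - apply (meas_image (prob_measure _ _ stream_prob_is_prob) (prod_sigma stream_sigma)
      (fun (y : Z -> nat -> bool) n => y (s + n)%Z)); [apply is_sigma_generated|auto].
  - apply prob_measure, stream_prob_is_prob.
  - apply boxes_prod.
  - intros F G (m & B & HF) (m' & B' & HG).
    exists (m + m')%nat, (fun n j e => ((code (n, j) < m)%nat -> B n j e) /\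
      ((code (n, j) < m')%nat -> B' n j e)).
    intros y. rewrite HF, HG. split.
    + intros [H1 H2] n j _. auto.
    + intros H. split; intros n j Hk; apply H; lia.
  - reflexivity.
  - intros F (m & B & HF). rewrite (ev_ext _ _ HF). unfold stream_prob.
    rewrite (box_prob B s m), <- (box_prob B 0 m). reflexivity.
  - now apply prod_boxes.
Qed.

Lemma stream_independent D n E C : ~ D n -> coord_sigma stream_sigma D E -> stream_sigma C ->
  stream_prob (fun y => E y /\ C (y n)) = stream_prob E * stream_prob (fun y => C (y 0%Z)).
Proof.
  intros Hn HE HC.
  assert (HC' : forall i, coord_sigma stream_sigma (eq i) (fun y => C (y i))).
  { intros i. apply generated_base. exists i, C. tauto. }
  rewrite <- (stream_shift n (fun y => C (y 0%Z))).
  2:{ eapply coord_sigma_all. apply HC'. }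
  unfold stream_prob. rewrite Z.add_0_r.
  eapply bits_independent; [|apply coord_bits, HE|apply (coord_bits _ _ (HC' n))].
  intros k (n1 & j1 & H1 & H2) (n2 & j2 & H3 & H4). subst.
  apply Hcode in H4. injection H4 as H4 H5. now subst.
Qed.

(** Conditioning on the first bit gives the recursion of [clamp_halves], in which argument and error
    [2^-m] double together. The offset [off] is the number of bits already consumed. *)
Lemma stream_value_below (x : R) (off m : nat) :
  clamp x <= P (fun w => stream_partial m (fun j => bit_stream w 0%Z (off + j)%nat) < x)
    <= clamp (x + (/ 2) ^ m).
Proof.
  revert x off. induction m as [|m IH]; intros x off.
  - simpl. destruct (Rlt_dec 0 x) as [Hx|Hx].
    + replace (P _) with 1.
      * rewrite (clamp_high (x + 1)) by lra. unfold clamp. split; [|lra].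
        apply Rmax_lub; [lra|apply Rmin_l].
      * symmetry. transitivity (P (fun _ => True)); [f_equal; apply ev_ext; simpl; intros; split; auto|apply HP].
    + replace (P _) with 0.
      * rewrite (clamp_low x) by lra. split; [lra|apply Rmax_l].
      * symmetry. transitivity (P (fun _ => False)); [|apply (meas_empty Hm)].
        f_equal. apply ev_ext; simpl; intros; split; tauto.
  - pose (V := fun w => stream_partial m (fun j => bit_stream w 0%Z (S off + j)%nat)).
    pose (b0 := fun w => b (code (0%Z, off)) w).
    pose (D := fun k => exists j, (off < j)%nat /\ k = code (0%Z, j)).
    assert (HD : ~ D (code (0%Z, off))).
    { intros (j & Hj & H). apply Hcode in H. injection H as ->. lia. }
    assert (HV : forall y, bits_sigma D (fun w => V w < y)).
    { assert (HS' : is_sigma (bits_sigma D)) by apply is_sigma_generated.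
      enough (H : forall m o y, (off < o)%nat ->
        bits_sigma D (fun w => stream_partial m (fun j => bit_stream w 0%Z (o + j)%nat) < y))
        by (intros y; apply H; lia).
      clear - HS'. induction m; intros o y Ho; simpl; [apply (sig_const HS')|].
      apply (sig_iff (fun w =>
        (b (code (0%Z, o)) w = true /\ stream_partial m (fun j => bit_stream w 0%Z (S o + j)%nat) < 2 * y - 1) \/
        (b (code (0%Z, o)) w = false /\ stream_partial m (fun j => bit_stream w 0%Z (S o + j)%nat) < 2 * y))).
      - intros w. unfold bit_stream. rewrite Nat.add_0_r.
        replace (fun j => b (code (0%Z, (o + S j)%nat)) w)
          with (fun j => b (code (0%Z, (S o + j)%nat)) w)
          by (apply functional_extensionality; intros j; now rewrite Nat.add_succ_r).
        destruct (b (code (0%Z, o)) w); intuition (try congruence; lra).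
      - assert (Hbit : forall e, bits_sigma D (fun w => b (code (0%Z, o)) w = e)).
        { intros e. apply (bits_sigma_bit D _ (fun e' => e' = e)). exists o; auto. }
        apply (sig_or HS'); apply (sig_and HS'); auto; apply IHm; lia. }
    assert (SV : forall y, Sig (fun w => V w < y)) by (intros; eapply bits_sigma_Sig; apply HV).
    assert (Hbit : forall e, Sig (fun w => b0 w = e)) by (intros; apply Hb).
    assert (HF : P (fun w => stream_partial (S m) (fun j => bit_stream w 0%Z (off + j)%nat) < x) =
      / 2 * P (fun w => V w < 2 * x - 1) + / 2 * P (fun w => V w < 2 * x)).
    { assert (Hw : forall e y, P (fun w => V w < y /\ b0 w = e) = P (fun w => V w < y) * / 2).
      { intros e y. unfold b0. rewrite (bit_independent D (code (0%Z, off)) (fun w => V w < y) (fun e' => e' = e)); auto.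
        f_equal. unfold bit_weight. destruct e;
          repeat destruct (excluded_middle_informative _); try congruence; lra. }
      replace (fun w => stream_partial (S m) (fun j => bit_stream w 0%Z (off + j)%nat) < x)
        with (fun w => (V w < 2 * x - 1 /\ b0 w = true) \/ (V w < 2 * x /\ b0 w = false)).
      - rewrite (meas_or Hm).
        + rewrite !Hw. lra.
        + apply (sig_and HS); auto.
        + apply (sig_and HS); auto.
        + intros w [_ H1] [_ H2]. congruence.
      - apply ev_ext. intros w. simpl. unfold V, b0, bit_stream. rewrite Nat.add_0_r.
        replace (fun j => b (code (0%Z, (off + S j)%nat)) w)
          with (fun j => b (code (0%Z, (S off + j)%nat)) w)
          by (apply functional_extensionality; intros j; now rewrite Nat.add_succ_r).
        destruct (b (code (0%Z, off)) w); intuition (try congruence; lra). }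
    assert (H1 := IH (2 * x - 1) (S off)). assert (H2 := IH (2 * x) (S off)).
    change (fun w => stream_partial m (fun j => bit_stream w 0%Z (S off + j)%nat) < 2 * x - 1)
      with (fun w => V w < 2 * x - 1) in H1.
    change (fun w => stream_partial m (fun j => bit_stream w 0%Z (S off + j)%nat) < 2 * x)
      with (fun w => V w < 2 * x) in H2.
    rewrite HF. simpl pow.
    set (d := (/ 2) ^ m) in *. clearbody d.
    assert (E1 := clamp_halves x). assert (E2 := clamp_halves (x + / 2 * d)).
    replace (2 * (x + / 2 * d) - 1) with (2 * x - 1 + d) in E2 by lra.
    replace (2 * (x + / 2 * d)) with (2 * x + d) in E2 by lra.
    lra.
Qed.

Lemma stream_value_uniform x : 0 <= x <= 1 ->
  stream_prob (fun y => stream_value (y 0%Z) < x) = x.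
Proof.
  intros Hx.
  assert (SV : Sig (fun w => stream_value (bit_stream w 0%Z) < x)).
  { apply (stream_measurable (fun y => stream_value (y 0%Z) < x)).
    apply generated_base. exists 0%Z, (fun a => stream_value a < x). split; [|tauto].
    apply stream_value_measurable. }
  assert (SP : forall m y, Sig (fun w => stream_partial m (bit_stream w 0%Z) < y)).
  { intros m y. apply (stream_measurable (fun z => stream_partial m (z 0%Z) < y)).
    apply generated_base. exists 0%Z, (fun a => stream_partial m a < y). split; [|tauto].
    apply stream_partial_measurable. }
  apply cond_eq. intros eps He.
  destruct (pow_lt_1_zero (/ 2)) with (y := eps) as [m Hm'].
  { rewrite Rabs_right; lra. }
  { exact He. }
  specialize (Hm' m (Nat.le_refl _)).
  assert (Hp : 0 < (/ 2) ^ m) by (apply pow_lt; lra).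
  rewrite Rabs_right in Hm' by lra.
  assert (H1 := proj2 (stream_value_below x 0 m)). assert (H2 := proj1 (stream_value_below (x - (/ 2) ^ m) 0 m)).
  assert (E1 : stream_prob (fun y => stream_value (y 0%Z) < x) <=
    P (fun w => stream_partial m (bit_stream w 0%Z) < x)).
  { apply (meas_mono Hm); auto. intros w Hw.
    assert (H := stream_value_bounds m (bit_stream w 0%Z)). lra. }
  assert (E2 : P (fun w => stream_partial m (bit_stream w 0%Z) < x - (/ 2) ^ m) <=
    stream_prob (fun y => stream_value (y 0%Z) < x)).
  { apply (meas_mono Hm); auto. intros w Hw.
    assert (H := stream_value_bounds m (bit_stream w 0%Z)). lra. }
  change (fun w => stream_partial m (fun j => bit_stream w 0%Z (0 + j)%nat) < x)
    with (fun w => stream_partial m (bit_stream w 0%Z) < x) in H1.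
  change (fun w => stream_partial m (fun j => bit_stream w 0%Z (0 + j)%nat) < x - (/ 2) ^ m)
    with (fun w => stream_partial m (bit_stream w 0%Z) < x - (/ 2) ^ m) in H2.
  assert (H3 := clamp_le (x + (/ 2) ^ m) ltac:(lra)).
  assert (H4 := clamp_ge (x - (/ 2) ^ m) ltac:(lra)).
  apply Rabs_def1; lra.
Qed.
End bits.

(** The interface to the randomness: everything below uses only these properties of the source, not
    its construction from bits. *)
Lemma uniform_sequence : exists (A : Type) (SigA : (A -> Prop) -> Prop)
    (Q : ((Z -> A) -> Prop) -> R) (U : A -> R),
  is_sigma SigA /\ is_prob (prod_sigma SigA) Q /\
  (forall s E, prod_sigma SigA E -> Q (fun y => E (fun n => y (s + n)%Z)) = Q E) /\
  (forall (D : Z -> Prop) n E C, ~ D n -> coord_sigma SigA D E -> SigA C ->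
    Q (fun y => E y /\ C (y n)) = Q E * Q (fun y => C (y 0%Z))) /\
  (forall x, SigA (fun a => U a < x)) /\ (forall a, 0 <= U a) /\
  (forall x, 0 <= x <= 1 -> Q (fun y => U (y 0%Z) < x) = x).
Proof.
  destruct MC.fair_bits as (O & Sig & P & b & HP & Hb & Hfair).
  destruct (countable_prod Z nat countable_Z countable_nat) as [code Hcode].
  exists (nat -> bool), stream_sigma, (@stream_prob O P b code), stream_value.
  split; [apply is_sigma_generated|].
  split; [apply (stream_prob_is_prob HP Hb)|].
  split; [apply (stream_shift HP Hb Hfair Hcode)|].
  split; [apply (stream_independent HP Hb Hfair Hcode)|].
  split; [apply stream_value_measurable|].
  split; [apply stream_value_ge0|].
  apply (stream_value_uniform HP Hb Hfair Hcode).
Qed.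

(** * Renewals driven by an i.i.d. sequence *)

(* A cycle of the regenerative process: [o] followed by states other than [o].
   Out of range, [nth i w o] is [o], the state at the end of the cycle. *)
Definition is_cycle {St : Type} (o : St) (w : list St) : Prop :=
  (1 <= length w)%nat /\ nth 0 w o = o /\
  forall i, (1 <= i < length w)%nat -> nth i w o <> o.

Section renewal.
Context {A St : Type} (o : St) (U : A -> R) (h : nat -> R) (Sel : nat -> A -> list St -> Prop).
Context (eps eta : R) (n0 : nat).
Context (Sel_cycle : forall t a w, Sel t a w -> is_cycle o w /\ length w = t).
Context (Sel_fun : forall t a w w', Sel t a w -> Sel t a w' -> w = w').
Context (Sel_ex : forall t a, (1 <= t)%nat -> (exists w, Sel t a w) <-> U a < h t).
Context (h_low : forall t, (n0 < t)%nat -> eps <= h t).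
Context (h_high : forall t, (1 <= t <= 2 * n0 + 1)%nat -> h t <= 1 - eta).
Context (eps_eta : eps <= 1 - eta).
Implicit Types (y : Z -> A) (n m : Z) (a j k t : nat) (w : list St).

(* The age is the time since the last renewal; a site of age [a] followed by the value [u]
   renews iff [U u < h (a + 1)]. *)
Definition age_step a (u : A) : nat :=
  if Rlt_dec (U u) (h (S a)) then 0%nat else S a.

Fixpoint run y m a j : nat :=
  match j with
  | 0%nat => a
  | S j => age_step (run y m a j) (y (m + Z.of_nat (S j))%Z)
  end.

(* The first entry sends every age to [0..n0], the next [n0] entries forbid renewals, so that
   all ages are then at least [n0], and the last entry renews all of them. *)
Definition pattern y m : Prop :=
  U (y (m - Z.of_nat (S n0))%Z) < eps /\
  (forall i, (1 <= i <= n0)%nat -> 1 - eta <= U (y (m - Z.of_nat i)%Z)) /\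
  U (y m) < eps.

(** The variable at the end of a cycle has two tasks: being below the threshold [h] causes the
    renewal, and its position below the threshold selects the whole word [w]. *)
Definition cyc y n w : Prop :=
  (forall i, (1 <= i < length w)%nat -> h i <= U (y (n + Z.of_nat i)%Z)) /\
  Sel (length w) (y (n + Z.of_nat (length w))%Z) w.

(** A run from the infinite past is replaced by a run that starts with age 0 at some pattern;
    [age_unique] shows that the choice of the pattern does not matter. *)
Definition age_at y n a : Prop :=
  exists k, pattern y (n - Z.of_nat k)%Z /\ run y (n - Z.of_nat k)%Z 0 k = a.

Definition state_at y n (x : St) : Prop :=
  exists (k j : nat) w, (j < length w)%nat /\ pattern y (n - Z.of_nat j - Z.of_nat k)%Z /\
    run y (n - Z.of_nat j - Z.of_nat k)%Z 0 k = 0%nat /\ cyc y (n - Z.of_nat j)%Z w /\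
    x = nth j w o.

Lemma run_succ y m a j :
  run y m a (S j) = age_step (run y m a j) (y (m + Z.of_nat (S j))%Z).
Proof. reflexivity. Qed.

Lemma run_add y m a j k : run y m a (j + k) = run y (m + Z.of_nat j)%Z (run y m a j) k.
Proof.
  induction k; [now rewrite Nat.add_0_r|].
  rewrite Nat.add_succ_r. simpl. rewrite IHk. do 2 f_equal. lia.
Qed.

Lemma run_no_renewal y m a j :
  (forall i, (1 <= i <= j)%nat -> h (a + i) <= U (y (m + Z.of_nat i)%Z)) -> run y m a j = (a + j)%nat.
Proof.
  induction j; intros H; [simpl; lia|].
  change (age_step (run y m a j) (y (m + Z.of_nat (S j))%Z) = (a + S j)%nat).
  rewrite IHj by (intros; apply H; lia). unfold age_step.
  destruct (Rlt_dec _ _) as [Hl|]; [|lia].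
  specialize (H (S j) ltac:(lia)). rewrite Nat.add_succ_r in H. lra.
Qed.

(** Only hazards at indices up to [2 * n0] are met, and these are at most [1 - eta], hence do not
    exceed the middle entries. *)
Lemma pattern_middle y m a : pattern y m -> (a <= n0)%nat ->
  run y (m - Z.of_nat (S n0))%Z a n0 = (a + n0)%nat.
Proof.
  intros (_ & H & _) Ha. apply run_no_renewal. intros i Hi.
  specialize (H (S n0 - i)%nat ltac:(lia)).
  replace (m - Z.of_nat (S n0) + Z.of_nat i)%Z
    with (m - Z.of_nat (S n0 - i))%Z by lia.
  eapply Rle_trans; [apply h_high; lia|auto].
Qed.

Lemma pattern_end y m a : pattern y m -> (a <= n0)%nat ->
  run y (m - Z.of_nat (S n0))%Z a (S n0) = 0%nat.
Proof.
  intros Hp Ha.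
  change (age_step (run y (m - Z.of_nat (S n0))%Z a n0)
    (y (m - Z.of_nat (S n0) + Z.of_nat (S n0))%Z) = 0%nat).
  rewrite pattern_middle by auto. unfold age_step.
  destruct (Rlt_dec _ _) as [|Hl]; auto. exfalso. apply Hl.
  replace (m - Z.of_nat (S n0) + Z.of_nat (S n0))%Z with m by lia.
  destruct Hp as (_ & _ & H). eapply Rlt_le_trans; [apply H|]. apply h_low. lia.
Qed.

(** At the first entry an age of at least [n0] renews, and a smaller one grows to at most [n0];
    either way [pattern_end] applies. *)
Lemma pattern_resets y m a : pattern y m ->
  run y (m - Z.of_nat (n0 + 2))%Z a (n0 + 2) = 0%nat.
Proof.
  intros Hp. replace (n0 + 2)%nat with (1 + S n0)%nat by lia. rewrite run_add.
  replace (m - Z.of_nat (1 + S n0) + Z.of_nat 1)%Z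
    with (m - Z.of_nat (S n0))%Z by lia.
  apply pattern_end; auto. simpl. unfold age_step.
  destruct (Rlt_dec _ _) as [|Hl]; [lia|].
  destruct (le_lt_dec (S a) n0) as [|Hn]; auto. exfalso. apply Hl.
  destruct Hp as (H & _).
  match goal with |- U (y ?z) < _ => replace z with (m - Z.of_nat (S n0))%Z by lia end.
  eapply Rlt_le_trans; [apply H|]. apply h_low; lia.
Qed.

(** Patterns agree on the age. Far apart, the second one resets; at distance [n0 + 1] its first
    entry is at [m], where the age is already 0; a smaller positive distance would require [U (y m)]
    to be both below [eps] and at least [1 - eta]. *)
Lemma pattern_pattern y m d : pattern y m -> pattern y (m + Z.of_nat d)%Z -> run y m 0 d = 0%nat.
Proof.
  intros H1 H2. destruct (le_lt_dec (n0 + 2) d) as [Hd|Hd].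
  - replace d with ((d - (n0 + 2)) + (n0 + 2))%nat by lia. rewrite run_add.
    replace (m + Z.of_nat (d - (n0 + 2)))%Z with (m + Z.of_nat d - Z.of_nat (n0 + 2))%Z by lia.
    now apply pattern_resets.
  - destruct (Nat.eq_dec d 0) as [->|]; auto.
    destruct (Nat.eq_dec d (S n0)) as [->|Hd'].
    + assert (H := pattern_end y _ 0 H2 ltac:(lia)).
      now replace (m + Z.of_nat (S n0) - Z.of_nat (S n0))%Z with m in H by lia.
    + exfalso. destruct H1 as (_ & _ & H1), H2 as (_ & H2 & _).
      specialize (H2 d ltac:(lia)). replace (m + Z.of_nat d - Z.of_nat d)%Z with m in H2 by lia. lra.
Qed.

Lemma age_unique y n a a' : age_at y n a -> age_at y n a' -> a = a'.
Proof.
  enough (H : forall k k', (k <= k')%nat -> pattern y (n - Z.of_nat k)%Z -> pattern y (n - Z.of_nat k')%Z ->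
    run y (n - Z.of_nat k)%Z 0 k = run y (n - Z.of_nat k')%Z 0 k').
  { intros (k & H1 & H2) (k' & H3 & H4). destruct (le_lt_dec k k').
    - rewrite <- H2, <- H4. now apply H.
    - rewrite <- H2, <- H4. symmetry. apply H; auto. lia. }
  intros k k' Hk H1 H2. replace k' with ((k' - k) + k)%nat at 2 by lia. rewrite run_add.
  replace (n - Z.of_nat k' + Z.of_nat (k' - k))%Z with (n - Z.of_nat k)%Z by lia.
  rewrite (pattern_pattern y (n - Z.of_nat k')%Z); auto.
  now replace (n - Z.of_nat k' + Z.of_nat (k' - k))%Z with (n - Z.of_nat k)%Z by lia.
Qed.

Lemma age_run y n a j : age_at y n a -> age_at y (n + Z.of_nat j)%Z (run y n a j).
Proof.
  intros (k & H1 & H2). exists (k + j)%nat.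
  replace (n + Z.of_nat j - Z.of_nat (k + j))%Z with (n - Z.of_nat k)%Z by lia.
  split; auto. rewrite run_add, H2. f_equal. lia.
Qed.

Lemma age_pattern y m : pattern y m -> age_at y m 0.
Proof. intros H. exists 0%nat. simpl. rewrite Z.sub_0_r. auto. Qed.

Lemma run_last_renewal y m k a : run y m 0 k = a -> (a <= k)%nat /\ run y m 0 (k - a) = 0%nat /\
  forall i, (1 <= i <= a)%nat -> h i <= U (y (m + Z.of_nat (k - a) + Z.of_nat i)%Z).
Proof.
  revert a. induction k; intros a H.
  - simpl in H. subst. repeat split; auto. intros; lia.
  - rewrite run_succ in H. unfold age_step in H. destruct (Rlt_dec _ _) as [Hl|Hl].
    + subst. rewrite Nat.sub_0_r. split; [lia|]. split.
      * rewrite run_succ. unfold age_step. destruct (Rlt_dec _ _); auto. tauto.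
      * intros; lia.
    + destruct (IHk (run y m 0 k) eq_refl) as (H1 & H2 & H3). subst a.
      set (a := run y m 0 k) in *.
      replace (S k - S a)%nat with (k - a)%nat by lia.
      split; [lia|]. split; auto. intros i Hi.
      destruct (Nat.eq_dec i (S a)) as [->|]; [|apply H3; lia].
      replace (m + Z.of_nat (k - a) + Z.of_nat (S a))%Z
        with (m + Z.of_nat (S k))%Z by lia.
      apply Rnot_lt_le. exact Hl.
Qed.

Lemma cyc_run y n w i : cyc y n w -> (i < length w)%nat -> run y n 0 i = i.
Proof. intros [H _] Hi. apply run_no_renewal. intros j Hj. apply H. lia. Qed.

Lemma cyc_end y n w : cyc y n w -> run y n 0 (length w) = 0%nat.
Proof.
  intros Hc. assert (H := proj2 Hc). destruct (Sel_cycle _ _ _ H) as [[Hw _] _].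
  replace (length w) with (S (length w - 1)) at 1 by lia.
  rewrite run_succ, (cyc_run y n w) by (auto; lia). unfold age_step.
  replace (S (length w - 1)) with (length w) by lia.
  destruct (Rlt_dec _ _) as [|Hl]; auto. exfalso. apply Hl, Sel_ex; [lia|].
  exists w. exact H.
Qed.

Lemma cyc_renewal_next y n w : age_at y n 0 -> cyc y n w -> age_at y (n + Z.of_nat (length w))%Z 0.
Proof. intros H1 H2. rewrite <- (cyc_end y n w H2). now apply age_run. Qed.

Lemma state_at_cycle y n w j : age_at y n 0 -> cyc y n w -> (j < length w)%nat ->
  state_at y (n + Z.of_nat j)%Z (nth j w o).
Proof.
  intros (k & H1 & H2) Hc Hj. exists k, j, w.
  replace (n + Z.of_nat j - Z.of_nat j)%Z with n by lia. auto.
Qed.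

(** Both offsets equal the age at [n]. If one word were shorter, its end would be a renewal strictly
    inside the other cycle. Equal lengths leave one site to select the word. *)
Lemma cycle_cover_unique y n w w' j j' :
  age_at y (n - Z.of_nat j)%Z 0 -> cyc y (n - Z.of_nat j)%Z w -> (j < length w)%nat ->
  age_at y (n - Z.of_nat j')%Z 0 -> cyc y (n - Z.of_nat j')%Z w' -> (j' < length w')%nat ->
  j = j' /\ w = w'.
Proof.
  intros H1 H2 H3 H4 H5 H6.
  assert (j = j') as ->.
  { apply (age_unique y n).
    - rewrite <- (cyc_run y (n - Z.of_nat j)%Z w j) by auto.
      replace n with (n - Z.of_nat j + Z.of_nat j)%Z at 1 by lia. now apply age_run.
    - rewrite <- (cyc_run y (n - Z.of_nat j')%Z w' j') by auto.
      replace n with (n - Z.of_nat j' + Z.of_nat j')%Z at 1 by lia. now apply age_run. }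
  split; auto.
  assert (length w = length w') as Hl.
  { destruct (Sel_cycle _ _ _ (proj2 H2)) as [[L _] _], (Sel_cycle _ _ _ (proj2 H5)) as [[L' _] _].
    destruct (Nat.lt_total (length w) (length w')) as [Hl|[|Hl]]; auto; exfalso.
    - assert (E := cyc_end _ _ _ H2). rewrite (cyc_run _ _ w') in E by auto. lia.
    - assert (E := cyc_end _ _ _ H5). rewrite (cyc_run _ _ w) in E by auto. lia. }
  destruct H2 as [_ H2], H5 as [_ H5]. rewrite Hl in H2. eapply Sel_fun; eauto.
Qed.

Lemma state_at_cover y n x : state_at y n x ->
  exists j w, (j < length w)%nat /\ age_at y (n - Z.of_nat j)%Z 0 /\
    cyc y (n - Z.of_nat j)%Z w /\ x = nth j w o.
Proof. intros (k & j & w & H1 & H2 & H3 & H4 & H5). exists j, w. repeat split; auto; try apply H4. now exists k. Qed.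

Lemma state_at_unique y n x x' : state_at y n x -> state_at y n x' -> x = x'.
Proof.
  intros H H'. apply state_at_cover in H as (j & w & H1 & H2 & H3 & ->).
  apply state_at_cover in H' as (j' & w' & H1' & H2' & H3' & ->).
  now destruct (cycle_cover_unique y n w w' j j') as [-> ->].
Qed.

(** The cycle starts at the last renewal up to [n], found by running from the left pattern, and ends
    at the first renewal after [n], which the right pattern forces by [n + d]. *)
Lemma cycle_cover y n (k d : nat) : pattern y (n - Z.of_nat k)%Z -> pattern y (n + Z.of_nat d)%Z -> (1 <= d)%nat ->
  exists j w, (j <= k)%nat /\ (j < length w <= j + d)%nat /\
    run y (n - Z.of_nat k)%Z 0 (k - j) = 0%nat /\ cyc y (n - Z.of_nat j)%Z w.
Proof.
  intros H1 H2 Hd. set (m := (n - Z.of_nat k)%Z) in *.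
  destruct (run_last_renewal y m k _ eq_refl) as (R1 & R2 & R3).
  set (a := run y m 0 k) in *.
  assert (Hex : exists i, (1 <= i <= d)%nat /\ run y n a i = 0%nat).
  { exists d. split; [lia|]. apply (age_unique y (n + Z.of_nat d)%Z); [|now apply age_pattern].
    apply age_run. exists k. auto. }
  destruct (least_element
    (fun i => (1 <= i <= d)%nat /\ run y n a i = 0%nat)) as (p & [(Hp & Hp0) Hmin]);
    [auto|].
  assert (Hrun : forall i, (i < p)%nat -> run y n a i = (a + i)%nat /\
     forall i', (1 <= i' <= i)%nat -> h (a + i') <= U (y (n + Z.of_nat i')%Z)).
  { induction i; intros Hi.
    - split; [simpl; lia|]. intros; lia.
    - destruct IHi as [E1 E2]; [lia|].
      assert (Hn : ~ run y n a (S i) = 0%nat).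
      { intros H. assert (p <= S i)%nat by (apply Hmin; split; [lia|auto]). lia. }
      rewrite run_succ, E1 in Hn. unfold age_step in Hn.
      destruct (Rlt_dec _ _) as [|Hl] in Hn; [tauto|].
      split.
      + rewrite run_succ, E1. unfold age_step. destruct (Rlt_dec _ _); [tauto|lia].
      + intros i' Hi'. destruct (Nat.eq_dec i' (S i)) as [->|]; [|apply E2; lia].
        rewrite Nat.add_succ_r. apply Rnot_lt_le. exact Hl. }
  destruct (Hrun (p - 1)%nat ltac:(lia)) as [E1 E2].
  replace p with (S (p - 1)) in Hp0 by lia. rewrite run_succ, E1 in Hp0.
  unfold age_step in Hp0. destruct (Rlt_dec _ _) as [Hl|] in Hp0; [|lia].
  replace (S (a + (p - 1))) with (a + p)%nat in Hl by lia.
  match goal with [H : U (y ?z) < h _ |- _] => replace z with (n + Z.of_nat p)%Z in H by lia end.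
  apply Sel_ex in Hl; [|lia]. destruct Hl as [w Hw].
  destruct (Sel_cycle _ _ _ Hw) as [_ Hlen].
  exists a, w. split; [auto|]. split; [lia|]. split; [auto|]. split.
  - intros i Hi. rewrite Hlen in Hi. destruct (le_lt_dec i a) as [Hia|Hia].
    + specialize (R3 i ltac:(lia)).
      now replace (m + Z.of_nat (k - a) + Z.of_nat i)%Z with (n - Z.of_nat a + Z.of_nat i)%Z in R3
        by (unfold m; lia).
    + specialize (E2 (i - a)%nat ltac:(lia)).
      replace (a + (i - a))%nat with i in E2 by lia.
      now replace (n - Z.of_nat a + Z.of_nat i)%Z with (n + Z.of_nat (i - a))%Z by lia.
  - rewrite Hlen. now replace (n - Z.of_nat a + Z.of_nat (a + p))%Z with (n + Z.of_nat p)%Z by lia.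
Qed.

Lemma pattern_ext y y' m m' :
  (forall i : Z, (- Z.of_nat (S n0) <= i <= 0)%Z -> y (m + i)%Z = y' (m' + i)%Z) ->
  pattern y m -> pattern y' m'.
Proof.
  intros H (H1 & H2 & H3). unfold pattern.
  assert (E : forall i, (0 <= i <= Z.of_nat (S n0))%Z -> y' (m' - i)%Z = y (m - i)%Z).
  { intros i Hi. unfold Z.sub. symmetry. apply H. lia. }
  split; [|split].
  - rewrite E by lia. auto.
  - intros i Hi. rewrite E by lia. auto.
  - replace m' with (m' - 0)%Z by lia. rewrite E by lia. now rewrite Z.sub_0_r.
Qed.

Lemma run_ext y y' m m' a j :
  (forall i : nat, (1 <= i <= j)%nat -> y (m + Z.of_nat i)%Z = y' (m' + Z.of_nat i)%Z) ->
  run y m a j = run y' m' a j.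
Proof.
  induction j; intros H; auto. rewrite !run_succ, IHj by (intros; apply H; lia).
  f_equal. apply H. lia.
Qed.

Lemma cyc_ext y y' m m' w :
  (forall i : nat, (1 <= i <= length w)%nat -> y (m + Z.of_nat i)%Z = y' (m' + Z.of_nat i)%Z) ->
  cyc y m w -> cyc y' m' w.
Proof.
  intros H [H1 H2]. destruct (Sel_cycle _ _ _ H2) as [[L _] _]. split.
  - intros i Hi. rewrite <- H by lia. auto.
  - rewrite <- H by lia. auto.
Qed.

Lemma state_at_shift y s n x :
  state_at (fun i : Z => y (s + i)%Z) n x <-> state_at y (s + n)%Z x.
Proof.
  split; intros (k & j & w & H1 & H2 & H3 & H4 & H5); exists k, j, w; (split; [auto|]);
    (split; [|split; [|split]]); auto.
  - revert H2. apply pattern_ext. intros i Hi. f_equal. lia.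
  - etransitivity; [|exact H3]. apply run_ext. intros i Hi. f_equal. lia.
  - revert H4. apply cyc_ext. intros i Hi. f_equal. lia.
  - revert H2. apply pattern_ext. intros i Hi. f_equal. lia.
  - etransitivity; [|exact H3]. apply run_ext. intros i Hi. f_equal. lia.
  - revert H4. apply cyc_ext. intros i Hi. f_equal. lia.
Qed.

Lemma age_at_shift y s n a :
  age_at (fun i : Z => y (s + i)%Z) n a <-> age_at y (s + n)%Z a.
Proof.
  split; intros (k & H1 & H2); exists k; split.
  - revert H1. apply pattern_ext. intros i Hi. f_equal. lia.
  - etransitivity; [|exact H2]. apply run_ext. intros i Hi. f_equal. lia.
  - revert H1. apply pattern_ext. intros i Hi. f_equal. lia.
  - etransitivity; [|exact H2]. apply run_ext. intros i Hi. f_equal. lia.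
Qed.

(** * Measurability with respect to the sites in [D], be it the past, a window or all of [Z] *)

Section measurability.
Context {SigA : (A -> Prop) -> Prop} (HSA : is_sigma SigA).
Context (HU : forall x, SigA (fun u => U u < x)) (HSel : forall t w, SigA (fun u => Sel t u w)).
Context (D : Z -> Prop).

Let HS : is_sigma (coord_sigma SigA D).
Proof. apply is_sigma_generated. Qed.

Lemma coord_event i (C : A -> Prop) : D i -> SigA C -> coord_sigma SigA D (fun y => C (y i)).
Proof. intros Hi HC. apply generated_base. exists i, C. tauto. Qed.

Lemma coord_below i x : D i -> coord_sigma SigA D (fun y => U (y i) < x).
Proof. intros Hi. now apply (coord_event i (fun u => U u < x)). Qed.

Lemma coord_above i x : D i -> coord_sigma SigA D (fun y => x <= U (y i)).
Proof.
  intros Hi. apply (sig_iff (fun y => ~ U (y i) < x)).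
  - intros y. split; [apply Rnot_lt_le|apply Rle_not_lt].
  - apply (sig_not HS). now apply coord_below.
Qed.

Lemma pattern_measurable m : (forall i, (m - Z.of_nat (S n0) <= i <= m)%Z -> D i) ->
  coord_sigma SigA D (fun y => pattern y m).
Proof.
  intros H. apply (sig_and HS); [|apply (sig_and HS)].
  - apply coord_below, H. lia.
  - apply (sig_all HS); [cty|]. intros i. apply (sig_guard HS). intros Hi.
    apply coord_above, H. lia.
  - apply coord_below, H. lia.
Qed.

Lemma run_measurable m a j b : (forall i, (m < i <= m + Z.of_nat j)%Z -> D i) ->
  coord_sigma SigA D (fun y => run y m a j = b).
Proof.
  revert b. induction j; intros b H; [simpl; apply (sig_const HS)|].
  apply (sig_iff (fun y => exists c, run y m a j = c /\
    ((U (y (m + Z.of_nat (S j))%Z) < h (S c) /\ 0%nat = b) \/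
     (~ U (y (m + Z.of_nat (S j))%Z) < h (S c) /\ S c = b)))).
  - intros y. change (run y m a (S j)) with
      (age_step (run y m a j) (y (m + Z.of_nat (S j))%Z)).
    unfold age_step. split.
    + intros (c & <- & Hc). destruct (Rlt_dec _ _); tauto.
    + intros Hc. eexists. split; [reflexivity|]. destruct (Rlt_dec _ _); tauto.
  - apply (sig_ex HS); [cty|]. intros c. apply (sig_and HS).
    + apply IHj. intros i Hi. apply H. lia.
    + assert (HC : coord_sigma SigA D (fun y => U (y (m + Z.of_nat (S j))%Z) < h (S c)))
        by (apply coord_below, H; lia).
      meas HS.
Qed.

Lemma cyc_measurable n w : (forall i, (n < i <= n + Z.of_nat (length w))%Z -> D i) ->
  coord_sigma SigA D (fun y => cyc y n w).
Proof.
  intros H. apply (sig_and HS).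
  - apply (sig_all HS); [cty|]. intros i. apply (sig_guard HS). intros Hi.
    apply coord_above, H. lia.
  - destruct w as [|x w].
    + apply (sig_iff (fun _ => False)); [|apply (sig_const HS)].
      intros y. split; [tauto|]. intros HC. apply Sel_cycle in HC as [[L _] _]. simpl in L. lia.
    + apply (coord_event _ (fun u => Sel (length (x :: w)) u (x :: w))); auto. apply H. simpl. lia.
Qed.

Lemma age_at_measurable n a : (forall i, (i <= n)%Z -> D i) -> coord_sigma SigA D (fun y => age_at y n a).
Proof.
  intros H. apply (sig_ex HS); [cty|]. intros k. apply (sig_and HS).
  - apply pattern_measurable. intros i Hi. apply H. lia.
  - apply run_measurable. intros i Hi. apply H. lia.
Qed.
End measurability.
End renewal.

(** * Partial sums, and the selection of a cycle by one uniform variable *)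

Fixpoint rsum (f : nat -> R) (n : nat) : R :=
  match n with 0%nat => 0 | S n => rsum f n + f n end.

Lemma rsum_sum_f f n : rsum f (S n) = sum_f_R0 f n.
Proof. induction n; simpl in *; lra. Qed.

Lemma rsum_mono f m n : (forall k, 0 <= f k) -> (m <= n)%nat -> rsum f m <= rsum f n.
Proof. intros Hf. induction 1; [lra|]. simpl. specialize (Hf m0). lra. Qed.

Lemma rsum_le_sum f l n : (forall k, 0 <= f k) -> infinite_sum f l -> rsum f n <= l.
Proof.
  intros Hf H. apply Rnot_lt_le. intros Hl. destruct (H (rsum f n - l)) as [N HN]; [lra|].
  specialize (HN (n + N)%nat ltac:(lia)). rewrite <- rsum_sum_f in HN.
  apply Rabs_def2 in HN. assert (rsum f n <= rsum f (S (n + N))); [|lra].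
  apply rsum_mono; auto. lia.
Qed.

Lemma rsum_exceeds f l x : infinite_sum f l -> x < l -> exists n, x < rsum f n.
Proof.
  intros H Hl. destruct (H (l - x)) as [N HN]; [lra|].
  exists (S N). specialize (HN N ltac:(lia)). rewrite <- rsum_sum_f in HN.
  apply Rabs_def2 in HN. lra.
Qed.

Section selection.
Context {O : Type} {Sig : (O -> Prop) -> Prop} {P : (O -> Prop) -> R} {St : Type} {M : Z -> O -> St}.
Context (Hm : is_measure Sig P) (HM : forall n x, Sig (fun w => M n w = x)).
Context (code : list St -> nat) (Hcode : forall w w', code w = code w' -> w = w') (o : St).

Let HS : is_sigma Sig := proj1 Hm.

(** For [T] the return time to [o], this is the joint probability of [M_0 = o] and [T >= t]. The
    normalisation by the probability of [o] is left out because it cancels in [hazard]. *)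
Definition tail_prob (t : nat) : R :=
  P (fun w => M 0%Z w = o /\ forall i : nat, (1 <= i < t)%nat -> M (Z.of_nat i) w <> o).

Definition first_prob (t : nat) : R :=
  P (fun w => (M 0%Z w = o /\ forall i : nat, (1 <= i < t)%nat -> M (Z.of_nat i) w <> o) /\
    M (Z.of_nat t) w = o).

Definition cycle_prob (l : list St) : R :=
  P (fun w => forall i, (i <= length l)%nat -> M (Z.of_nat i) w = nth i l o).

Definition hazard (t : nat) : R := first_prob t / tail_prob t.

(** The probability, given [T >= t], that the cycle is the word of length [t] with code [k], and 0
    if there is none. Indexing by codes makes the partial sums the end points of the cells. *)
Definition cell (t k : nat) : R :=
  P (fun w => exists l, code l = k /\ (is_cycle o l /\ length l = t) /\
    forall i, (i <= t)%nat -> M (Z.of_nat i) w = nth i l o) / tail_prob t.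

Context {A : Type} (U : A -> R).

(* The interval [0, hazard t) is cut into consecutive cells, one for each cycle of length [t]. *)
Definition select (t : nat) (u : A) (l : list St) : Prop :=
  (is_cycle o l /\ length l = t) /\
  rsum (cell t) (code l) <= U u < rsum (cell t) (S (code l)).

Context (tail_pos : forall t, 0 < tail_prob t) (U_ge0 : forall u, 0 <= U u).

Lemma cell_ge0 t k : 0 <= cell t k.
Proof.
  apply Rmult_le_pos; [|left; now apply Rinv_0_lt_compat].
  apply (meas_ge0 Hm).
  assert (countable_type (list St)) by (now exists code). meas HS.
Qed.

Lemma path_list (f : nat -> St) n : exists l, length l = n /\ forall i, (i < n)%nat -> nth i l o = f i.
Proof.
  exists (map f (seq 0 n)). split; [now rewrite length_map, length_seq|].
  intros i Hi. rewrite (nth_indep _ o (f 0%nat)) by (now rewrite length_map, length_seq).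
  rewrite map_nth, seq_nth; auto.
Qed.

Lemma nth_list_ext (l l' : list St) : length l = length l' ->
  (forall i, (i < length l)%nat -> nth i l o = nth i l' o) -> l = l'.
Proof. intros H1 H2. apply (nth_ext l l' o o); auto. Qed.

Lemma cell_sum t : (1 <= t)%nat -> infinite_sum (cell t) (hazard t).
Proof.
  intros Ht.
  pose (E := fun l w => (is_cycle o l /\ length l = t) /\
    forall i, (i <= t)%nat -> M (Z.of_nat i) w = nth i l o).
  assert (H : infinite_sum (fun k => P (fun w => exists l, code l = k /\ E l w)) (P (fun w => exists l, E l w))).
  { apply (meas_countable Hm); auto.
    - intros l. unfold E. meas HS.
    - intros l l' w Hl [[_ L1] H1] [[_ L2] H2]. apply Hl.
      apply nth_list_ext; [congruence|]. intros i Hi. rewrite <- H1, <- H2; lia || auto. }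
  replace (P (fun w => exists l, E l w)) with (first_prob t) in H.
  - intros e He. destruct (H (e * tail_prob t)) as [N HN].
    { specialize (tail_pos t). nra. }
    exists N. intros n Hn. specialize (HN n Hn). unfold Rdist in *.
    replace (sum_f_R0 (cell t) n) with (sum_f_R0 (fun k => P (fun w => exists l, code l = k /\ E l w)) n / tail_prob t).
    + unfold hazard. rewrite <- Rdiv_minus_distr. unfold Rdiv.
      rewrite Rabs_mult, (Rabs_right (/ _)).
      * apply (Rmult_lt_reg_r (tail_prob t)); auto.
        rewrite Rmult_assoc, Rinv_l, Rmult_1_r; auto. specialize (tail_pos t). lra.
      * left. now apply Rinv_0_lt_compat.
    + unfold Rdiv. rewrite Rmult_comm, scal_sum. apply sum_eq. intros; reflexivity.
  - unfold first_prob. f_equal. apply ev_ext. intros w. unfold E. split.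
    + intros [[H0 H1] H2]. destruct (path_list (fun i => M (Z.of_nat i) w) t) as (l & L1 & L2).
      exists l. split; [split; [split; [|split]|]|]; auto; try lia.
      * rewrite L2 by lia. auto.
      * intros i Hi. rewrite L2 by lia. apply H1. lia.
      * intros i Hi. destruct (Nat.eq_dec i t) as [->|].
        -- rewrite nth_overflow by lia. auto.
        -- rewrite L2 by lia. auto.
    + intros (l & [(C1 & C2 & C3) L1] & L2). split; [split|].
      * rewrite <- C2. apply (L2 0%nat). lia.
      * intros i Hi. rewrite L2 by lia. apply C3. lia.
      * rewrite L2 by lia. apply nth_overflow. lia.
Qed.

Lemma hazard_ge0 t : (1 <= t)%nat -> 0 <= hazard t.
Proof. intros Ht. exact (rsum_le_sum _ _ 0 (cell_ge0 t) (cell_sum t Ht)). Qed.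

(** Makes products of survival probabilities telescope into quotients of [tail_prob]. *)
Lemma hazard_compl t : (1 <= t)%nat -> 1 - hazard t = tail_prob (S t) / tail_prob t.
Proof.
  intros Ht. assert (Hp := tail_pos t). unfold hazard.
  replace (tail_prob (S t)) with (tail_prob t - first_prob t); [field; lra|].
  assert (ST : forall t, Sig (fun w => M 0%Z w = o /\ forall i : nat, (1 <= i < t)%nat -> M (Z.of_nat i) w <> o))
    by (intros; meas HS).
  unfold tail_prob at 1. rewrite (meas_split Hm _ (fun w => M (Z.of_nat t) w = o)) by auto.
  unfold first_prob. cbv beta. unfold Rminus. rewrite Rplus_comm, <- Rplus_assoc, Rplus_opp_l, Rplus_0_l.
  unfold tail_prob. f_equal. apply ev_ext. intros w. split.
  - intros [[H0 H1] H2]. split; auto. intros i Hi. destruct (Nat.eq_dec i t); subst; auto. apply H1. lia.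
  - intros [H0 H1]. split; [split; auto|]; intros; apply H1; lia.
Qed.

Lemma select_fun t u l l' : select t u l -> select t u l' -> l = l'.
Proof.
  enough (H : forall l l', (code l < code l')%nat -> select t u l -> select t u l' -> False).
  { intros H1 H2. apply Hcode. destruct (Nat.lt_total (code l) (code l')) as [|[|]]; auto; exfalso; eauto. }
  intros x x' Hx [_ H1] [_ H2].
  assert (rsum (cell t) (S (code x)) <= rsum (cell t) (code x')); [|lra].
  apply rsum_mono; [apply cell_ge0|lia].
Qed.

(** The cells exhaust [[0, hazard t)]: the least partial sum above [U u] singles out a cell of
    positive length, whose index must then be the code of a cycle. *)
Lemma select_ex t u : (1 <= t)%nat -> (exists l, select t u l) <-> U u < hazard t.
Proof.
  intros Ht. assert (Hs := cell_sum t Ht). split.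
  - intros (l & _ & H). eapply Rlt_le_trans; [apply H|].
    apply rsum_le_sum; auto. apply cell_ge0.
  - intros H. destruct (least_element (fun n => U u < rsum (cell t) n))
      as (p & [Hp Hmin]); [eapply rsum_exceeds; eauto|].
    destruct p as [|k]; [simpl in Hp; specialize (U_ge0 u); lra|].
    assert (Hk : rsum (cell t) k <= U u).
    { apply Rnot_lt_le. intros Hk. apply Hmin in Hk. lia. }
    assert (Hc : 0 < cell t k) by (simpl in Hp; lra).
    assert (Hl : exists l, code l = k /\ is_cycle o l /\ length l = t).
    { apply NNPP. intros Hn. unfold cell in Hc.
      replace (fun w => exists l, _) with (fun _ : O => False) in Hc.
      - rewrite (meas_empty Hm) in Hc. unfold Rdiv in Hc. lra.
      - apply ev_ext. intros w. split; [tauto|]. intros (l & H1 & H2 & _). apply Hn. eauto. }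
    destruct Hl as (l & Hl & Hl'). exists l. split; auto. now rewrite Hl.
Qed.

Lemma cell_cycle l : is_cycle o l -> cell (length l) (code l) = cycle_prob l / tail_prob (length l).
Proof.
  intros Hl. unfold cell, cycle_prob. do 2 f_equal. apply ev_ext. intros w. split.
  - intros (l' & H1 & H2 & H3). apply Hcode in H1. now subst.
  - intros H. exists l. auto.
Qed.

Lemma cell_sum_le1 t k : (1 <= t)%nat -> 0 <= rsum (cell t) k <= 1.
Proof.
  intros Ht. split; [apply (rsum_mono (cell t) 0); [apply cell_ge0|lia]|].
  eapply Rle_trans; [apply rsum_le_sum; [apply cell_ge0|now apply cell_sum]|].
  assert (H := hazard_compl t Ht). assert (0 <= tail_prob (S t) / tail_prob t); [|lra].
  apply Rmult_le_pos; [left; auto|]. left. now apply Rinv_0_lt_compat.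
Qed.
End selection.

(** * The factor of a chain whose return hazards are eventually bounded below *)

Section core.
Context {O : Type} {Sig : (O -> Prop) -> Prop} {P : (O -> Prop) -> R} {St : Type} {M : Z -> O -> St}.
Context (HP : is_prob Sig P) (HM : forall n x, Sig (fun w => M n w = x)).
Context (code : list St -> nat) (Hcode : forall w w', code w = code w' -> w = w').
Context (o : St) (pi : St -> R) (K : St -> St -> R).
Context (fdd : forall (n : Z) (L : nat) (x : nat -> St),
  P (fun w => forall i, (i <= L)%nat -> M (n + Z.of_nat i)%Z w = x i) =
  pi (x 0%nat) * rprod (fun i => K (x i) (x (S i))) L).
Context (pi_pos : 0 < pi o).
Context (recurrent : forall e, 0 < e -> exists a : nat, forall n : Z,
  P (fun w => forall i, (i < a)%nat -> M (n + Z.of_nat i)%Z w <> o) < e).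
Context (tail_pos : forall t, 0 < tail_prob (P := P) (M := M) o t).

Context {A : Type} {SigA : (A -> Prop) -> Prop} {Q : ((Z -> A) -> Prop) -> R} {U : A -> R}.
Context (HSA : is_sigma SigA) (HQ : is_prob (prod_sigma SigA) Q).
Context (Q_shift : forall s E, prod_sigma SigA E -> Q (fun y => E (fun n => y (s + n)%Z)) = Q E).
Context (Q_indep : forall (D : Z -> Prop) n E C, ~ D n -> coord_sigma SigA D E -> SigA C ->
    Q (fun y => E y /\ C (y n)) = Q E * Q (fun y => C (y 0%Z))).
Context (HU : forall x, SigA (fun u => U u < x)) (U_ge0 : forall u, 0 <= U u).
Context (U_uniform : forall x, 0 <= x <= 1 -> Q (fun y => U (y 0%Z) < x) = x).

Context (n0 : nat) (eps eta : R).
Local Notation h := (hazard (P := P) (M := M) o).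
Local Notation Sel := (select (P := P) (M := M) code o U).
Context (eps_pos : 0 < eps < 1) (eta_pos : 0 < eta < 1).
Context (h_low : forall t, (n0 < t)%nat -> eps <= h t).
Context (h_high : forall t, (1 <= t <= 2 * n0 + 1)%nat -> h t <= 1 - eta).
Context (eps_eta : eps <= 1 - eta).

Let Hm : is_measure Sig P := prob_measure Sig P HP.
Let HS : is_sigma Sig := proj1 HP.
Let HmQ : is_measure (prod_sigma SigA) Q := prob_measure _ _ HQ.
Let HSQ : is_sigma (prod_sigma SigA) := proj1 HQ.
Let cS : countable_type St.
Proof. exists (fun x => code (x :: nil)). intros x y H. apply Hcode in H. congruence. Qed.
Let cL : countable_type (list St).
Proof. now exists code. Qed.

Let Sel_cycle : forall t u l, Sel t u l -> is_cycle o l /\ length l = t.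
Proof. intros t u l H. apply H. Qed.
Let Sel_fun : forall t u l l', Sel t u l -> Sel t u l' -> l = l'.
Proof. exact (select_fun Hm HM code Hcode o U tail_pos). Qed.
Let Sel_ex : forall t u, (1 <= t)%nat -> (exists l, Sel t u l) <-> U u < h t.
Proof. exact (select_ex Hm HM code Hcode o U tail_pos U_ge0). Qed.

Local Notation Pat := (pattern U eps eta n0).
Local Notation Run := (run U h).
Local Notation Cyc := (cyc U h Sel).
Local Notation Age := (age_at U h eps eta n0).
Local Notation State := (state_at o U h Sel eps eta n0).
Local Notation past n := (coord_sigma SigA (fun i => (i <= n)%Z)).

Lemma site_ge u x : (~ U u < x) <-> x <= U u.
Proof. split; [apply Rnot_lt_le|apply Rle_not_lt]. Qed.

Lemma HU_ge x : SigA (fun u => x <= U u).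
Proof. apply (sig_iff (fun u => ~ U u < x)); [intros; apply site_ge|]. now apply (sig_not HSA). Qed.

Lemma HSel t l : SigA (fun u => Sel t u l).
Proof.
  unfold select. apply (sig_guard_and HSA). intros _. apply (sig_and HSA); auto. apply HU_ge.
Qed.

Lemma site_measurable n (C : A -> Prop) : SigA C -> prod_sigma SigA (fun y => C (y n)).
Proof. intros HC. apply generated_base. exists n, C. tauto. Qed.

Lemma past_prod n E : past n E -> prod_sigma SigA E.
Proof. apply coord_sigma_all. Qed.

Lemma coord_mono (D D' : Z -> Prop) E : (forall i, D i -> D' i) ->
  coord_sigma SigA D E -> coord_sigma SigA D' E.
Proof.
  intros H. apply generated_sub. intros F (n & C & Hn & HC & HF). apply generated_base.
  exists n, C. auto.
Qed.

Lemma Q_site n m E C : past n E -> (n < m)%Z -> SigA C ->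
  Q (fun y => E y /\ C (y m)) = Q E * Q (fun y => C (y 0%Z)).
Proof. intros HE Hn HC. apply (Q_indep (fun i => (i <= n)%Z)); auto. lia. Qed.

Lemma past_site n (C : A -> Prop) m : (m <= n)%Z -> SigA C -> past n (fun y => C (y m)).
Proof. intros H HC. apply generated_base. exists m, C. tauto. Qed.

Lemma Q_total : Q (fun _ => True) = 1.
Proof. apply HQ. Qed.

Lemma Q_compl E : prod_sigma SigA E -> Q (fun y => ~ E y) = 1 - Q E.
Proof.
  intros HE. rewrite <- Q_total, (meas_split HmQ (fun _ => True) E); auto; [|apply HSQ].
  cbv beta. replace (fun y => True /\ E y) with E by (apply ev_ext; tauto).
  replace (fun y => True /\ ~ E y) with (fun y => ~ E y) by (apply ev_ext; tauto). lra.
Qed.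

Lemma Q_above x : 0 <= x <= 1 -> Q (fun y => x <= U (y 0%Z)) = 1 - x.
Proof.
  intros Hx. replace (1 - x) with (1 - Q (fun y => U (y 0%Z) < x)) by (now rewrite U_uniform).
  rewrite <- Q_compl.
  - f_equal. apply ev_ext. intros y. symmetry. apply site_ge.
  - apply (site_measurable 0 (fun u => U u < x)). auto.
Qed.

Lemma Q_select l : is_cycle o l ->
  Q (fun y => Sel (length l) (y 0%Z) l) = cycle_prob (P := P) (M := M) o l / tail_prob (P := P) (M := M) o (length l).
Proof.
  intros Hl. rewrite <- (cell_cycle code Hcode o l Hl).
  assert (Ht : (1 <= length l)%nat) by apply Hl.
  set (t := length l). set (x := rsum (cell (P := P) (M := M) code o t) (code l)).
  set (x' := rsum (cell (P := P) (M := M) code o t) (S (code l))).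
  assert (Hx : 0 <= x <= 1) by (apply (cell_sum_le1 Hm HM code Hcode o tail_pos t _ Ht)).
  assert (Hx' : 0 <= x' <= 1) by (apply (cell_sum_le1 Hm HM code Hcode o tail_pos t _ Ht)).
  assert (E : x' = x + cell (P := P) (M := M) code o t (code l)) by reflexivity.
  assert (Hc := cell_ge0 Hm HM code Hcode o tail_pos t (code l)).
  assert (Mx : forall z, prod_sigma SigA (fun y => U (y 0%Z) < z)).
  { intros z. now apply (site_measurable 0 (fun u => U u < z)). }
  assert (H := meas_split HmQ _ (fun y => U (y 0%Z) < x) (Mx x') (Mx x)).
  cbv beta in H. rewrite U_uniform in H by auto.
  replace (fun y => U (y 0%Z) < x' /\ U (y 0%Z) < x) with (fun y => U (y 0%Z) < x) in H
    by (apply ev_ext; intros; lra).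
  rewrite U_uniform in H by auto.
  replace (fun y => U (y 0%Z) < x' /\ ~ U (y 0%Z) < x) with (fun y => Sel t (y 0%Z) l) in H; [lra|].
  apply ev_ext. intros y. unfold select. fold t x x'. rewrite site_ge. tauto.
Qed.

Lemma tail_prob_1 : tail_prob (P := P) (M := M) o 1 = pi o.
Proof.
  assert (H0 := fdd 0 0 (fun _ => o)). simpl rprod in H0. rewrite Rmult_1_r in H0. rewrite <- H0.
  unfold tail_prob. f_equal. apply ev_ext. intros w. split.
  - intros [H _] i Hi. replace (0 + Z.of_nat i)%Z with 0%Z by lia. auto.
  - intros H. split; [apply (H 0%nat); lia|]. intros; lia.
Qed.

Lemma no_renewal_measurable n (t : nat) m : (n + Z.of_nat t <= m + 1)%Z ->
  past m (fun y => forall i, (1 <= i < t)%nat -> h i <= U (y (n + Z.of_nat i)%Z)).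
Proof.
  intros Hn. assert (HS' : is_sigma (past m)) by apply is_sigma_generated.
  apply (sig_all HS'); [cty|]. intros i. apply (sig_guard HS'). intros Hi.
  apply (past_site m (fun u => h i <= U u)); [lia|apply HU_ge].
Qed.

(** The factors [1 - h i] telescope from [tail_prob 1 = pi o] to [tail_prob t]. *)
Lemma no_renewal_prob E n (t : nat) : past n E -> (1 <= t)%nat ->
  Q (fun y => E y /\ forall i, (1 <= i < t)%nat -> h i <= U (y (n + Z.of_nat i)%Z)) =
  Q E * (tail_prob (P := P) (M := M) o t / pi o).
Proof.
  intros HE Ht. induction Ht as [|t Ht IH].
  - rewrite tail_prob_1. unfold Rdiv. rewrite Rinv_r, Rmult_1_r by lra. f_equal. apply ev_ext.
    intros y; split; [tauto|]. intros H; split; auto. intros; lia.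
  - replace (fun y => E y /\ forall i, (1 <= i < S t)%nat -> h i <= U (y (n + Z.of_nat i)%Z))
      with (fun y => (E y /\ forall i, (1 <= i < t)%nat -> h i <= U (y (n + Z.of_nat i)%Z)) /\
        h t <= U (y (n + Z.of_nat t)%Z)).
    2:{ apply ev_ext. intros y; split.
        - intros [[H1 H2] H3]. split; auto. intros i Hi. destruct (Nat.eq_dec i t); subst; auto.
          apply H2. lia.
        - intros [H1 H2]. split; [split; auto|]; intros; apply H2; lia. }
    rewrite (Q_site (n + Z.of_nat t - 1) (n + Z.of_nat t)
      (fun y => E y /\ forall i, (1 <= i < t)%nat -> h i <= U (y (n + Z.of_nat i)%Z)) (fun u => h t <= U u)).
    + rewrite IH, Q_above.
      * rewrite (hazard_compl Hm HM o tail_pos t Ht). assert (Hp := tail_pos t). field. lra.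
      * assert (H1 := hazard_ge0 Hm HM code Hcode o tail_pos t Ht).
        assert (H2 := hazard_compl Hm HM o tail_pos t Ht).
        assert (0 < tail_prob (P := P) (M := M) o (S t) / tail_prob (P := P) (M := M) o t)
          by (apply Rdiv_lt_0_compat; auto). lra.
    + assert (HS' : is_sigma (past (n + Z.of_nat t - 1)%Z)) by apply is_sigma_generated.
      apply (sig_and HS').
      * revert HE. apply coord_mono. lia.
      * apply no_renewal_measurable. lia.
    + lia.
    + apply HU_ge.
Qed.

(** The survival factor [tail_prob t] cancels the denominator of the cell, so a cycle has exactly
    its conditional law in the chain started at [o], independently of the past. *)
Lemma cyc_prob E n l : past n E -> is_cycle o l ->
  Q (fun y => E y /\ Cyc y n l) = Q E * (cycle_prob (P := P) (M := M) o l / pi o).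
Proof.
  intros HE Hl. set (t := length l). assert (Ht : (1 <= t)%nat) by apply Hl.
  replace (fun y => E y /\ Cyc y n l)
    with (fun y => (E y /\ forall i, (1 <= i < t)%nat -> h i <= U (y (n + Z.of_nat i)%Z)) /\
      Sel t (y (n + Z.of_nat t)%Z) l) by (apply ev_ext; intros y; unfold cyc; fold t; tauto).
  rewrite (Q_site (n + Z.of_nat t - 1) (n + Z.of_nat t)
    (fun y => E y /\ forall i, (1 <= i < t)%nat -> h i <= U (y (n + Z.of_nat i)%Z)) (fun u => Sel t u l)).
  - rewrite no_renewal_prob by auto. unfold t at 2. rewrite Q_select by auto. fold t.
    assert (Hp := tail_pos t). field. lra.
  - assert (HS' : is_sigma (past (n + Z.of_nat t - 1)%Z)) by apply is_sigma_generated.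
    apply (sig_and HS').
    + revert HE. apply coord_mono. lia.
    + apply no_renewal_measurable. lia.
  - lia.
  - apply HSel.
Qed.

Definition pattern_weight : R := eps * eta ^ n0 * eps.

Lemma pattern_weight_pos : 0 < pattern_weight < 1.
Proof.
  assert (H1 : 0 < eta ^ n0) by (apply pow_lt; lra).
  assert (H2 : eta ^ n0 <= 1) by (rewrite <- (pow1 n0); apply pow_incr; lra).
  unfold pattern_weight. split; [apply Rmult_lt_0_compat; [apply Rmult_lt_0_compat|]; lra|].
  apply Rle_lt_trans with (eps * eps); [|nra].
  apply Rmult_le_compat_r; [lra|]. nra.
Qed.

Lemma pattern_prob E m : past (m - Z.of_nat (n0 + 2))%Z E ->
  Q (fun y => E y /\ Pat y m) = Q E * pattern_weight.
Proof.
  intros HE.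
  (* [G j] imposes the first entry and the next [j] entries of the pattern, in the order of the
     sites, so that each new entry is independent of the preceding ones. *)
  pose (G := fun (j : nat) y => (E y /\ U (y (m - Z.of_nat (S n0))%Z) < eps) /\
    forall i, (n0 - j < i <= n0)%nat -> 1 - eta <= U (y (m - Z.of_nat i)%Z)).
  assert (HG : forall j, (j <= n0)%nat -> past (m - Z.of_nat (n0 - j) - 1)%Z (G j)).
  { intros j Hj. assert (HS' : is_sigma (past (m - Z.of_nat (n0 - j) - 1)%Z)) by apply is_sigma_generated.
    apply (sig_and HS'); [apply (sig_and HS')|].
    - revert HE. apply coord_mono. lia.
    - apply (past_site _ (fun u => U u < eps)); auto. lia.
    - apply (sig_all HS'); [cty|]. intros i. apply (sig_guard HS'). intros Hi.
      apply (past_site _ (fun u => 1 - eta <= U u)); [lia|apply HU_ge]. }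
  assert (QG : forall j, (j <= n0)%nat -> Q (G j) = Q E * (eps * eta ^ j)).
  { induction j as [|j IH]; intros Hj.
    - simpl. rewrite Rmult_1_r. replace (Q E * eps) with (Q E * Q (fun y => U (y 0%Z) < eps))
        by (rewrite U_uniform; lra).
      rewrite <- (Q_site (m - Z.of_nat (n0 + 2)) (m - Z.of_nat (S n0)) E (fun u => U u < eps)); auto; [|lia].
      f_equal. apply ev_ext. intros y. unfold G. split; [tauto|]. intros H; split; auto. intros; lia.
    - transitivity (Q (fun y => G j y /\ 1 - eta <= U (y (m - Z.of_nat (n0 - j))%Z))).
      + f_equal. apply ev_ext. intros y. unfold G. split.
        * intros [H1 H2]. split; [split; auto|]; intros; apply H2; lia.
        * intros [[H1 H2] H3]. split; auto. intros i Hi.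
          destruct (Nat.eq_dec i (n0 - j)) as [->|]; auto. apply H2; lia.
      + rewrite (Q_site (m - Z.of_nat (n0 - j) - 1) (m - Z.of_nat (n0 - j)) (G j) (fun u => 1 - eta <= U u));
          [|apply HG; lia|lia|apply HU_ge].
        rewrite IH, Q_above by (lia || lra). simpl. ring. }
  transitivity (Q (fun y => G n0 y /\ U (y m) < eps)).
  - f_equal. apply ev_ext. intros y. unfold G, pattern. rewrite Nat.sub_diag. split.
    + intros (H1 & H2 & H3 & H4). repeat split; auto.
    + intros (((H1 & H2) & H3) & H4). repeat split; auto.
  - rewrite (Q_site (m - Z.of_nat (n0 - n0) - 1) m (G n0) (fun u => U u < eps)); auto; [|lia].
    rewrite QG, U_uniform by (lia || lra). unfold pattern_weight. ring.
Qed.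

Lemma pat_measurable (D : Z -> Prop) m : (forall i, (m - Z.of_nat (S n0) <= i <= m)%Z -> D i) ->
  coord_sigma SigA D (fun y => Pat y m).
Proof. apply pattern_measurable; auto. Qed.

Lemma pat_prod m : prod_sigma SigA (fun y => Pat y m).
Proof. eapply coord_sigma_all, (pat_measurable (fun _ => True)). auto. Qed.

(** A pattern occupies [n0 + 2] sites, so candidates at this spacing use disjoint blocks. *)
Lemma no_pattern_prob z N :
  Q (fun y => forall i, (i < N)%nat -> ~ Pat y (z + Z.of_nat ((n0 + 2) * i))%Z) =
  (1 - pattern_weight) ^ N.
Proof.
  induction N.
  - simpl. rewrite <- Q_total. f_equal. apply ev_ext. intros; split; auto. intros; lia.
  - pose (E := fun y => forall i, (i < N)%nat -> ~ Pat y (z + Z.of_nat ((n0 + 2) * i))%Z).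
    set (m := (z + Z.of_nat ((n0 + 2) * N))%Z).
    assert (HE : past (m - Z.of_nat (n0 + 2))%Z E).
    { assert (HS' : is_sigma (past (m - Z.of_nat (n0 + 2))%Z)) by apply is_sigma_generated.
      apply (sig_all HS'); [cty|]. intros i. apply (sig_guard HS'). intros Hi. apply (sig_not HS').
      apply pat_measurable. intros j Hj. unfold m. nia. }
    assert (H := meas_split HmQ E (fun y => Pat y m) (past_prod _ _ HE) (pat_prod m)).
    cbv beta in H. rewrite pattern_prob in H by auto.
    transitivity (Q (fun y => E y /\ ~ Pat y m)).
    + f_equal. apply ev_ext. intros y. unfold E. split.
      * intros H1. split; [intros i Hi|]; apply H1; lia.
      * intros [H1 H2] i Hi. destruct (Nat.eq_dec i N) as [->|]; auto. apply H1; lia.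
    + fold E in IHN. simpl. rewrite IHN in H. lra.
Qed.

(** * The coding window *)

(** Both patterns lie entirely inside [[-r, r]]. The condition [n0 + 1 <= r] takes care of the right
    one, which ends after the origin but may begin before it. *)
Definition good (r : nat) (y : Z -> A) : Prop :=
  (n0 + 1 <= r)%nat /\
  (exists k : nat, (k + n0 + 1 <= r)%nat /\ Pat y (- Z.of_nat k)%Z) /\
  (exists d : nat, (1 <= d <= r)%nat /\ Pat y (Z.of_nat d)).

Lemma good_measurable r : window_sigma SigA r (good r).
Proof.
  assert (HS' : is_sigma (window_sigma SigA r)) by apply is_sigma_generated.
  apply (sig_guard_and HS'). intros Hr. apply (sig_and HS'); (apply (sig_ex HS'); [cty|]);
    intros k; apply (sig_guard_and HS'); intros Hk;
    apply (pat_measurable (fun i => (Z.abs i <= Z.of_nat r)%Z)); intros i Hi; lia.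
Qed.

Lemma good_mono r r' y : (r <= r')%nat -> good r y -> good r' y.
Proof.
  intros Hr (H1 & (k & Hk & Hk') & (d & Hd & Hd')). split; [lia|].
  split; [exists k|exists d]; (split; [lia|auto]).
Qed.

Lemma window_prod r E : window_sigma SigA r E -> prod_sigma SigA E.
Proof. apply (coord_sigma_all A SigA (fun i => (Z.abs i <= Z.of_nat r)%Z)). Qed.

(** If [r] is not good, then all [N] candidates ending at or before 0 fail or all [N] candidates
    ending at or after 1 fail. *)
Lemma not_good_prob r N : ((n0 + 2) * N <= r)%nat -> (1 <= N)%nat ->
  Q (fun y => ~ good r y) <= 2 * (1 - pattern_weight) ^ N.
Proof.
  intros Hr HN.
  pose (E := fun z y => forall i, (i < N)%nat -> ~ Pat y (z + Z.of_nat ((n0 + 2) * i))%Z).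
  assert (ME : forall z, prod_sigma SigA (E z)).
  { intros z. apply (sig_all HSQ); [cty|]. intros i. apply (sig_guard HSQ). intros _.
    apply (sig_not HSQ), pat_prod. }
  set (z := (- Z.of_nat ((n0 + 2) * (N - 1)))%Z).
  apply Rle_trans with (Q (fun y => E z y \/ E 1%Z y)).
  - apply (meas_mono HmQ).
    + apply (sig_not HSQ), (window_prod r), good_measurable.
    + apply (sig_or HSQ); auto.
    + intros y Hy. apply NNPP. intros Hn. apply Hy.
      apply not_or_and in Hn as [H1 H2]. unfold E in H1, H2.
      apply not_all_ex_not in H1 as [i Hi]. apply not_all_ex_not in H2 as [j Hj].
      apply imply_to_and in Hi as [Hi Hi']. apply imply_to_and in Hj as [Hj Hj'].
      apply NNPP in Hi', Hj'. split; [nia|]. split.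
      * exists ((n0 + 2) * (N - 1 - i))%nat. split; [nia|].
        replace (- Z.of_nat ((n0 + 2) * (N - 1 - i)))%Z with (z + Z.of_nat ((n0 + 2) * i))%Z; auto.
        unfold z. nia.
      * exists (1 + (n0 + 2) * j)%nat. split; [nia|].
        now replace (Z.of_nat (1 + (n0 + 2) * j)) with (1 + Z.of_nat ((n0 + 2) * j))%Z by lia.
  - eapply Rle_trans; [apply (meas_union_le HmQ); auto|]. unfold E.
    rewrite !no_pattern_prob. lra.
Qed.

Definition window (y : Z -> A) : option nat :=
  epsilon (inhabits None) (fun x => match x with
    | None => forall r, ~ good r y
    | Some r => good r y /\ forall r', (r' < r)%nat -> ~ good r' y
    end).

Lemma window_spec y : match window y with
    | None => forall r, ~ good r y
    | Some r => good r y /\ forall r', (r' < r)%nat -> ~ good r' y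
    end.
Proof.
  apply (epsilon_spec (inhabits None) (fun x => match x with
    | None => forall r, ~ good r y
    | Some r => good r y /\ forall r', (r' < r)%nat -> ~ good r' y
    end)).
  destruct (classic (exists r, good r y)) as [H|H].
  - destruct (least_element (fun r => good r y)) as (p & [Hp Hmin]);
      [auto|].
    exists (Some p). split; auto. intros r Hr Hg. apply Hmin in Hg. lia.
  - exists None. intros r Hr. eauto.
Qed.

Lemma window_le y r : le_opt (window y) r <-> good r y.
Proof.
  assert (H := window_spec y). destruct (window y) as [p|]; simpl.
  - split.
    + intros Hp. eapply good_mono; [apply Hp|apply H].
    + intros Hg. apply Nat.nlt_ge. intros Hr. eapply H; eauto.
  - split; [tauto|]. intros Hg. eapply H; eauto.
Qed.

Lemma window_ge y r : (1 <= r)%nat -> ge_opt (window y) r <-> ~ good (r - 1) y.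
Proof.
  intros Hr. rewrite <- window_le. destruct (window y) as [p|]; simpl; [lia|tauto].
Qed.

Lemma never_good_null : Q (fun y => forall r, ~ good r y) = 0.
Proof.
  assert (MG : forall r, prod_sigma SigA (fun y => ~ good r y)).
  { intros r. apply (sig_not HSQ), (window_prod r), good_measurable. }
  assert (MA : prod_sigma SigA (fun y => forall r, ~ good r y)).
  { apply (sig_all HSQ); [cty|auto]. }
  apply Rle_antisym; [|now apply (meas_ge0 HmQ)].
  apply Rnot_lt_le. intros Hp. assert (Hw := pattern_weight_pos).
  destruct (pow_lt_1_zero (1 - pattern_weight)) with (y := Q (fun y => forall r, ~ good r y) / 2) as [N HN].
  - rewrite Rabs_right; lra.
  - lra.
  - specialize (HN (N + 1)%nat ltac:(lia)).
    rewrite Rabs_right in HN by (apply Rle_ge, pow_le; lra).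
    assert (H := not_good_prob ((n0 + 2) * (N + 1)) (N + 1) ltac:(lia) ltac:(lia)).
    assert (Q (fun y => forall r, ~ good r y) <= Q (fun y => ~ good ((n0 + 2) * (N + 1)) y)); [|lra].
    apply (meas_mono HmQ); auto.
Qed.

Lemma window_tail : exists C c, 0 < C /\ 0 < c /\ forall r, (1 <= r)%nat ->
  Q (fun y => ge_opt (window y) r) <= C * exp (- c * INR r).
Proof.
  assert (Hw := pattern_weight_pos). set (a := 1 - pattern_weight) in *.
  assert (Ha : 0 < a < 1) by (unfold a; lra).
  assert (Hl : ln a < 0) by (rewrite <- ln_1; apply ln_increasing; lra).
  assert (HI : 0 < INR (n0 + 2)) by (apply lt_0_INR; lia).
  (* The rate comes from one trial every [n0 + 2] sites. With [N] the floor of [(r - 1) / (n0 + 2)]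
     one has [N + 2 >= r / (n0 + 2)], and the two missing trials cost the factor [a^-2]. *)
  exists (2 * exp (- 2 * ln a)), (- ln a / INR (n0 + 2)).
  split; [apply Rmult_lt_0_compat; [lra|apply exp_pos]|].
  split; [apply Rdiv_lt_0_compat; lra|].
  intros r Hr.
  replace (fun y => ge_opt (window y) r) with (fun y => ~ good (r - 1) y)
    by (apply ev_ext; intros; symmetry; now apply window_ge).
  set (N := ((r - 1) / (n0 + 2))%nat).
  assert (HN : ((n0 + 2) * N <= r - 1)%nat) by (apply Nat.Div0.mul_div_le).
  assert (HN' : (r <= (n0 + 2) * (N + 2))%nat).
  { assert (H := Nat.mul_succ_div_gt (r - 1) (n0 + 2) ltac:(lia)). fold N in H. nia. }
  assert (Hbound : Q (fun y => ~ good (r - 1) y) <= 2 * a ^ N).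
  { destruct (le_lt_dec 1 N) as [H1|H1]; [now apply not_good_prob|].
    replace N with 0%nat by lia. simpl.
    assert (MG : prod_sigma SigA (good (r - 1))) by (eapply window_prod, good_measurable).
    rewrite Q_compl by auto. assert (H := meas_ge0 HmQ _ MG). lra. }
  eapply Rle_trans; [exact Hbound|]. rewrite Rmult_assoc. apply Rmult_le_compat_l; [lra|].
  rewrite <- exp_plus. rewrite <- Rpower_pow by lra. unfold Rpower.
  destruct (Rle_lt_or_eq_dec (INR N * ln a)
    (-2 * ln a + - (- ln a / INR (n0 + 2)) * INR r)) as [H|H].
  - apply le_INR in HN'. rewrite mult_INR, (plus_INR N 2) in HN'. simpl (INR 2) in HN'.
    assert (HX : INR r / INR (n0 + 2) <= INR N + 2).
    { apply Rmult_le_reg_r with (INR (n0 + 2)); auto. unfold Rdiv.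
      rewrite Rmult_assoc, Rinv_l by lra. lra. }
    replace (-2 * ln a + - (- ln a / INR (n0 + 2)) * INR r)
      with (ln a * (INR r / INR (n0 + 2) - 2)) by (field; lra).
    nra.
  - left. now apply exp_increasing.
  - rewrite H. lra.
Qed.

(** * The factor map *)

(** Where no state is determined, an event of probability 0, [epsilon] returns a fixed default. *)
Definition phi (y : Z -> A) : St := epsilon (inhabits o) (State y 0%Z).
Definition process (y : Z -> A) (n : Z) : St := phi (fun k => y (n + k)%Z).

Lemma process_state y n x : State y n x -> process y n = x.
Proof.
  intros Hx. unfold process, phi.
  replace (State (fun k => y (n + k)%Z) 0%Z) with (State y n).
  - apply (state_at_unique o U h Sel eps eta n0 Sel_cycle Sel_fun Sel_ex h_low h_high eps_eta y n); auto.
    apply epsilon_spec. eauto.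
  - apply functional_extensionality. intros z. apply propositional_extensionality.
    rewrite (state_at_shift o U h Sel eps eta n0 Sel_cycle). now rewrite Z.add_0_r.
Qed.

Lemma cover y n (k d : nat) : Pat y (n - Z.of_nat k)%Z -> Pat y (n + Z.of_nat d)%Z -> (1 <= d)%nat ->
  exists j w, (j <= k)%nat /\ (j < length w <= j + d)%nat /\
    Run y (n - Z.of_nat k)%Z 0 (k - j) = 0%nat /\ Cyc y (n - Z.of_nat j)%Z w.
Proof.
  apply (cycle_cover o U h Sel eps eta n0 Sel_cycle Sel_ex h_low h_high eps_eta).
Qed.

(** A version of [state_at] at the origin that reads no site outside [[-r, r]]. *)
Definition local_state (r : nat) (y : Z -> A) (x : St) : Prop :=
  exists (k j : nat) w, (k + n0 + 1 <= r)%nat /\ (j <= k)%nat /\ (j < length w <= j + r)%nat /\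
    Pat y (- Z.of_nat k)%Z /\ Run y (- Z.of_nat k)%Z 0 (k - j) = 0%nat /\
    Cyc y (- Z.of_nat j)%Z w /\ x = nth j w o.

Lemma local_state_phi r y x : good r y -> local_state r y x <-> phi y = x.
Proof.
  intros Hg.
  assert (H1 : forall z, local_state r y z -> phi y = z).
  { intros z (k & j & w & Hk & Hj & Hw & HP1 & HR & HC & ->).
    rewrite <- (process_state y 0 (nth j w o)); [reflexivity|].
    exists (k - j)%nat, j, w.
    replace (0 - Z.of_nat j - Z.of_nat (k - j))%Z with (- Z.of_nat k)%Z by lia.
    replace (0 - Z.of_nat j)%Z with (- Z.of_nat j)%Z by lia. intuition lia. }
  split; [apply H1|]. intros <-.
  destruct Hg as (Hr & (k & Hk & HP1) & (d & Hd & HP2)).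
  destruct (cover y 0 k d) as (j & w & Hj & Hw & HR & HC); auto; [lia|].
  assert (HL : local_state r y (nth j w o)).
  { exists k, j, w. intuition lia. }
  now rewrite (H1 _ HL).
Qed.

Lemma window_phi_measurable (B : St -> Prop) r :
  window_sigma SigA r (fun y => B (phi y) /\ good r y).
Proof.
  assert (HS' : is_sigma (window_sigma SigA r)) by apply is_sigma_generated.
  apply (sig_iff (fun y => (exists x, B x /\ local_state r y x) /\ good r y)).
  { intros y. split.
    - intros [(x & Hx & HL) Hg]. split; auto. apply local_state_phi in HL; auto. now subst.
    - intros [Hx Hg]. split; auto. exists (phi y). split; auto. now apply local_state_phi. }
  apply (sig_and HS'); [|apply good_measurable].
  apply (sig_ex HS'); auto. intros x. apply (sig_guard_and HS'). intros _.
  apply (sig_ex HS'); [cty|]. intros k. apply (sig_ex HS'); [cty|]. intros j.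
  apply (sig_ex HS'); auto. intros w.
  do 3 (apply (sig_guard_and HS'); intros ?).
  apply (sig_and HS'); [|apply (sig_and HS'); [|apply (sig_and HS')]].
  - apply (pat_measurable (fun i => (Z.abs i <= Z.of_nat r)%Z)). intros; lia.
  - apply (run_measurable U h HU (fun i => (Z.abs i <= Z.of_nat r)%Z)). intros; lia.
  - apply (cyc_measurable o U h Sel Sel_cycle HU HSel (fun i => (Z.abs i <= Z.of_nat r)%Z)). intros; lia.
  - apply (sig_const HS').
Qed.

Lemma state_measurable n x : prod_sigma SigA (fun y => State y n x).
Proof.
  apply (sig_ex HSQ); [cty|]. intros k. apply (sig_ex HSQ); [cty|]. intros j.
  apply (sig_ex HSQ); auto. intros w. apply (sig_guard_and HSQ). intros _.
  apply (sig_and HSQ); [|apply (sig_and HSQ); [|apply (sig_and HSQ)]].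
  - apply pat_prod.
  - eapply coord_sigma_all, (run_measurable U h HU (fun _ => True)). auto.
  - eapply coord_sigma_all, (cyc_measurable o U h Sel Sel_cycle HU HSel (fun _ => True)). auto.
  - apply (sig_const HSQ).
Qed.

Lemma phi_measurable (B : St -> Prop) : prod_sigma SigA (fun y => B (phi y)).
Proof.
  (* Measurability is required at every configuration. Without a state, [phi] is [epsilon] of the
     empty predicate, a constant independent of [y]. *)
  apply (sig_iff (fun y => (exists x, B x /\ State y 0%Z x) \/
    ((forall x, ~ State y 0%Z x) /\ B (epsilon (inhabits o) (fun _ => False))))).
  - intros y. destruct (classic (exists x, State y 0%Z x)) as [[x Hx]|Hn].
    + assert (E : phi y = x) by (apply (process_state y 0 x Hx)). rewrite E. split.
      * intros [(x' & HB & Hx')|[Hx' _]]; [|exfalso; eapply Hx'; eauto].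
        replace x with x'; auto. rewrite <- E. symmetry. apply (process_state y 0 x' Hx').
      * eauto.
    + assert (E : phi y = epsilon (inhabits o) (fun _ => False)).
      { unfold phi. f_equal. apply functional_extensionality. intros x.
        apply propositional_extensionality. split; [eauto|tauto]. }
      rewrite E. split; [intros [(x & _ & Hx)|[_ H]]; [exfalso; eauto|auto]|].
      intros H. right. split; auto. intros x Hx. eauto.
  - apply (sig_or HSQ).
    + apply (sig_ex HSQ); auto. intros x. apply (sig_guard_and HSQ). intros _. apply state_measurable.
    + apply (sig_and HSQ); [|apply (sig_const HSQ)].
      apply (sig_all HSQ); auto. intros x. apply (sig_not HSQ), state_measurable.
Qed.

Lemma process_measurable E : prod_sigma (@discrete St) E -> prod_sigma SigA (fun y => E (process y)).
Proof.
  apply (generated_preimage process); auto. intros F (n & C & _ & HF).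
  apply (sig_iff (fun y => C (phi (fun k => y (n + k)%Z)))); [intros y; now rewrite HF|].
  assert (Hsh : forall E, prod_sigma SigA E -> prod_sigma SigA (fun y => E (fun k => y (n + k)%Z))).
  { apply (generated_preimage (fun (y : Z -> A) k => y (n + k)%Z)); auto.
    intros G (m & D & HD & HG). apply generated_base. exists (n + m)%Z, D. split; auto. }
  apply (Hsh (fun y => C (phi y))). apply phi_measurable.
Qed.

(** * The law of the factor *)

(** Never computed from the hazards: [scale_1] identifies it with [pi o] at the very end. *)
Definition renewal_prob : R := Q (fun y => Age y 0%Z 0%nat).

Lemma renewal_measurable n : past n (fun y => Age y n 0%nat).
Proof. apply (age_at_measurable U h); auto. Qed.

Lemma renewal_prob_shift n : Q (fun y => Age y n 0%nat) = renewal_prob.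
Proof.
  unfold renewal_prob. rewrite <- (Q_shift n (fun y => Age y 0%Z 0%nat)) by (eapply past_prod, renewal_measurable).
  f_equal. apply ev_ext. intros y.
  rewrite (age_at_shift U h eps eta n0 y n 0 0). now rewrite Z.add_0_r.
Qed.

Definition segment (x : nat -> St) (j l : nat) : list St := map x (seq j l).

Lemma segment_length x j l : length (segment x j l) = l.
Proof. unfold segment. now rewrite length_map, length_seq. Qed.

Lemma segment_nth x j l i : (i < l)%nat -> nth i (segment x j l) o = x (j + i)%nat.
Proof.
  intros Hi. unfold segment. rewrite (nth_indep _ o (x 0%nat)) by (now rewrite length_map, length_seq).
  rewrite map_nth, seq_nth; auto.
Qed.

Definition returns (x : nat -> St) (j j' : nat) : Prop :=
  (j < j')%nat /\ x j = o /\ x j' = o /\ forall i, (j < i < j')%nat -> x i <> o.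

Lemma segment_cycle x j j' : returns x j j' -> is_cycle o (segment x j (j' - j)).
Proof.
  intros (H1 & H2 & H3 & H4). unfold is_cycle. rewrite segment_length. split; [lia|]. split.
  - rewrite segment_nth by lia. now rewrite Nat.add_0_r.
  - intros i Hi. rewrite segment_nth by lia. apply H4. lia.
Qed.

Lemma last_return x (L : nat) : x 0%nat = o -> x L = o -> (0 < L)%nat -> exists j, returns x j L.
Proof.
  intros H0 HL HL0.
  assert (H : forall k, (k < L)%nat -> (forall i, (L - k <= i < L)%nat -> x i <> o) \/ exists j, returns x j L).
  { induction k; intros Hk; [left; intros; lia|].
    destruct IHk as [IH|IH]; [lia| |auto].
    destruct (classic (x (L - S k)%nat = o)) as [E|E].
    - right. exists (L - S k)%nat. repeat split; auto; [lia|].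
      intros i Hi. apply IH. lia.
    - left. intros i Hi. destruct (Nat.eq_dec i (L - S k)) as [->|]; auto. apply IH. lia. }
  destruct (H (L - 1)%nat ltac:(lia)) as [H1|H1]; auto.
  exists 0%nat. repeat split; auto. intros i Hi. apply H1. lia.
Qed.

(* The path [x] from time [n], cut into its cycles. *)
Definition traces (n : Z) (x : nat -> St) (L : nat) (y : Z -> A) : Prop :=
  Age y n 0%nat /\ forall j j', returns x j j' -> (j' <= L)%nat ->
    Cyc y (n + Z.of_nat j)%Z (segment x j (j' - j)).

Lemma traces_measurable n x L : past (n + Z.of_nat L)%Z (traces n x L).
Proof.
  assert (HS' : is_sigma (past (n + Z.of_nat L)%Z)) by apply is_sigma_generated.
  apply (sig_and HS').
  - eapply coord_mono; [|apply renewal_measurable]. simpl. lia.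
  - apply (sig_all HS'); [cty|]. intros j. apply (sig_all HS'); [cty|]. intros j'.
    apply (sig_guard HS'). intros Hr. apply (sig_guard HS'). intros Hj.
    apply (cyc_measurable o U h Sel Sel_cycle HU HSel (fun i => (i <= n + Z.of_nat L)%Z)).
    rewrite segment_length. destruct Hr. intros; lia.
Qed.

Lemma traces_last n x j L y : returns x j L ->
  traces n x L y <-> traces n x j y /\ Cyc y (n + Z.of_nat j)%Z (segment x j (L - j)).
Proof.
  intros Hr. split.
  - intros [H1 H2]. split; [split|]; auto. intros i i' Hi Hj. apply H2; auto. destruct Hr. lia.
  - intros [[H1 H2] H3]. split; auto. intros i i' Hi Hi'.
    destruct (le_lt_dec i' j) as [Hj|Hj]; [auto|].
    destruct Hr as (R1 & R2 & R3 & R4), Hi as (I1 & I2 & I3 & I4).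
    destruct (Nat.eq_dec i' L) as [->|]; [|exfalso; apply (R4 i'); auto; lia].
    destruct (Nat.lt_total i j) as [Hij|[->|Hij]]; auto; exfalso.
    + apply (I4 j); auto.
    + apply (R4 i); auto.
Qed.

Lemma rprod_split f j l : rprod f (j + l) = rprod f j * rprod (fun i => f (j + i)%nat) l.
Proof.
  induction l; simpl; [rewrite Nat.add_0_r; lra|].
  rewrite Nat.add_succ_r. simpl. rewrite IHl. lra.
Qed.

(** Strong induction on [L], removing the last cycle: [cyc_prob] gives its weight, and the path
    weight of the chain factors at the visit to [o] where that cycle starts. *)
Lemma traces_prob n x L : x 0%nat = o -> x L = o ->
  Q (traces n x L) = renewal_prob / pi o * P (fun w => forall i, (i <= L)%nat -> M (n + Z.of_nat i)%Z w = x i).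
Proof.
  intros H0. rewrite fdd. induction L as [L IH] using (well_founded_induction lt_wf). intros HL.
  destruct (Nat.eq_dec L 0) as [->|HL0].
  - simpl. rewrite H0. transitivity renewal_prob; [|field; lra].
    rewrite <- (renewal_prob_shift n). f_equal. apply ev_ext. intros y. split; [now intros []|].
    intros H; split; auto. intros j j' (R1 & _) Hj. lia.
  - destruct (last_return x L H0 HL) as [j Hr]; [lia|].
    transitivity (Q (fun y => traces n x j y /\ Cyc y (n + Z.of_nat j)%Z (segment x j (L - j)))).
    { f_equal. apply ev_ext. intros y. now apply traces_last. }
    rewrite cyc_prob by (apply traces_measurable || now apply segment_cycle).
    assert (Hr' := Hr). destruct Hr' as (R1 & R2 & R3 & R4). rewrite IH by auto.
    replace L with (j + (L - j))%nat at 2 by lia. rewrite rprod_split.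
    unfold cycle_prob. rewrite segment_length.
    replace (fun w => forall i, (i <= L - j)%nat -> M (Z.of_nat i) w = nth i (segment x j (L - j)) o)
      with (fun w => forall i, (i <= L - j)%nat -> M (0 + Z.of_nat i)%Z w = x (j + i)%nat).
    2:{ apply ev_ext. intros w. split; intros Hw i Hi; specialize (Hw i Hi).
        - destruct (Nat.eq_dec i (L - j)) as [->|].
          + rewrite nth_overflow by (rewrite segment_length; lia).
            rewrite Z.add_0_l in Hw. rewrite Hw, <- HL. f_equal. lia.
          + rewrite segment_nth by lia. exact Hw.
        - rewrite Z.add_0_l, Hw. destruct (Nat.eq_dec i (L - j)) as [->|].
          + rewrite nth_overflow by (rewrite segment_length; lia). rewrite <- HL. f_equal. lia.
          + now rewrite segment_nth by lia. }
    rewrite (fdd 0 (L - j) (fun i => x (j + i)%nat)). rewrite Nat.add_0_r, R2.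
    replace (rprod (fun i => K (x (j + i)%nat) (x (j + S i)%nat)) (L - j))
      with (rprod (fun i => K (x (j + i)%nat) (x (S (j + i)))) (L - j))
      by (apply rprod_ext; intros; now rewrite Nat.add_succ_r).
    field. lra.
Qed.

(** An event of full measure on which every site is covered by a cycle, so that [process] is
    governed by the renewals. *)
Definition two_sided (y : Z -> A) : Prop :=
  forall n, (exists k : nat, Pat y (n - Z.of_nat k)%Z) /\ (exists d : nat, (1 <= d)%nat /\ Pat y (n + Z.of_nat d)%Z).

Lemma two_sided_measurable : prod_sigma SigA two_sided.
Proof.
  apply (sig_all HSQ); [cty|]. intros n. apply (sig_and HSQ); (apply (sig_ex HSQ); [cty|]); intros k.
  - apply pat_prod.
  - apply (sig_guard_and HSQ). intros _. apply pat_prod.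
Qed.

Lemma small_power e : 0 < e -> exists N, (1 - pattern_weight) ^ N < e.
Proof.
  intros He. assert (Hw := pattern_weight_pos).
  destruct (pow_lt_1_zero (1 - pattern_weight)) with (y := e) as [N HN];
    [rewrite Rabs_right; lra|lra|].
  exists N. specialize (HN N (Nat.le_refl _)). rewrite Rabs_right in HN; auto.
  apply Rle_ge, pow_le. lra.
Qed.

Lemma two_sided_full : Q (fun y => ~ two_sided y) = 0.
Proof.
  replace (fun y => ~ two_sided y) with (fun y => exists n,
    (forall k : nat, ~ Pat y (n - Z.of_nat k)%Z) \/ (forall d : nat, (1 <= d)%nat -> ~ Pat y (n + Z.of_nat d)%Z)).
  2:{ apply ev_ext. intros y. unfold two_sided. split.
      - intros [n [H|H]] H'; destruct (H' n) as [[k Hk] [d [Hd Hd']]]; [eapply H|eapply H]; eauto.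
      - intros H. apply not_all_ex_not in H as [n H]. exists n.
        apply not_and_or in H as [H|H]; [left|right].
        + intros k Hk. eauto.
        + intros d Hd Hd'. eauto. }
  assert (M1 : forall n, prod_sigma SigA (fun y => forall k : nat, ~ Pat y (n - Z.of_nat k)%Z)).
  { intros n. apply (sig_all HSQ); [cty|]. intros k. apply (sig_not HSQ), pat_prod. }
  assert (M2 : forall n, prod_sigma SigA (fun y => forall d : nat, (1 <= d)%nat -> ~ Pat y (n + Z.of_nat d)%Z)).
  { intros n. apply (sig_all HSQ); [cty|]. intros d. apply (sig_guard HSQ). intros _.
    apply (sig_not HSQ), pat_prod. }
  assert (M3 : forall z N, prod_sigma SigA (fun y => forall i, (i < N)%nat -> ~ Pat y (z + Z.of_nat ((n0 + 2) * i))%Z)).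
  { intros z N. apply (sig_all HSQ); [cty|]. intros i. apply (sig_guard HSQ). intros _.
    apply (sig_not HSQ), pat_prod. }
  apply (meas_null_countable _ HmQ); [cty|intros n; now apply (sig_or HSQ)|].
  intros n. apply Rle_antisym; [|apply (meas_ge0 HmQ); now apply (sig_or HSQ)].
  apply Rnot_lt_le. intros Hp.
  destruct (small_power (Q (fun y => (forall k : nat, ~ Pat y (n - Z.of_nat k)%Z) \/
    (forall d : nat, (1 <= d)%nat -> ~ Pat y (n + Z.of_nat d)%Z)) / 2)) as [N HN]; [lra|].
  assert (H := meas_union_le HmQ _ _ (M1 n) (M2 n)). cbv beta in H.
  assert (H1 : Q (fun y => forall k : nat, ~ Pat y (n - Z.of_nat k)%Z) <= (1 - pattern_weight) ^ N).
  { rewrite <- (no_pattern_prob (n - Z.of_nat ((n0 + 2) * N))). apply (meas_mono HmQ); auto.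
    intros y Hy i Hi. replace (n - Z.of_nat ((n0 + 2) * N) + Z.of_nat ((n0 + 2) * i))%Z
      with (n - Z.of_nat ((n0 + 2) * (N - i)))%Z by nia. auto. }
  assert (H2 : Q (fun y => forall d : nat, (1 <= d)%nat -> ~ Pat y (n + Z.of_nat d)%Z) <= (1 - pattern_weight) ^ N).
  { rewrite <- (no_pattern_prob (n + 1)). apply (meas_mono HmQ); auto.
    intros y Hy i Hi. replace (n + 1 + Z.of_nat ((n0 + 2) * i))%Z
      with (n + Z.of_nat (1 + (n0 + 2) * i))%Z by lia. apply Hy. lia. }
  lra.
Qed.

Lemma two_sided_cycle y n : two_sided y -> exists j w, (j < length w)%nat /\
  Age y (n - Z.of_nat j)%Z 0%nat /\ Cyc y (n - Z.of_nat j)%Z w /\ process y n = nth j w o.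
Proof.
  intros Hy. destruct (Hy n) as [[k Hk] [d [Hd Hd']]].
  destruct (cover y n k d Hk Hd' Hd) as (j & w & Hj & Hw & HR & HC).
  exists j, w. split; [lia|].
  assert (HA : Age y (n - Z.of_nat j)%Z 0%nat).
  { exists (k - j)%nat. replace (n - Z.of_nat j - Z.of_nat (k - j))%Z with (n - Z.of_nat k)%Z by lia. auto. }
  split; auto. split; auto. apply process_state.
  replace n with (n - Z.of_nat j + Z.of_nat j)%Z at 1 by lia.
  apply (state_at_cycle o U h Sel eps eta n0); auto. lia.
Qed.

(** Strictly inside a cycle the age is positive and the word avoids [o]; at its start the age is 0
    and the word reads [o]. *)
Lemma two_sided_renewal y n : two_sided y -> process y n = o <-> Age y n 0%nat.
Proof.
  intros Hy. destruct (two_sided_cycle y n Hy) as (j & w & Hj & HA & HC & E).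
  destruct (Sel_cycle _ _ _ (proj2 HC)) as [(C1 & C2 & C3) _].
  assert (HAj : Age y n j).
  { rewrite <- (cyc_run U h Sel y _ w j HC Hj).
    replace n with (n - Z.of_nat j + Z.of_nat j)%Z at 1 by lia.
    apply (age_run U h); auto. }
  rewrite E. destruct (Nat.eq_dec j 0) as [->|Hj0].
  - tauto.
  - split; [intros H; exfalso; apply (C3 j); auto; lia|].
    intros H0. exfalso. apply Hj0.
    apply (age_unique U h eps eta n0 h_low h_high eps_eta y n); auto.
Qed.

Lemma cycle_process y n w i : Age y n 0%nat -> Cyc y n w -> (i < length w)%nat ->
  process y (n + Z.of_nat i)%Z = nth i w o.
Proof. intros HA HC Hi. apply process_state. apply (state_at_cycle o U h Sel eps eta n0); auto. Qed.

Lemma two_sided_next y n : two_sided y -> Age y n 0%nat -> exists w, Cyc y n w.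
Proof.
  intros Hy HA. destruct (two_sided_cycle y n Hy) as (j & w & Hj & HA' & HC & E).
  assert (HAj : Age y n j).
  { rewrite <- (cyc_run U h Sel y _ w j HC Hj).
    replace n with (n - Z.of_nat j + Z.of_nat j)%Z at 1 by lia.
    apply (age_run U h); auto. }
  assert (j = 0%nat) as ->.
  { apply (age_unique U h eps eta n0 h_low h_high eps_eta y n); auto. }
  exists w. now rewrite Z.sub_0_r in HC.
Qed.

(** The visits to [o] locate the renewals, hence the length of the last cycle, and the states in
    between spell its word. For the converse, that word is compared with the path entry by entry. *)
Lemma traces_process n x L y : two_sided y -> x 0%nat = o -> x L = o ->
  traces n x L y <-> forall i, (i <= L)%nat -> process y (n + Z.of_nat i)%Z = x i.
Proof.
  intros Hy H0. induction L as [L IH] using (well_founded_induction lt_wf). intros HL.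
  destruct (Nat.eq_dec L 0) as [->|HL0].
  - split.
    + intros [H _] i Hi. replace i with 0%nat by lia. rewrite H0. apply two_sided_renewal; auto.
      now rewrite Z.add_0_r.
    + intros H. specialize (H 0%nat (Nat.le_refl _)). rewrite H0, Z.add_0_r in H. split.
      * now apply two_sided_renewal.
      * intros j j' (R1 & _) Hj. lia.
  - destruct (last_return x L H0 HL) as [j Hr]; [lia|].
    rewrite (traces_last n x j L y Hr). assert (Hr' := Hr). destruct Hr' as (R1 & R2 & R3 & R4).
    rewrite IH by auto. split.
    + intros [H1 HC] i Hi. assert (HA : Age y (n + Z.of_nat j)%Z 0%nat).
      { apply two_sided_renewal; auto. rewrite H1; auto. }
      destruct (le_lt_dec i j) as [Hij|Hij]; [auto|].
      destruct (Nat.eq_dec i L) as [->|HiL].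
      * rewrite HL. apply two_sided_renewal; auto.
        assert (H := cyc_renewal_next o U h Sel eps eta n0 Sel_cycle Sel_ex y _ _ HA HC).
        rewrite segment_length in H.
        now replace (n + Z.of_nat j + Z.of_nat (L - j))%Z with (n + Z.of_nat L)%Z in H by lia.
      * replace (n + Z.of_nat i)%Z with (n + Z.of_nat j + Z.of_nat (i - j))%Z by lia.
        rewrite (cycle_process y _ _ _ HA HC) by (rewrite segment_length; lia).
        rewrite segment_nth by lia. f_equal. lia.
    + intros H. split; [intros; apply H; lia|].
      assert (HA : Age y (n + Z.of_nat j)%Z 0%nat).
      { apply two_sided_renewal; auto. rewrite H; auto. lia. }
      destruct (two_sided_next y _ Hy HA) as [w HC].
      destruct (Sel_cycle _ _ _ (proj2 HC)) as [(C1 & C2 & C3) _].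
      enough (w = segment x j (L - j)) as <- by auto.
      assert (Hend : process y (n + Z.of_nat j + Z.of_nat (length w))%Z = o).
      { apply two_sided_renewal; auto.
        apply (cyc_renewal_next o U h Sel eps eta n0 Sel_cycle Sel_ex); auto. }
      assert (Hlen : length w = (L - j)%nat).
      { destruct (Nat.lt_total (length w) (L - j)) as [Hl|[|Hl]]; auto; exfalso.
        - apply (R4 (j + length w)%nat); [lia|]. rewrite <- H by lia.
          now replace (n + Z.of_nat (j + length w))%Z with (n + Z.of_nat j + Z.of_nat (length w))%Z by lia.
        - apply (C3 (L - j)%nat); [lia|]. rewrite <- (cycle_process y _ _ _ HA HC) by lia.
          replace (n + Z.of_nat j + Z.of_nat (L - j))%Z with (n + Z.of_nat L)%Z by lia.
          rewrite H; auto. }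
      apply (nth_list_ext o); [now rewrite segment_length|]. intros i Hi.
      rewrite segment_nth by lia. rewrite <- (cycle_process y _ _ _ HA HC) by lia.
      rewrite <- H by lia. f_equal. lia.
Qed.

Lemma chain_measurable E : prod_sigma (@discrete St) E -> Sig (fun w => E (fun n => M n w)).
Proof.
  apply (generated_preimage (fun (w : O) n => M n w)); auto. intros F (n & C & _ & HF).
  apply (sig_iff (fun w => exists x, M n w = x /\ C x)).
  - intros w. rewrite HF. split; [intros (x & <- & H); auto|eauto].
  - meas HS.
Qed.

Lemma null_restrict E : prod_sigma SigA E -> Q E = Q (fun y => E y /\ two_sided y).
Proof.
  intros HE. rewrite (meas_split HmQ E two_sided HE two_sided_measurable).
  assert (Q (fun y => E y /\ ~ two_sided y) = 0); [|cbv beta in *; lra].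
  apply (meas_null_sub HmQ _ (fun y => ~ two_sided y)); [|apply (sig_not HSQ), two_sided_measurable|tauto|apply two_sided_full].
  apply (sig_and HSQ); auto. apply (sig_not HSQ), two_sided_measurable.
Qed.

Definition scale : R := renewal_prob / pi o.

Lemma scale_ge0 : 0 <= scale.
Proof.
  apply Rmult_le_pos; [|left; now apply Rinv_0_lt_compat].
  apply (meas_ge0 HmQ). eapply past_prod, renewal_measurable.
Qed.

Let HSD : is_sigma (prod_sigma (@discrete St)) := is_sigma_generated _.

Lemma state_eq_measurable n (x : St) : prod_sigma (@discrete St) (fun z => z n = x).
Proof. apply generated_base. exists n, (fun x' => x' = x). repeat split; auto. Qed.

(** The factor [scale] is kept because pinned cylinders determine the law of the factor only up to
    this constant. *)
Definition law_chain (E : (Z -> St) -> Prop) : R := scale * P (fun w => E (fun n => M n w)).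
Definition law_factor (E : (Z -> St) -> Prop) : R := Q (fun y => E (process y)).

Lemma law_chain_measure : is_measure (prod_sigma (@discrete St)) law_chain.
Proof.
  apply (meas_scale (m := fun E => P (fun w => E (fun n => M n w)))); [|apply scale_ge0].
  apply (meas_image Hm _ (fun (w : O) n => M n w)); auto. apply chain_measurable.
Qed.

Lemma law_factor_measure : is_measure (prod_sigma (@discrete St)) law_factor.
Proof. apply (meas_image HmQ _ process); auto. apply process_measurable. Qed.

Lemma law_cylinder n x L : x 0%nat = o -> x L = o ->
  law_factor (fun z => forall i, (i <= L)%nat -> z (n + Z.of_nat i)%Z = x i) =
  law_chain (fun z => forall i, (i <= L)%nat -> z (n + Z.of_nat i)%Z = x i).
Proof.
  intros H0 HL. unfold law_factor, law_chain, scale. rewrite <- traces_prob by auto.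
  assert (MC : prod_sigma (@discrete St) (fun z => forall i, (i <= L)%nat -> z (n + Z.of_nat i)%Z = x i)).
  { apply (sig_all HSD); [cty|]. intros i. apply (sig_guard HSD). intros _. apply state_eq_measurable. }
  rewrite null_restrict by (apply (process_measurable _ MC)).
  rewrite (null_restrict (traces n x L)) by (eapply past_prod, traces_measurable).
  f_equal. apply ev_ext. intros y. split; intros [H1 H2]; split; auto; now apply (traces_process n x L y).
Qed.

Definition local_event (n : Z) (L : nat) (E : (Z -> St) -> Prop) : Prop :=
  forall z z', (forall i, (i <= L)%nat -> z (n + Z.of_nat i)%Z = z' (n + Z.of_nat i)%Z) -> E z -> E z'.

(** [E] is tested on the path that reads [l] from time [n] on; outside the window that path takes
    arbitrary values, which a local event ignores. *)
Definition on_path (n : Z) (L : nat) (E : (Z -> St) -> Prop) (l : list St) (z : Z -> St) : Prop :=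
  length l = S L /\ (forall i, (i <= L)%nat -> z (n + Z.of_nat i)%Z = nth i l o) /\
  E (fun k => nth (Z.to_nat (k - n)) l o).

Lemma on_path_iff n L E z : local_event n L E -> E z <-> exists l, on_path n L E l z.
Proof.
  intros HE. split.
  - intros Hz. exists (segment (fun i => z (n + Z.of_nat i)%Z) 0 (S L)).
    split; [apply segment_length|]. split.
    + intros i Hi. rewrite segment_nth by lia. reflexivity.
    + apply (HE z); auto. intros i Hi.
      replace (Z.to_nat (n + Z.of_nat i - n)) with i by lia.
      rewrite segment_nth by lia. reflexivity.
  - intros (l & Hl & H1 & H2). apply (HE _ z) in H2; auto. intros i Hi.
    rewrite H1 by auto. f_equal. lia.
Qed.

Lemma on_path_measurable n L E l : prod_sigma (@discrete St) (on_path n L E l).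
Proof.
  apply (sig_guard_and HSD). intros _. apply (sig_and HSD); [|apply (sig_const HSD)].
  apply (sig_all HSD); [cty|]. intros i. apply (sig_guard HSD). intros _. apply state_eq_measurable.
Qed.

Lemma on_path_disjoint n L E l l' z : l <> l' -> on_path n L E l z -> on_path n L E l' z -> False.
Proof.
  intros Hl (H1 & H2 & _) (H1' & H2' & _). apply Hl, (nth_list_ext o); [congruence|].
  intros i Hi. rewrite <- H2, <- H2' by lia. reflexivity.
Qed.

Lemma local_measurable n L E : local_event n L E -> prod_sigma (@discrete St) E.
Proof.
  intros HE. apply (sig_iff (fun z => exists l, on_path n L E l z)).
  - intros z. symmetry. now apply on_path_iff.
  - apply (sig_ex HSD); auto. intros l. apply on_path_measurable.
Qed.

(** A local event is a countable disjoint union over words; here each word gives either an empty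
    event or a cylinder with [o] at both ends. *)
Lemma law_pinned n L E : local_event n L E ->
  (forall z, E z -> z n = o /\ z (n + Z.of_nat L)%Z = o) -> law_factor E = law_chain E.
Proof.
  intros HE Ho. rewrite (ev_ext E (fun z => exists l, on_path n L E l z)) by (intros; now apply on_path_iff).
  apply (meas_partition (on_path n L E) (on_path n L E) law_factor_measure law_chain_measure cL).
  - apply on_path_measurable.
  - intros l l' z. apply on_path_disjoint.
  - apply on_path_measurable.
  - intros l l' z. apply on_path_disjoint.
  - intros l. destruct (classic (length l = S L /\ E (fun k => nth (Z.to_nat (k - n)) l o))) as [[Hl HEl]|Hn].
    + replace (on_path n L E l) with (fun z : Z -> St => forall i, (i <= L)%nat -> z (n + Z.of_nat i)%Z = nth i l o)
        by (apply ev_ext; unfold on_path; tauto).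
      destruct (Ho _ HEl) as [H1 H2]. apply (law_cylinder n (fun i => nth i l o)).
      * now replace (Z.to_nat (n - n)) with 0%nat in H1 by lia.
      * now replace (Z.to_nat (n + Z.of_nat L - n)) with L in H2 by lia.
    + replace (on_path n L E l) with (fun z : Z -> St => False)
        by (apply ev_ext; unfold on_path; tauto).
      now rewrite (meas_empty law_factor_measure), (meas_empty law_chain_measure).
Qed.

Definition visits (N : nat) (z : Z -> St) : Prop :=
  (exists a : nat, z (- Z.of_nat N - Z.of_nat a)%Z = o) /\ (exists b : nat, z (Z.of_nat N + Z.of_nat b)%Z = o).

Lemma visits_measurable N : prod_sigma (@discrete St) (visits N).
Proof.
  apply (sig_and HSD); (apply (sig_ex HSD); [cty|]); intros k; apply state_eq_measurable.
Qed.

Lemma visits_factor N : law_factor (fun z => ~ visits N z) = 0.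
Proof.
  apply (meas_null_sub HmQ _ (fun y => ~ two_sided y)).
  - apply (process_measurable (fun z => ~ visits N z)). apply (sig_not HSD), visits_measurable.
  - apply (sig_not HSQ), two_sided_measurable.
  - intros y Hn Hy. apply Hn. split.
    + destruct (Hy (- Z.of_nat N)%Z) as [[k Hk] _]. exists k. apply two_sided_renewal; auto.
      now apply (age_pattern U h).
    + destruct (Hy (Z.of_nat N)) as [_ [d [Hd Hk]]]. exists d. apply two_sided_renewal; auto.
      now apply (age_pattern U h).
  - apply two_sided_full.
Qed.

(** A missing visit on one side leaves a stretch of [a] sites without [o], whose probability is
    below any bound for large [a], uniformly in the position. *)
Lemma visits_chain N : law_chain (fun z => ~ visits N z) = 0.
Proof.
  unfold law_chain. enough (H : P (fun w => ~ visits N (fun n => M n w)) = 0) by (rewrite H; ring).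
  assert (MV : Sig (fun w => ~ visits N (fun n => M n w))).
  { apply (chain_measurable (fun z => ~ visits N z)). apply (sig_not HSD), visits_measurable. }
  apply Rle_antisym; [|now apply (meas_ge0 Hm)].
  apply Rnot_lt_le. intros Hp.
  destruct (recurrent (P (fun w => ~ visits N (fun n => M n w)) / 2)) as [a Ha]; [lra|].
  assert (MR : forall n, Sig (fun w => forall i, (i < a)%nat -> M (n + Z.of_nat i)%Z w <> o)) by (intros; meas HS).
  assert (H1 := Ha (- Z.of_nat N - Z.of_nat a)%Z). assert (H2 := Ha (Z.of_nat N)).
  assert (H3 := meas_union_le Hm _ _ (MR (- Z.of_nat N - Z.of_nat a)%Z) (MR (Z.of_nat N))).
  assert (H4 : P (fun w => ~ visits N (fun n => M n w)) <=
    P (fun w => (forall i, (i < a)%nat -> M (- Z.of_nat N - Z.of_nat a + Z.of_nat i)%Z w <> o) \/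
      (forall i, (i < a)%nat -> M (Z.of_nat N + Z.of_nat i)%Z w <> o))).
  { apply (meas_mono Hm); auto; [now apply (sig_or HS)|]. intros w Hw.
    apply not_and_or in Hw as [Hw|Hw]; [left|right]; intros i Hi E; apply Hw.
    - exists (a - i)%nat. rewrite <- E. f_equal. lia.
    - now exists i. }
  cbv beta in H3. lra.
Qed.

(** Splitting according to the last visit to [o] up to [-N] and the first from [N] on turns a local
    event, up to a null set, into countably many pinned ones. *)
Lemma law_local N E : local_event (- Z.of_nat N) (2 * N) E -> law_factor E = law_chain E.
Proof.
  intros HE. assert (ME := local_measurable _ _ _ HE). assert (MV := visits_measurable N).
  assert (MN := sig_not HSD _ MV).
  assert (Hnull : forall m, is_measure (prod_sigma (@discrete St)) m -> m (fun z => ~ visits N z) = 0 ->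
    m E = m (fun z => E z /\ visits N z)).
  { intros m Hm0 H0. rewrite (meas_split Hm0 E (visits N) ME MV).
    assert (m (fun z => E z /\ ~ visits N z) = 0); [|cbv beta in *; lra].
    apply (meas_null_sub Hm0 _ (fun z => ~ visits N z)); auto; [now apply (sig_and HSD)|tauto]. }
  rewrite (Hnull _ law_factor_measure (visits_factor N)), (Hnull _ law_chain_measure (visits_chain N)).
  pose (G := fun (t : nat * nat) (z : Z -> St) => E z /\
    (z (- Z.of_nat N - Z.of_nat (fst t))%Z = o /\ forall i, (i < fst t)%nat -> z (- Z.of_nat N - Z.of_nat i)%Z <> o) /\
    (z (Z.of_nat N + Z.of_nat (snd t))%Z = o /\ forall i, (i < snd t)%nat -> z (Z.of_nat N + Z.of_nat i)%Z <> o)).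
  assert (MG : forall t, prod_sigma (@discrete St) (G t)).
  { intros t. assert (H := state_eq_measurable). apply (sig_and HSD); auto. apply (sig_and HSD);
      (apply (sig_and HSD); [apply H|]; apply (sig_all HSD); [cty|]; intros i; apply (sig_guard HSD);
       intros _; apply (sig_not HSD), H). }
  assert (DG : forall s t z, s <> t -> G s z -> G t z -> False).
  { intros [a b] [a' b'] z Hst (_ & [H1 H2] & [H3 H4]) (_ & [H1' H2'] & [H3' H4']). simpl in *. apply Hst. f_equal.
    - destruct (Nat.lt_total a a') as [|[|]]; auto; exfalso; [eapply H2'|eapply H2]; eauto.
    - destruct (Nat.lt_total b b') as [|[|]]; auto; exfalso; [eapply H4'|eapply H4]; eauto. }
  replace (fun z => E z /\ visits N z) with (fun z => exists t, G t z).
  2:{ apply ev_ext. intros z. split.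
      - intros ([a b] & HEz & [H1 _] & [H2 _]). split; [auto|]. split; eauto.
      - intros (HEz & [a Ha] & [b Hb]).
        destruct (least_element
          (fun a => z (- Z.of_nat N - Z.of_nat a)%Z = o)) as (p & [Hp Hpm]); [eauto|].
        destruct (least_element
          (fun b => z (Z.of_nat N + Z.of_nat b)%Z = o)) as (q & [Hq Hqm]); [eauto|].
        exists (p, q). split; [auto|]. simpl. split; (split; [auto|]); intros i Hi Hz.
        + apply Hpm in Hz. lia.
        + apply Hqm in Hz. lia. }
  apply (meas_partition G G law_factor_measure law_chain_measure); auto; [cty|].
  intros [a b]. apply (law_pinned (- Z.of_nat N - Z.of_nat a)%Z (2 * N + a + b)%nat).
  - assert (Hz : forall z z' : Z -> St,
      (forall i, (i <= 2 * N + a + b)%nat -> z (- Z.of_nat N - Z.of_nat a + Z.of_nat i)%Z =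
        z' (- Z.of_nat N - Z.of_nat a + Z.of_nat i)%Z) ->
      forall k, (- Z.of_nat N - Z.of_nat a <= k <= Z.of_nat N + Z.of_nat b)%Z -> z k = z' k).
    { intros z z' H k Hk. specialize (H (Z.to_nat (k + Z.of_nat N + Z.of_nat a)) ltac:(lia)).
      now replace (- Z.of_nat N - Z.of_nat a + Z.of_nat (Z.to_nat (k + Z.of_nat N + Z.of_nat a)))%Z with k in H by lia. }
    intros z z' H (HEz & [H1 H2] & [H3 H4]). assert (Hk := Hz _ _ H). simpl in *.
    split; [|split; split].
    + apply (HE z); auto. intros i Hi. apply Hk. lia.
    + simpl. rewrite <- Hk by lia. auto.
    + simpl. intros i Hi. rewrite <- Hk by lia. auto.
    + simpl. rewrite <- Hk by lia. auto.
    + simpl. intros i Hi. rewrite <- Hk by lia. auto.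
  - intros z (_ & [H1 _] & [H2 _]). simpl in *. split; auto.
    rewrite <- H2. f_equal. lia.
Qed.

(** The sure event is local, and both laws come from probabilities. *)
Lemma scale_1 : scale = 1.
Proof.
  assert (H := law_local 0 (fun _ => True) ltac:(now intros ? ?)).
  unfold law_factor, law_chain in H. rewrite Q_total in H.
  assert (P (fun _ => True) = 1) by apply HP. rewrite H0 in H. lra.
Qed.

Lemma law_eq E : prod_sigma (@discrete St) E -> law_factor E = P (fun w => E (fun n => M n w)).
Proof.
  intros HE. transitivity (law_chain E); [|unfold law_chain; rewrite scale_1; lra].
  apply (meas_unique (fun E => exists N : nat, local_event (- Z.of_nat N) (2 * N) E) (prod_sigma (@discrete St)));
    auto using law_factor_measure, law_chain_measure.
  - intros F [N HF]. eapply local_measurable; eauto.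
  - intros F G [N HF] [N' HG]. exists (N + N')%nat. intros z z' Hz [H1 H2].
    assert (Hk : forall k, (- Z.of_nat (N + N') <= k <= Z.of_nat (N + N'))%Z -> z k = z' k).
    { intros k Hk. specialize (Hz (Z.to_nat (k + Z.of_nat (N + N'))) ltac:(lia)).
      now replace (- Z.of_nat (N + N') + Z.of_nat (Z.to_nat (k + Z.of_nat (N + N'))))%Z with k in Hz by lia. }
    split; [apply (HF z)|apply (HG z)]; auto; intros i Hi; apply Hk; lia.
  - apply (law_local 0). now intros ? ?.
  - intros F [N HF]. eapply law_local; eauto.
  - revert HE. apply generated_sub. intros F (n & C & _ & HF). apply generated_base.
    exists (Z.abs_nat n). intros z z' Hz. rewrite !HF.
    specialize (Hz (Z.to_nat (n + Z.of_nat (Z.abs_nat n))) ltac:(lia)).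
    replace (- Z.of_nat (Z.abs_nat n) + Z.of_nat (Z.to_nat (n + Z.of_nat (Z.abs_nat n))))%Z with n in Hz by lia.
    now rewrite Hz.
Qed.

Lemma site_law n B : SigA B -> Q (fun y => B (y n)) = Q (fun y => B (y 0%Z)).
Proof.
  intros HB. rewrite <- (Q_shift n (fun y => B (y 0%Z))) by (now apply site_measurable).
  now rewrite Z.add_0_r.
Qed.

Lemma coordinates_iid : iid (prod_sigma SigA) Q SigA (fun n y => y n).
Proof.
  split; [|split].
  - intros n B HB. now apply site_measurable.
  - apply site_law.
  - intros ns Bs Hns HBs.
    induction Hns as [|n ns Hn Hns IH]; simpl.
    + rewrite <- Q_total. f_equal. apply ev_ext. intros; split; auto.
    + rewrite <- IH, (site_law n (Bs n) (HBs n)), Rmult_comm.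
      rewrite <- (Q_indep (fun i => In i ns) n); auto.
      * f_equal. apply ev_ext. intros y. split.
        -- intros H. inversion H; subst. auto.
        -- intros [H1 H2]. now constructor.
      * assert (HS' : is_sigma (coord_sigma SigA (fun i => In i ns))) by apply is_sigma_generated.
        apply (sig_iff (fun y => forall i, In i ns -> Bs i (y i))).
        { intros y. symmetry. apply Forall_forall. }
        apply (sig_all HS'); [cty|]. intros i. apply (sig_guard HS'). intros Hi.
        apply generated_base. exists i, (Bs i). split; auto. split; auto. tauto.
Qed.

Lemma core_factor : finitary_iid_factor_exp P M.
Proof.
  destruct window_tail as (C & c & HC & Hc & Htail).
  exists (Z -> A), (prod_sigma SigA), Q, A, SigA, (fun n y => y n), phi, window, C, c.
  split; [auto|]. split; [auto|]. split; [apply coordinates_iid|].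
  split; [intros B _; apply phi_measurable|].
  split; [intros B HB; apply (law_eq B HB)|].
  split.
  { intros r. apply (sig_iff (good r)); [intros; symmetry; apply window_le|apply good_measurable]. }
  split.
  { intros B r. apply (sig_iff (fun y => B (phi y) /\ good r y)); [|apply window_phi_measurable].
    intros y. now rewrite window_le. }
  split.
  { rewrite <- never_good_null. f_equal. apply ev_ext. intros y.
    assert (H := window_spec y). change (fun k => y k) with y. destruct (window y) as [p|].
    - split; [discriminate|]. intros Hn. exfalso. eapply Hn. apply H.
    - tauto. }
  auto.
Qed.
End core.

(** * Renewal sequences *)

Lemma rsum_ext f g n : (forall k, (k < n)%nat -> f k = g k) -> rsum f n = rsum g n.
Proof. induction n; simpl; intros H; auto. rewrite H, IHn; auto. Qed.

Lemma rsum_le f g n : (forall k, (k < n)%nat -> f k <= g k) -> rsum f n <= rsum g n.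
Proof.
  induction n; simpl; intros H; [lra|]. assert (H1 := H n ltac:(lia)).
  assert (rsum f n <= rsum g n) by auto. lra.
Qed.

Lemma rsum_scal c f n : rsum (fun k => c * f k) n = c * rsum f n.
Proof. induction n; simpl; [lra|]. rewrite IHn. lra. Qed.

Lemma rsum_minus f g n : rsum (fun k => f k - g k) n = rsum f n - rsum g n.
Proof. induction n; simpl; [lra|]. rewrite IHn. lra. Qed.

Lemma rsum_const c n : rsum (fun _ => c) n = c * INR n.
Proof. induction n; [simpl; lra|]. rewrite S_INR. simpl. rewrite IHn. lra. Qed.

Lemma rsum_head f n : rsum f (S n) = f 0%nat + rsum (fun k => f (S k)) n.
Proof. induction n; simpl in *; [lra|]. rewrite IHn. lra. Qed.

Lemma rsum_add f m n : rsum f (m + n) = rsum f m + rsum (fun k => f (m + k)%nat) n.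
Proof.
  induction n; simpl; [rewrite Nat.add_0_r; lra|]. rewrite Nat.add_succ_r. simpl. rewrite IHn. lra.
Qed.

Lemma rsum_ge0 f n : (forall k, (k < n)%nat -> 0 <= f k) -> 0 <= rsum f n.
Proof.
  intros H. replace 0 with (rsum (fun _ => 0) n) by (rewrite rsum_const; lra).
  now apply rsum_le.
Qed.

Lemma rsum_geometric r n : 0 <= r < 1 -> rsum (fun k => r ^ k) n <= / (1 - r).
Proof.
  intros Hr. assert (H : rsum (fun k => r ^ k) n * (1 - r) = 1 - r ^ n).
  { induction n; simpl; [lra|]. rewrite Rmult_plus_distr_r, IHn. ring. }
  apply (Rmult_le_reg_r (1 - r)); [lra|]. rewrite H, Rinv_l by lra.
  assert (0 <= r ^ n) by (apply pow_le; lra). lra.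
Qed.

(** * Additive sets of integers with greatest common divisor one *)

Section semigroup.
Context (G : nat -> Prop) (G_add : forall m n, G m -> G n -> G (m + n)%nat).
Context (G_gcd : forall d, (forall n, (1 <= n)%nat -> G n -> Nat.divide d n) -> d = 1%nat).

Lemma semigroup_mult k a : G a -> G ((1 + k) * a)%nat.
Proof.
  intros Ha. induction k; [now rewrite Nat.mul_1_l|].
  replace ((1 + S k) * a)%nat with (a + (1 + k) * a)%nat by lia. auto.
Qed.

(* A least positive gap [d] between two elements divides every element, hence equals 1. *)
Lemma semigroup_gap : exists a, (1 <= a)%nat /\ G a /\ G (a + 1)%nat.
Proof.
  assert (Hne : exists n, (1 <= n)%nat /\ G n).
  { apply NNPP. intros Hn. assert (H := G_gcd 2 ltac:(intros n H1 H2; exfalso; eauto)). discriminate. }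
  destruct Hne as (n & Hn & Gn).
  pose (gap := fun d => (1 <= d)%nat /\ exists a, (1 <= a)%nat /\ G a /\ G (a + d)%nat).
  destruct (least_element gap) as (d & [(Hd & a & Ha & Ga & Gd) Hmin]).
  { exists n. split; auto. exists n. auto. }
  assert (d = 1%nat) as ->; [|eauto].
  apply G_gcd. intros m Hm Gm.
  apply NNPP. intros Hnd.
  set (k := (m / d)%nat). assert (Hdiv := Nat.div_mod_eq m d). fold k in Hdiv.
  assert (Hr : (0 < m mod d < d)%nat).
  { assert (H := Nat.mod_upper_bound m d ltac:(lia)).
    destruct (Nat.eq_dec (m mod d) 0) as [E|]; [|lia].
    exfalso. apply Hnd. exists k. nia. }
  (* With [m = d * k + m mod d], the elements [m + (1 + k) * a] and [(1 + k) * (a + d)] differ by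
     [d - m mod d], a gap smaller than [d]. *)
  assert (Hg : gap (d - m mod d)%nat).
  { split; [lia|]. exists (m + (1 + k) * a)%nat. split; [lia|]. split.
    - apply G_add; auto. now apply semigroup_mult.
    - replace (m + (1 + k) * a + (d - m mod d))%nat with ((1 + k) * (a + d))%nat by nia.
      now apply semigroup_mult. }
  apply Hmin in Hg. lia.
Qed.

(** If [n = a * k + r] with [r < a <= k], then [n = (k - r) * a + r * (a + 1)]. Zero multiples are
    treated apart, since [G 0] is not assumed. *)
Lemma semigroup_cofinite : exists N, forall n, (N <= n)%nat -> G n.
Proof.
  destruct semigroup_gap as (a & Ha & Ga & Ga1).
  exists (a * a + a)%nat. intros n Hn.
  set (k := (n / a)%nat). set (r := (n mod a)%nat).
  assert (Hdiv := Nat.div_mod_eq n a). fold k r in Hdiv.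
  assert (Hr : (r < a)%nat) by (apply Nat.mod_upper_bound; lia).
  assert (Hk : (a <= k)%nat) by nia.
  destruct (Nat.eq_dec r 0) as [E|E].
  - replace n with ((1 + (k - 1)) * a)%nat by nia. now apply semigroup_mult.
  - replace n with ((1 + (k - r - 1)) * a + (1 + (r - 1)) * (a + 1))%nat by nia.
    apply G_add; now apply semigroup_mult.
Qed.
End semigroup.

(** * Lower bound for a renewal sequence; [a k] is the weight of the gap [k + 1] *)

Section renewal_sequence.
Context (a u : nat -> R).
Context (a_ge0 : forall k, 0 <= a k) (u_0 : u 0%nat = 1).
Context (u_renewal : forall n, u (S n) = rsum (fun k => a k * u (n - k)%nat) (S n)).

Lemma renewal_ge0 n : 0 <= u n.
Proof.
  induction n as [n IH] using (well_founded_induction lt_wf). destruct n; [lra|].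
  rewrite u_renewal. apply rsum_ge0. intros k Hk. apply Rmult_le_pos; auto. apply IH. lia.
Qed.

(** Renewing at both [m] and [m + n] is one way to renew at [m + n]. In the induction, the terms
    whose first gap passes [m] are dropped from the renewal equation at [m + n]. *)
Lemma renewal_supermult m n : u m * u n <= u (m + n)%nat.
Proof.
  induction m as [m IH] using (well_founded_induction lt_wf). destruct m; [simpl; rewrite u_0; lra|].
  simpl. rewrite !u_renewal.
  replace (S (m + n)) with (S m + n)%nat by lia. rewrite rsum_add.
  assert (H1 : 0 <= rsum (fun k => a (S m + k)%nat * u (m + n - (S m + k))%nat) n).
  { apply rsum_ge0. intros. apply Rmult_le_pos; auto. apply renewal_ge0. }
  assert (H2 : rsum (fun k => a k * u (m - k)%nat) (S m) * u n <=
    rsum (fun k => a k * u (m + n - k)%nat) (S m)); [|lra].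
  rewrite Rmult_comm, <- rsum_scal. apply rsum_le. intros k Hk.
  replace (m + n - k)%nat with ((m - k) + n)%nat by lia.
  assert (H := IH (m - k)%nat ltac:(lia)). assert (Ha := a_ge0 k). nra.
Qed.

Context (a_le1 : forall n, rsum a n <= 1).

Lemma renewal_le1 n : u n <= 1.
Proof.
  induction n as [n IH] using (well_founded_induction lt_wf). destruct n; [lra|].
  rewrite u_renewal. eapply Rle_trans; [|apply (a_le1 (S n))].
  apply rsum_le. intros k Hk. assert (H := IH (n - k)%nat ltac:(lia)). assert (Ha := a_ge0 k). nra.
Qed.

(** Decomposition by the last renewal up to [n]: it lies [k] steps back when a renewal at [n - k] is
    followed by a gap longer than [k]. *)
Lemma renewal_identity n : rsum (fun k => (1 - rsum a k) * u (n - k)%nat) (S n) = 1.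
Proof.
  induction n; [simpl; rewrite u_0; lra|].
  rewrite rsum_head. simpl (rsum a 0). rewrite Nat.sub_0_r.
  rewrite (rsum_ext _ (fun k => (1 - rsum a k) * u (n - k)%nat - a k * u (n - k)%nat)).
  - rewrite rsum_minus, IHn, <- u_renewal. lra.
  - intros k Hk. simpl. ring.
Qed.

Context (c r : R) (Hr : 0 <= r < 1) (a_tail : forall k, 1 - rsum a k <= c * r ^ k).

(** In [renewal_identity] the terms from [K] on add up to at most 1/4. If every [u (n - k)] with
    [k < K] were below [1 / (2 K)], the others would add up to at most 1/2, and the total could not
    be 1. *)
Lemma renewal_window : exists d K, 0 < d /\ (1 <= K)%nat /\
  forall n, (K <= n)%nat -> exists k, (k < K)%nat /\ d <= u (n - k)%nat.
Proof.
  assert (Hc : 1 <= c). { assert (H := a_tail 0). simpl in H. lra. }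
  destruct (pow_lt_1_zero r ltac:(rewrite Rabs_right; lra) ((1 - r) / (4 * c))) as [N HN].
  { apply Rdiv_lt_0_compat; lra. }
  set (K := (N + 1)%nat). specialize (HN K ltac:(lia)).
  rewrite Rabs_right in HN by (apply Rle_ge, pow_le; lra).
  assert (HK : 0 < INR K) by (apply lt_0_INR; lia).
  exists (/ (2 * INR K)), K. split; [apply Rinv_0_lt_compat; lra|]. split; [lia|].
  intros n Hn. apply NNPP. intros Hno.
  assert (Hlt : forall k, (k < K)%nat -> u (n - k)%nat < / (2 * INR K)).
  { intros k Hk. apply Rnot_le_lt. eauto. }
  assert (H := renewal_identity n).
  replace (S n) with (K + (S n - K))%nat in H by lia. rewrite rsum_add in H.
  assert (H1 : rsum (fun k => (1 - rsum a k) * u (n - k)%nat) K <= / 2).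
  { apply Rle_trans with (rsum (fun _ => / (2 * INR K)) K).
    - apply rsum_le. intros k Hk. specialize (Hlt k Hk).
      assert (0 <= rsum a k) by (apply rsum_ge0; auto). assert (H2 := a_le1 k).
      assert (H3 := renewal_ge0 (n - k)). nra.
    - rewrite rsum_const. right. field. lra. }
  assert (H2 : rsum (fun k => (1 - rsum a (K + k)) * u (n - (K + k))%nat) (S n - K) <= / 4).
  { apply Rle_trans with (rsum (fun k => (c * r ^ K) * r ^ k) (S n - K)).
    - apply rsum_le. intros k Hk. rewrite Rmult_assoc, <- pow_add.
      assert (H3 := a_tail (K + k)). assert (H4 := a_le1 (K + k)).
      assert (H5 := renewal_ge0 (n - (K + k))). assert (H6 := renewal_le1 (n - (K + k))). nra.
    - rewrite rsum_scal. assert (Hg := rsum_geometric r (S n - K) Hr).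
      assert (0 <= r ^ K) by (apply pow_le; lra).
      apply Rle_trans with ((c * r ^ K) * / (1 - r)); [apply Rmult_le_compat_l; [apply Rmult_le_pos; lra|exact Hg]|].
      apply (Rmult_le_reg_r (1 - r)); [lra|]. rewrite Rmult_assoc, Rinv_l, Rmult_1_r by lra.
      apply Rlt_le, (Rmult_le_compat_l c) in HN; [|lra].
      replace (c * ((1 - r) / (4 * c))) with (/ 4 * (1 - r)) in HN by (field; lra). exact HN. }
  lra.
Qed.

(** Some index [n - N1 - k] with [k < K] has a value of at least [d]; the remaining distance
    [N1 + k] ranges over finitely many indices, all with positive values, and supermultiplicativity
    joins the two. *)
Lemma renewal_bounded_below (N1 : nat) : (forall n, (N1 <= n)%nat -> 0 < u n) ->
  exists d N, 0 < d /\ forall n, (N <= n)%nat -> d <= u n.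
Proof.
  intros Hpos. destruct renewal_window as (d & K & Hd & HK & Hw).
  assert (Hmin : forall l, exists d', 0 < d' /\ forall k, (k < l)%nat -> d' <= u (N1 + k)%nat).
  { induction l as [|l (d' & Hd' & IH)]; [exists 1; split; [lra|]; intros; lia|].
    exists (Rmin d' (u (N1 + l)%nat)). split; [apply Rmin_glb_lt; auto; apply Hpos; lia|].
    intros k Hk. destruct (Nat.eq_dec k l) as [->|]; [apply Rmin_r|].
    eapply Rle_trans; [apply Rmin_l|]. apply IH. lia. }
  destruct (Hmin K) as (d' & Hd' & Hd'').
  exists (d * d'), (N1 + K)%nat. split; [nra|]. intros n Hn.
  destruct (Hw (n - N1)%nat ltac:(lia)) as (k & Hk & Huk).
  assert (H := renewal_supermult (n - N1 - k) (N1 + k)).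
  replace (n - N1 - k + (N1 + k))%nat with n in H by lia.
  specialize (Hd'' k Hk). nra.
Qed.
End renewal_sequence.

(** * Exponential tilting *)

(* For [q] the inverse of the generating function of [f] at [exp lam], the weights
   [q * f k * exp (lam * (k + 1))] form a probability distribution with exponential tails. *)
Lemma tilt (f : nat -> R) (C c : R) : 0 < c -> (forall k, 0 <= f k) ->
  (forall k, f k <= C * exp (- c * INR (S k))) ->
  (forall k, 0 <= 1 - rsum f k <= C * exp (- c * INR (S k))) ->
  exists q lam, 0 < q < 1 /\ 0 < lam /\
    let a := fun k => q * f k * exp (lam * INR (S k)) in
    (forall n, rsum a n <= 1) /\
    exists C' r, 0 <= r < 1 /\ forall k, 1 - rsum a k <= C' * r ^ k.
Proof.
  (* Half of the decay rate is spent on the tilt and the other half remains as the decay [r] of the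
     tilted weights. *)
  intros Hc Hf Hfle Htail. set (lam := c / 2). set (r := exp (- lam)).
  assert (Hlam : 0 < lam) by (unfold lam; lra).
  assert (Hr : 0 < r < 1).
  { split; [apply exp_pos|]. unfold r. rewrite <- exp_0. apply exp_increasing. lra. }
  assert (HC : 0 <= C).
  { assert (H := Hf 0%nat). assert (H' := Hfle 0%nat). assert (He := exp_pos (- c * INR 1)). nra. }
  assert (Hrk : forall k, exp (- lam * INR k) = r ^ k).
  { intros k. unfold r. rewrite <- (Rpower_pow k) by apply exp_pos. unfold Rpower.
    rewrite ln_exp. f_equal. ring. }
  set (b := fun k => f k * exp (lam * INR (S k))).
  assert (Hb0 : forall k, 0 <= b k).
  { intros k. apply Rmult_le_pos; auto. left. apply exp_pos. }
  assert (Hb : forall k, b k <= C * r ^ k).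
  { intros k. unfold b. eapply Rle_trans; [apply Rmult_le_compat_r; [left; apply exp_pos|apply Hfle]|].
    rewrite Rmult_assoc, <- exp_plus. apply Rmult_le_compat_l; auto.
    replace (- c * INR (S k) + lam * INR (S k)) with (- lam * INR (S k))
      by (unfold lam; field).
    rewrite Hrk. simpl. assert (0 <= r ^ k) by (apply pow_le; lra). nra. }
  assert (Hmono : forall m n, (m <= n)%nat -> rsum b m <= rsum b n) by (intros; now apply rsum_mono).
  assert (Hbd : forall m n, rsum b (m + n) <= rsum b m + C * r ^ m / (1 - r)).
  { intros m n. rewrite rsum_add. apply Rplus_le_compat_l.
    apply Rle_trans with (rsum (fun k => (C * r ^ m) * r ^ k) n).
    - apply rsum_le. intros k _. rewrite Rmult_assoc, <- pow_add. apply Hb.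
    - rewrite rsum_scal. apply Rmult_le_compat_l; [|apply rsum_geometric; lra].
      apply Rmult_le_pos; auto. apply pow_le. lra. }
  destruct (growing_cv (rsum b)) as [Phi HPhi].
  { intros n. apply Hmono. lia. }
  { exists (C / (1 - r)). intros x [n ->]. assert (H := Hbd 0%nat n). simpl in H.
    rewrite Rmult_1_r, Rplus_0_l in H. exact H. }
  assert (HPle : forall n, rsum b n <= Phi).
  { apply growing_ineq; auto. intros n. apply Hmono. lia. }
  assert (HPtail : forall m, Phi <= rsum b m + C * r ^ m / (1 - r)).
  { intros m. apply Rnot_lt_le. intros H.
    destruct (HPhi (Phi - (rsum b m + C * r ^ m / (1 - r)))) as [N HN]; [lra|].
    specialize (HN (m + N)%nat ltac:(lia)). apply Rabs_def2 in HN. specialize (Hbd m N). lra. }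
  (* The tail bound forces the [f k] to sum to 1, and tilting multiplies every term by at least
     [exp lam > 1]. Hence the inverse [q] of [Phi] is below 1. *)
  assert (HP1 : 1 < Phi).
  { assert (Hexp : 1 < exp lam) by (rewrite <- exp_0; apply exp_increasing; lra).
    assert (Hge : forall n, exp lam * rsum f n <= rsum b n).
    { intros n. rewrite <- rsum_scal. apply rsum_le. intros k _. unfold b. rewrite Rmult_comm.
      apply Rmult_le_compat_l; auto. rewrite S_INR. assert (H := pos_INR k).
      destruct (Req_dec (INR k) 0) as [->|Hk]; [right; f_equal; ring|].
      left. apply exp_increasing. nra. }
    destruct (pow_lt_1_zero r) with (y := (1 - / exp lam) / (C + 1)) as [N HN].
    { rewrite Rabs_right; lra. }
    { apply Rdiv_lt_0_compat; [|lra]. assert (/ exp lam < 1); [|lra].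
      rewrite <- Rinv_1. apply Rinv_lt_contravar; lra. }
    specialize (HN N (Nat.le_refl _)). rewrite Rabs_right in HN by (apply Rle_ge, pow_le; lra).
    assert (Hlt : 1 - rsum f N < 1 - / exp lam).
    { apply Rle_lt_trans with (C * r ^ N).
      - eapply Rle_trans; [apply Htail|]. apply Rmult_le_compat_l; auto. rewrite <- Hrk.
        rewrite S_INR. assert (H := pos_INR N). left. apply exp_increasing. unfold lam. nra.
      - apply (Rmult_lt_compat_r (C + 1)) in HN; [|lra]. unfold Rdiv in HN.
        rewrite Rmult_assoc, Rinv_l in HN by lra. assert (0 <= r ^ N) by (apply pow_le; lra). lra. }
    eapply Rlt_le_trans; [|apply (HPle N)]. eapply Rlt_le_trans; [|apply Hge].
    apply Rmult_lt_reg_l with (/ exp lam); [apply Rinv_0_lt_compat; lra|].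
    rewrite <- Rmult_assoc, Rinv_l, Rmult_1_l, Rmult_1_r by lra. lra. }
  exists (/ Phi), lam. split; [split; [apply Rinv_0_lt_compat; lra|]|].
  { rewrite <- Rinv_1. apply Rinv_lt_contravar; lra. }
  split; auto. cbv zeta.
  assert (Hsum : forall n, rsum (fun k => / Phi * f k * exp (lam * INR (S k))) n = / Phi * rsum b n).
  { intros n. rewrite <- rsum_scal. apply rsum_ext. intros k _. unfold b. ring. }
  split.
  - intros n. rewrite Hsum. apply (Rmult_le_reg_l Phi); [lra|].
    rewrite <- Rmult_assoc, Rinv_r, Rmult_1_l, Rmult_1_r by lra. auto.
  - exists (/ Phi * (C / (1 - r))), r. split; [lra|]. intros k. rewrite Hsum.
    specialize (HPtail k). apply (Rmult_le_reg_l Phi); [lra|].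
    rewrite Rmult_minus_distr_l, <- !Rmult_assoc, Rinv_r, !Rmult_1_l, Rmult_1_r by lra.
    unfold Rdiv in HPtail. lra.
Qed.

(** * Markov chains and their path probabilities *)

(** The right-hand side is free of [n], so stationarity is included. *)
Definition path_law {O St : Type} (P : (O -> Prop) -> R) (X : Z -> O -> St)
  (pi : St -> R) (K : St -> St -> R) : Prop :=
  forall (n : Z) (L : nat) (x : nat -> St),
    P (fun w => forall i, (i <= L)%nat -> X (n + Z.of_nat i)%Z w = x i) =
    pi (x 0%nat) * rprod (fun i => K (x i) (x (S i))) L.

Definition finite_event {St : Type} (L : nat) (E : (nat -> St) -> Prop) : Prop :=
  forall x x', (forall i, (i <= L)%nat -> x i = x' i) -> E x -> E x'.

Section chain_law.
Context {O : Type} {Sig : (O -> Prop) -> Prop} {P : (O -> Prop) -> R} {St : Type} {M : Z -> O -> St}.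
Context (HP : is_prob Sig P) (HM : forall n, measurable Sig (@discrete St) (M n)).
Context (Hstat : stationary P M) (Hmarkov : markov P M).

Let Hm : is_measure Sig P := prob_measure Sig P HP.
Let HS : is_sigma Sig := proj1 HP.

Lemma chain_state_measurable n x : Sig (fun w => M n w = x).
Proof. exact (HM n (fun z => z = x) I). Qed.

Lemma stationary_shift B n : prod_sigma (@discrete St) B ->
  P (fun w => B (fun k => M (n + k)%Z w)) = P (fun w => B (fun k => M k w)).
Proof.
  revert B. assert (Hsh : forall B s, prod_sigma (@discrete St) B ->
    prod_sigma (@discrete St) (fun z => B (fun k => z (s + k)%Z))).
  { intros B s. apply (generated_preimage (fun (z : Z -> St) k => z (s + k)%Z)); [apply is_sigma_generated|].
    intros F (n' & C & HC & HF). apply generated_base. exists (s + n')%Z, C. split; auto. }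
  assert (Hstep : forall B s, prod_sigma (@discrete St) B ->
    P (fun w => B (fun k => M (s + 1 + k)%Z w)) = P (fun w => B (fun k => M (s + k)%Z w))).
  { intros B s HB. rewrite (Hstat _ (Hsh B s HB)). f_equal. apply ev_ext. intros w.
    replace (fun k => M (s + k + 1)%Z w) with (fun k => M (s + 1 + k)%Z w); [tauto|].
    apply functional_extensionality. intros k. f_equal. lia. }
  intros B HB. induction n as [|n IH|n IH] using Z.peano_ind.
  - f_equal.
  - rewrite <- IH. unfold Z.succ. now apply Hstep.
  - rewrite <- IH, <- Hstep by auto. now replace (Z.pred n + 1)%Z with n by lia.
Qed.

Definition marginal (x : St) : R := P (fun w => M 0%Z w = x).
Definition kernel (x y : St) : R := P (fun w => M 0%Z w = x /\ M 1%Z w = y) / marginal x.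

Lemma prod_state n (x : St) : prod_sigma (@discrete St) (fun z => z n = x).
Proof. apply generated_base. exists n, (fun x' => x' = x). repeat split; auto. Qed.

Lemma marginal_shift n x : P (fun w => M n w = x) = marginal x.
Proof.
  unfold marginal. rewrite <- (stationary_shift (fun z => z 0%Z = x) n) by apply prod_state.
  f_equal. apply ev_ext. intros w. now rewrite Z.add_0_r.
Qed.

Lemma step_shift n x y : P (fun w => M n w = x /\ M (n + 1)%Z w = y) = P (fun w => M 0%Z w = x /\ M 1%Z w = y).
Proof.
  rewrite <- (stationary_shift (fun z => z 0%Z = x /\ z 1%Z = y) n).
  - f_equal. apply ev_ext. intros w. now rewrite Z.add_0_r.
  - apply (sig_and (is_sigma_generated _)); apply prod_state.
Qed.

Lemma chain_path_law : path_law P M marginal kernel.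
Proof.
  intros n L x. induction L as [|L IH].
  - simpl. rewrite Rmult_1_r, <- (marginal_shift n). f_equal. apply ev_ext. intros w. split.
    + intros H. rewrite <- (H 0%nat) by auto. f_equal. lia.
    + intros H i Hi. replace i with 0%nat by lia. now rewrite Z.add_0_r.
  - simpl rprod. rewrite <- Rmult_assoc, <- IH.
    assert (SE : forall n x, Sig (fun w => M n w = x)) by apply chain_state_measurable.
    assert (SW : forall L, Sig (fun w => forall i, (i <= L)%nat -> M (n + Z.of_nat i)%Z w = x i)) by (intros; meas HS).
    assert (SB : Sig (fun w => M 0%Z w = x L /\ M 1%Z w = x (S L))) by meas HS.
    set (s := x L) in *. set (t := x (S L)) in *.
    set (m := (n + Z.of_nat L)%Z).
    (* The Markov property, stated without division, says nothing about a state of probability 0;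
       then both sides vanish. *)
    destruct (Req_dec (marginal s) 0) as [H0|H0].
    + assert (E1 : P (fun w => forall i, (i <= S L)%nat -> M (n + Z.of_nat i)%Z w = x i) = 0).
      { apply (meas_null_sub Hm _ (fun w => M m w = s)); auto.
        - intros w Hw. apply Hw. lia.
        - rewrite <- H0. apply marginal_shift. }
      assert (E2 : P (fun w => M 0%Z w = s /\ M 1%Z w = t) = 0).
      { apply (meas_null_sub Hm _ (fun w => M 0%Z w = s)); auto. tauto. }
      unfold kernel. rewrite E1, E2. unfold Rdiv. ring.
    (* [markov] lists the past backwards from time [m - 1], hence the reversed path. *)
    + assert (H := Hmarkov m L (fun i => x (L - 1 - i)%nat) s t). cbv zeta in H.
      rewrite (marginal_shift m), (step_shift m) in H.
      assert (Hpast : forall w, (forall i, (i < L)%nat -> M (m - 1 - Z.of_nat i)%Z w = x (L - 1 - i)%nat) <->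
        (forall i, (i < L)%nat -> M (n + Z.of_nat i)%Z w = x i)).
      { intros w. split; intros Hw i Hi; specialize (Hw (L - 1 - i)%nat ltac:(lia)).
        - replace (L - 1 - (L - 1 - i))%nat with i in Hw by lia. rewrite <- Hw. f_equal. unfold m. lia.
        - rewrite <- Hw. f_equal. unfold m. lia. }
      replace (fun w => (forall i, (i < L)%nat -> M (m - 1 - Z.of_nat i)%Z w = x (L - 1 - i)%nat) /\
        M m w = s /\ M (m + 1)%Z w = t)
        with (fun w => forall i, (i <= S L)%nat -> M (n + Z.of_nat i)%Z w = x i) in H.
      2:{ apply ev_ext. intros w. rewrite Hpast. split.
          - intros Hw. split; [intros; apply Hw; lia|]. split; [apply Hw; lia|].
            unfold t. rewrite <- Hw by lia. f_equal. unfold m. lia.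
          - intros (H1 & H2 & H3) i Hi. destruct (Nat.eq_dec i L) as [->|]; auto.
            destruct (Nat.eq_dec i (S L)) as [->|]; [|apply H1; lia].
            unfold t in H3. rewrite <- H3. f_equal. unfold m. lia. }
      replace (fun w => (forall i, (i < L)%nat -> M (m - 1 - Z.of_nat i)%Z w = x (L - 1 - i)%nat) /\ M m w = s)
        with (fun w => forall i, (i <= L)%nat -> M (n + Z.of_nat i)%Z w = x i) in H.
      2:{ apply ev_ext. intros w. rewrite Hpast. split.
          - intros Hw. split; [intros; apply Hw; lia|]. apply Hw; lia.
          - intros (H1 & H2) i Hi. destruct (Nat.eq_dec i L) as [->|]; auto. apply H1; lia. }
      unfold kernel. apply (Rmult_eq_reg_r (marginal s)); auto. rewrite H. field. auto.
Qed.
End chain_law.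

(** * Events that depend on finitely many coordinates *)

Section finite_events.
Context {St : Type} (HcS : countable_type St) (o : St).

Let HcL : countable_type (list St) := countable_list St HcS.

Definition on_list {O : Type} (X : nat -> O -> St) (L : nat) (E : (nat -> St) -> Prop) (l : list St) (w : O) : Prop :=
  length l = S L /\ (forall i, (i <= L)%nat -> X i w = nth i l o) /\ E (fun i => nth i l o).

Lemma on_list_iff {O : Type} (X : nat -> O -> St) L E w : finite_event L E ->
  E (fun i => X i w) <-> exists l, on_list X L E l w.
Proof.
  intros HE. split.
  - intros Hw. destruct (path_list o (fun i => X i w) (S L)) as (l & H1 & H2).
    exists l. split; auto. split.
    + intros i Hi. rewrite H2; auto. lia.
    + apply (HE (fun i => X i w)); auto. intros i Hi. rewrite H2; auto. lia.
  - intros (l & Hl & H1 & H2). apply (HE _ (fun i => X i w)) in H2; auto.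
    intros i Hi. now rewrite H1.
Qed.

Lemma on_list_disjoint {O : Type} (X : nat -> O -> St) L E l l' w :
  l <> l' -> on_list X L E l w -> on_list X L E l' w -> False.
Proof.
  intros Hl (H1 & H2 & _) (H1' & H2' & _). apply Hl, (nth_list_ext o); [congruence|].
  intros i Hi. rewrite <- H2, <- H2' by lia. reflexivity.
Qed.

Lemma on_list_measurable {O : Type} {Sig : (O -> Prop) -> Prop} (HS : is_sigma Sig) (X : nat -> O -> St) L E l :
  (forall i x, Sig (fun w => X i w = x)) -> Sig (on_list X L E l).
Proof. intros HX. unfold on_list. meas HS. Qed.

Lemma finite_event_measurable {O : Type} {Sig : (O -> Prop) -> Prop} (HS : is_sigma Sig) (X : nat -> O -> St) L E :
  (forall i x, Sig (fun w => X i w = x)) -> finite_event L E -> Sig (fun w => E (fun i => X i w)).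
Proof.
  intros HX HE. apply (sig_iff (fun w => exists l, on_list X L E l w)).
  - intros w. symmetry. now apply on_list_iff.
  - apply (sig_ex HS); auto. intros l. now apply on_list_measurable.
Qed.

(** Reduces a comparison of two measures to single paths satisfying [E]. The measures are arbitrary
    so that restrictions and multiples of a law can be compared too. *)
Lemma finite_event_agree {O1 O2 : Type} {Sig1 : (O1 -> Prop) -> Prop} {Sig2 : (O2 -> Prop) -> Prop} {m1 m2}
  (X1 : nat -> O1 -> St) (X2 : nat -> O2 -> St) L E :
  is_measure Sig1 m1 -> is_measure Sig2 m2 ->
  (forall i x, Sig1 (fun w => X1 i w = x)) -> (forall i x, Sig2 (fun w => X2 i w = x)) ->
  finite_event L E ->
  (forall x, E x -> m1 (fun w => forall i, (i <= L)%nat -> X1 i w = x i) =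
                    m2 (fun w => forall i, (i <= L)%nat -> X2 i w = x i)) ->
  m1 (fun w => E (fun i => X1 i w)) = m2 (fun w => E (fun i => X2 i w)).
Proof.
  intros H1 H2 HX1 HX2 HE H.
  rewrite (ev_ext (fun w => E (fun i => X1 i w)) (fun w => exists l, on_list X1 L E l w))
    by (intros; now apply on_list_iff).
  rewrite (ev_ext (fun w => E (fun i => X2 i w)) (fun w => exists l, on_list X2 L E l w))
    by (intros; now apply on_list_iff).
  apply (meas_partition (on_list X1 L E) (on_list X2 L E) H1 H2 HcL).
  - intros l. apply (on_list_measurable (proj1 H1)); auto.
  - intros l l' w. apply on_list_disjoint.
  - intros l. apply (on_list_measurable (proj1 H2)); auto.
  - intros l l' w. apply on_list_disjoint.
  - intros l. destruct (classic (length l = S L /\ E (fun i => nth i l o))) as [[Hl HEl]|Hn].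
    + replace (on_list X1 L E l) with (fun w => forall i, (i <= L)%nat -> X1 i w = nth i l o)
        by (apply ev_ext; unfold on_list; tauto).
      replace (on_list X2 L E l) with (fun w => forall i, (i <= L)%nat -> X2 i w = nth i l o)
        by (apply ev_ext; unfold on_list; tauto).
      apply (H (fun i => nth i l o)); auto.
    + replace (on_list X1 L E l) with (fun _ : O1 => False) by (apply ev_ext; unfold on_list; tauto).
      replace (on_list X2 L E l) with (fun _ : O2 => False) by (apply ev_ext; unfold on_list; tauto).
      now rewrite (meas_empty H1), (meas_empty H2).
Qed.
End finite_events.

(** * The Markov property for finite events *)

Section markov_process.
Context {O : Type} {Sig : (O -> Prop) -> Prop} {P : (O -> Prop) -> R} {St : Type} {X : Z -> O -> St}.
Context (HP : is_prob Sig P) (HX : forall n x, Sig (fun w => X n w = x)) (HcS : countable_type St) (o : St).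
Context (pi : St -> R) (K : St -> St -> R) (Hlaw : path_law P X pi K).

Let Hm : is_measure Sig P := prob_measure Sig P HP.
Let HS : is_sigma Sig := proj1 HP.

Lemma law_state n x : P (fun w => X n w = x) = pi x.
Proof.
  assert (H0 := Hlaw n 0%nat (fun _ => x)). simpl rprod in H0. rewrite Rmult_1_r in H0. rewrite <- H0.
  f_equal. apply ev_ext. intros w. split.
  - intros H i Hi. replace i with 0%nat by lia. now rewrite Z.add_0_r.
  - intros H. rewrite <- (H 0%nat) by auto. f_equal. lia.
Qed.

Lemma law_ge0 x : 0 <= pi x.
Proof. rewrite <- (law_state 0). now apply (meas_ge0 Hm). Qed.

Lemma law_shift n L E : finite_event L E ->
  P (fun w => E (fun i => X (n + Z.of_nat i)%Z w)) = P (fun w => E (fun i => X (Z.of_nat i) w)).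
Proof.
  intros HE.
  apply (finite_event_agree HcS o (fun i => X (n + Z.of_nat i)%Z) (fun i => X (Z.of_nat i)) L E Hm Hm); auto.
  intros x _. rewrite Hlaw, <- (Hlaw 0%Z). reflexivity.
Qed.

Lemma law_split_paths n j l x x' : x j = x' 0%nat ->
  P (fun w => (forall i, (i <= j)%nat -> X (n + Z.of_nat i)%Z w = x i) /\
              (forall i, (i <= l)%nat -> X (n + Z.of_nat j + Z.of_nat i)%Z w = x' i)) * pi (x' 0%nat) =
  P (fun w => forall i, (i <= j)%nat -> X (n + Z.of_nat i)%Z w = x i) *
  P (fun w => forall i, (i <= l)%nat -> X (Z.of_nat i) w = x' i).
Proof.
  intros Hz.
  pose (x'' := fun i => if le_lt_dec i j then x i else x' (i - j)%nat).
  assert (Hx1 : forall i, (i <= j)%nat -> x'' i = x i).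
  { intros i Hi. unfold x''. destruct (le_lt_dec i j); auto. lia. }
  assert (Hx2 : forall i, x'' (j + i)%nat = x' i).
  { intros i. unfold x''. destruct (le_lt_dec (j + i) j).
    - replace i with 0%nat by lia. now rewrite Nat.add_0_r.
    - f_equal. lia. }
  transitivity (P (fun w => forall i, (i <= j + l)%nat -> X (n + Z.of_nat i)%Z w = x'' i) * pi (x' 0%nat)).
  { do 2 f_equal. apply ev_ext. intros w. split.
    - intros [H1 H2] i Hi. destruct (le_lt_dec i j) as [Hij|Hij].
      + rewrite Hx1 by auto. auto.
      + replace i with (j + (i - j))%nat by lia. rewrite Hx2, <- H2 by lia. f_equal. lia.
    - intros H. split; intros i Hi.
      + rewrite H, Hx1; auto. lia.
      + rewrite <- Hx2, <- H by lia. f_equal. lia. }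
  change (fun w => forall i, (i <= l)%nat -> X (Z.of_nat i) w = x' i)
    with (fun w => forall i, (i <= l)%nat -> X (0 + Z.of_nat i)%Z w = x' i).
  rewrite !Hlaw, rprod_split, Hx1 by lia.
  rewrite (rprod_ext (fun i => K (x'' i) (x'' (S i))) (fun i => K (x i) (x (S i))) j).
  - rewrite (rprod_ext (fun i => K (x'' (j + i)%nat) (x'' (S (j + i)))) (fun i => K (x' i) (x' (S i))) l).
    + ring.
    + intros k _. now rewrite <- Nat.add_succ_r, !Hx2.
  - intros k Hk. rewrite !Hx1; auto; lia.
Qed.

(** The Markov property at time [n + j], cleared of the division by [pi z]. It passes from paths to
    events twice: first for the future with a fixed past path, then for the past. *)
Lemma law_split n j l z E F : finite_event j E -> finite_event l F ->
  P (fun w => (E (fun i => X (n + Z.of_nat i)%Z w) /\ X (n + Z.of_nat j)%Z w = z) /\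
              F (fun i => X (n + Z.of_nat j + Z.of_nat i)%Z w)) * pi z =
  P (fun w => E (fun i => X (n + Z.of_nat i)%Z w) /\ X (n + Z.of_nat j)%Z w = z) *
  P (fun w => X 0%Z w = z /\ F (fun i => X (Z.of_nat i) w)).
Proof.
  intros HE HF.
  assert (SF : forall m, Sig (fun w => F (fun i => X (m + Z.of_nat i)%Z w))).
  { intros m. apply (finite_event_measurable HcS o HS (fun i => X (m + Z.of_nat i)%Z) l); auto. }
  assert (SF0 : Sig (fun w => F (fun i => X (Z.of_nat i) w))) by exact (SF 0%Z).
  assert (HF' : forall x, x j = z ->
    P (fun w => F (fun i => X (n + Z.of_nat j + Z.of_nat i)%Z w) /\
                (forall i, (i <= j)%nat -> X (n + Z.of_nat i)%Z w = x i)) * pi z =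
    P (fun w => forall i, (i <= j)%nat -> X (n + Z.of_nat i)%Z w = x i) *
    P (fun w => F (fun i => X (Z.of_nat i) w) /\ X 0%Z w = z)).
  { intros x Hz. set (W := fun w => forall i, (i <= j)%nat -> X (n + Z.of_nat i)%Z w = x i).
    assert (SW : Sig W) by (unfold W; meas HS).
    rewrite Rmult_comm.
    apply (finite_event_agree HcS o (Sig1 := Sig) (Sig2 := Sig) (m1 := fun G => pi z * P (fun w => G w /\ W w))
      (m2 := fun G => P W * P (fun w => G w /\ X 0%Z w = z))
      (fun i => X (n + Z.of_nat j + Z.of_nat i)%Z) (fun i => X (Z.of_nat i)) l F); auto.
    - apply (meas_scale (meas_restrict Hm W SW)). apply law_ge0.
    - apply (meas_scale (meas_restrict Hm (fun w => X 0%Z w = z) (HX _ _))). now apply (meas_ge0 Hm).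
    - intros x' _. cbv beta. destruct (classic (x' 0%nat = z)) as [Hz'|Hz'].
      + assert (H := law_split_paths n j l x x' ltac:(congruence)). rewrite Hz' in H.
        etransitivity; [|etransitivity; [exact H|]].
        * rewrite Rmult_comm. do 2 f_equal. apply ev_ext. intros; unfold W; tauto.
        * do 2 f_equal. apply ev_ext. intros w. split; [|tauto].
          intros Hw. split; auto. rewrite <- Hz'. apply (Hw 0%nat). lia.
      + replace (fun w => (forall i, (i <= l)%nat -> X (n + Z.of_nat j + Z.of_nat i)%Z w = x' i) /\ W w)
          with (fun _ : O => False).
        * replace (fun w => (forall i, (i <= l)%nat -> X (Z.of_nat i) w = x' i) /\ X 0%Z w = z)
            with (fun _ : O => False); [rewrite (meas_empty Hm); ring|].
          apply ev_ext. intros w. split; [tauto|]. intros [H1 H2]. apply Hz'.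
          rewrite <- H2. symmetry. apply (H1 0%nat). lia.
        * apply ev_ext. intros w. split; [tauto|]. intros [H1 H2]. apply Hz'.
          rewrite <- Hz, <- (H2 j), <- (H1 0%nat) by lia. f_equal. lia. }
  rewrite Rmult_comm, (Rmult_comm _ (P (fun w => X 0%Z w = z /\ _))).
  assert (SA : Sig (fun w => X (n + Z.of_nat j)%Z w = z /\ F (fun i => X (n + Z.of_nat j + Z.of_nat i)%Z w)))
    by (apply (sig_and HS); auto).
  transitivity (pi z * P (fun w => E (fun i => X (n + Z.of_nat i)%Z w) /\
    (X (n + Z.of_nat j)%Z w = z /\ F (fun i => X (n + Z.of_nat j + Z.of_nat i)%Z w)))).
  { do 2 f_equal. apply ev_ext. intros; tauto. }
  apply (finite_event_agree HcS o (Sig1 := Sig) (Sig2 := Sig) (m1 := fun G => pi z * P (fun w => G w /\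
      (X (n + Z.of_nat j)%Z w = z /\ F (fun i => X (n + Z.of_nat j + Z.of_nat i)%Z w))))
    (m2 := fun G => P (fun w => X 0%Z w = z /\ F (fun i => X (Z.of_nat i) w)) *
       P (fun w => G w /\ X (n + Z.of_nat j)%Z w = z))
    (fun i => X (n + Z.of_nat i)%Z) (fun i => X (n + Z.of_nat i)%Z) j E); auto.
  - apply (meas_scale (meas_restrict Hm _ SA)). apply law_ge0.
  - apply (meas_scale (meas_restrict Hm _ (HX (n + Z.of_nat j)%Z z))).
    apply (meas_ge0 Hm). apply (sig_and HS); auto.
  - intros x _. cbv beta. destruct (classic (x j = z)) as [Hz|Hz].
    + rewrite Rmult_comm.
      transitivity (P (fun w => F (fun i => X (n + Z.of_nat j + Z.of_nat i)%Z w) /\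
                (forall i, (i <= j)%nat -> X (n + Z.of_nat i)%Z w = x i)) * pi z).
      { do 2 f_equal. apply ev_ext. intros w. split; [tauto|]. intros [H1 H2].
        split; auto. split; auto. rewrite <- Hz. auto. }
      rewrite HF' by auto. rewrite Rmult_comm. f_equal.
      * f_equal. apply ev_ext. intros; tauto.
      * f_equal. apply ev_ext. intros w. split; [|tauto]. intros H; split; auto. rewrite <- Hz. auto.
    + replace (fun w => (forall i, (i <= j)%nat -> X (n + Z.of_nat i)%Z w = x i) /\ _)
        with (fun _ : O => False).
      * replace (fun w => (forall i, (i <= j)%nat -> X (n + Z.of_nat i)%Z w = x i) /\ X (n + Z.of_nat j)%Z w = z)
          with (fun _ : O => False); [rewrite (meas_empty Hm); ring|].
        apply ev_ext. intros w. split; [tauto|]. intros [H1 H2]. apply Hz. rewrite <- H2. symmetry. auto.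
      * apply ev_ext. intros w. split; [tauto|]. intros [H1 [H2 _]]. apply Hz. rewrite <- H2. symmetry. auto.
Qed.

(** * Recurrence *)

Context (Hirr : forall z, 0 < pi z -> exists n : nat, 0 < P (fun w => X 0%Z w = o /\ X (Z.of_nat n) w = z)).
Context (Hret : forall e, 0 < e -> exists t : nat,
  P (fun w => X 0%Z w = o /\ forall i : nat, (1 <= i < t)%nat -> X (Z.of_nat i) w <> o) < e).

(** A path from [o] to [z] may be cut at its last visit to [o]; by stationarity the remaining piece
    can be moved to time 0. *)
Lemma taboo_path z : z <> o -> 0 < pi z -> exists l : nat,
  0 < P (fun w => (X 0%Z w = o /\ forall i : nat, (1 <= i < l)%nat -> X (Z.of_nat i) w <> o) /\ X (Z.of_nat l) w = z).
Proof.
  intros Hz Hpz. destruct (Hirr z Hpz) as [n Hn]. apply NNPP. intros Hno.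
  assert (SE := HX).
  pose (E := fun l w => (X 0%Z w = o /\ forall i : nat, (1 <= i < l)%nat -> X (Z.of_nat i) w <> o) /\ X (Z.of_nat l) w = z).
  assert (HE0 : forall l, P (E l) = 0).
  { intros l. apply Rle_antisym; [|apply (meas_ge0 Hm); unfold E; meas HS].
    apply Rnot_lt_le. intros H. apply Hno. now exists l. }
  (* Decompose at the last visit of [o] before [n]. *)
  pose (F := fun (j : nat) w => (X (Z.of_nat j) w = o /\
    forall i : nat, (1 <= i < n - j)%nat -> X (Z.of_nat j + Z.of_nat i)%Z w <> o) /\
    X (Z.of_nat j + Z.of_nat (n - j))%Z w = z).
  assert (HF0 : forall j, P (F j) = 0).
  { intros j. rewrite <- (HE0 (n - j)%nat). unfold E, F.
    assert (HL : finite_event (n - j) (fun x : nat -> St =>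
      (x 0%nat = o /\ forall i : nat, (1 <= i < n - j)%nat -> x i <> o) /\ x (n - j)%nat = z)).
    { intros x x' Hx [[H1 H2] H3]. rewrite <- !Hx by lia. split; [split|]; auto.
      intros i Hi. rewrite <- Hx by lia. auto. }
    assert (H := law_shift (Z.of_nat j) _ _ HL). cbv beta in H. etransitivity; [|exact H].
    f_equal. apply ev_ext. intros w. now rewrite Z.add_0_r. }
  assert (HU : P (fun w => exists j, F j w) = 0).
  { apply (meas_null_countable F Hm countable_nat); auto. intros j. unfold F. meas HS. }
  enough (P (fun w => X 0%Z w = o /\ X (Z.of_nat n) w = z) = 0) by lra.
  apply (meas_null_sub Hm _ (fun w => exists j, F j w)); auto.
  - meas HS.
  - unfold F. meas HS.
  - intros w [H1 H2].
    assert (Hlast : forall k, (k <= n)%nat -> (forall i, (n - k < i <= n)%nat -> X (Z.of_nat i) w <> o) \/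
      exists j, F j w).
    { induction k; intros Hk; [left; intros; lia|].
      destruct IHk as [IH|IH]; [lia| |auto].
      destruct (classic (X (Z.of_nat (n - k)) w = o)) as [Ek|Ek].
      - right. exists (n - k)%nat. split; [split|]; auto.
        + intros i Hi. replace (Z.of_nat (n - k) + Z.of_nat i)%Z with (Z.of_nat (n - k + i)) by lia.
          apply IH. lia.
        + now replace (Z.of_nat (n - k) + Z.of_nat (n - (n - k)))%Z with (Z.of_nat n) by lia.
      - left. intros i Hi. destruct (Nat.eq_dec i (n - k)) as [->|]; auto. apply IH. lia. }
    destruct (Hlast n (Nat.le_refl _)) as [H|H]; auto.
    exists 0%nat. split; [split|]; auto.
    + intros i Hi. simpl. apply H. lia.
    + simpl. now rewrite Nat.sub_0_r.
Qed.

(** If some [z] had probability [v > 0] of being the initial state with [o] never hit, then going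
    from [o] to [z] along a taboo path and avoiding [o] afterwards would bound the tail of the
    return time from below, against [Hret]. *)
Lemma hitting e : 0 < e -> exists b : nat, P (fun w => forall i, (i < b)%nat -> X (Z.of_nat i) w <> o) < e.
Proof.
  intros He. assert (SE := HX).
  pose (A := fun (b : nat) w => forall i, (i < b)%nat -> X (Z.of_nat i) w <> o).
  assert (SA : forall b, Sig (A b)) by (intros; unfold A; meas HS).
  assert (Hcv := meas_decreasing Hm A SA ltac:(unfold A; auto)).
  assert (SAll : Sig (fun w => forall b, A b w)) by meas HS.
  assert (H0 : P (fun w => forall b, A b w) = 0).
  2:{ rewrite H0 in Hcv. destruct (Hcv e He) as [N HN]. exists N.
      specialize (HN N (Nat.le_refl _)). apply Rabs_def2 in HN. unfold A in HN. lra. }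
  replace (fun w => forall b, A b w) with (fun w => exists z, X 0%Z w = z /\ forall b, A b w)
    by (apply ev_ext; intros w; split; [intros (z & _ & H); auto|eauto]).
  apply (meas_null_countable _ Hm HcS); [intros; meas HS|].
  intros z. apply Rle_antisym; [|apply (meas_ge0 Hm); meas HS].
  apply Rnot_lt_le. intros Hp. set (v := P (fun w => X 0%Z w = z /\ forall b, A b w)) in *.
  assert (Hz : z <> o).
  { intros ->. enough (v = 0) by lra. unfold v. rewrite <- (meas_empty Hm). f_equal. apply ev_ext.
    intros w. split; [|tauto]. intros [H1 H2]. apply (H2 1%nat 0%nat); auto. }
  assert (Hpz : 0 < pi z).
  { eapply Rlt_le_trans; [exact Hp|]. rewrite <- (law_state 0%Z z).
    apply (meas_mono Hm); [meas HS|auto|tauto]. }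
  destruct (taboo_path z Hz Hpz) as [l Hl].
  set (al := P (fun w => (X 0%Z w = o /\ forall i : nat, (1 <= i < l)%nat -> X (Z.of_nat i) w <> o) /\ X (Z.of_nat l) w = z)) in *.
  (* By the Markov property at [z], the return tail is at least [al * v / pi z] for every [t]. *)
  destruct (Hret (al * v / pi z)) as [t Ht].
  { apply Rdiv_lt_0_compat; auto. nra. }
  assert (HE : finite_event l (fun x : nat -> St => x 0%nat = o /\ forall i : nat, (1 <= i < l)%nat -> x i <> o)).
  { intros x x' Hx [H1 H2]. split; [rewrite <- Hx by lia; auto|]. intros i Hi. rewrite <- Hx by lia. auto. }
  assert (HF : finite_event t (fun x : nat -> St => forall i, (i < t)%nat -> x i <> o)).
  { intros x x' Hx H i Hi. rewrite <- Hx by lia. auto. }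
  assert (H := law_split 0%Z l t z _ _ HE HF). cbv beta in H. fold al in H.
  assert (Hv : v <= P (fun w => X 0%Z w = z /\ forall i, (i < t)%nat -> X (Z.of_nat i) w <> o)).
  { apply (meas_mono Hm); [meas HS|meas HS|]. intros w [H1 H2]. split; auto. apply (H2 t). }
  assert (Hle : P (fun w => ((X 0%Z w = o /\ forall i : nat, (1 <= i < l)%nat -> X (Z.of_nat i) w <> o) /\
      X (Z.of_nat l) w = z) /\ forall i, (i < t)%nat -> X (0 + Z.of_nat l + Z.of_nat i)%Z w <> o) <=
    P (fun w => X 0%Z w = o /\ forall i : nat, (1 <= i < t)%nat -> X (Z.of_nat i) w <> o)).
  { apply (meas_mono Hm); [meas HS|meas HS|]. intros w [[[H1 H2] H3] H4]. split; auto.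
    intros i Hi. destruct (le_lt_dec l i) as [Hi'|Hi']; [|apply H2; lia].
    replace (Z.of_nat i) with (0 + Z.of_nat l + Z.of_nat (i - l))%Z by lia. apply H4. lia. }
  assert (H1 : al * v / pi z * pi z = al * v) by (field; lra).
  change (0 + Z.of_nat 0)%Z with 0%Z in H.
  change (fun w => _ /\ X (0 + Z.of_nat l)%Z w = z) with
    (fun w => (X 0%Z w = o /\ forall i : nat, (1 <= i < l)%nat -> X (Z.of_nat i) w <> o) /\ X (Z.of_nat l) w = z) in H.
  fold al in H.
  assert (H2 : al * v <= al * P (fun w => X 0%Z w = z /\ forall i, (i < t)%nat -> X (Z.of_nat i) w <> o))
    by (apply Rmult_le_compat_l; lra).
  rewrite <- H in H2. rewrite <- H1 in H2.
  apply Rmult_le_reg_r in H2; auto.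
  eapply Rlt_irrefl, Rle_lt_trans; [exact H2|]. eapply Rle_lt_trans; [|exact Ht]. exact Hle.
Qed.
End markov_process.

(** * Thinning the returns *)

Lemma rprod_mult f g n : rprod (fun k => f k * g k) n = rprod f n * rprod g n.
Proof. induction n; simpl; [lra|]. rewrite IHn. ring. Qed.

Lemma rprod_head f n : rprod f (S n) = f 0%nat * rprod (fun k => f (S k)) n.
Proof. induction n; simpl in *; [lra|]. rewrite IHn. lra. Qed.

Lemma meas_rsum {O : Type} {Sig : (O -> Prop) -> Prop} {m} (Hm : is_measure Sig m) (G : nat -> O -> Prop) n :
  (forall k, Sig (G k)) -> (forall i j x, i <> j -> G i x -> G j x -> False) ->
  m (fun x => exists k, (k < n)%nat /\ G k x) = rsum (fun k => m (G k)) n.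
Proof.
  intros HG D. assert (HS := proj1 Hm). induction n; simpl.
  - rewrite <- (meas_empty Hm). f_equal. apply ev_ext. intros x. split; [|tauto].
    intros (k & Hk & _). lia.
  - rewrite <- IHn, <- (meas_or Hm); [|meas HS|auto|].
    + f_equal. apply ev_ext. intros x. split.
      * intros (k & Hk & Hx). destruct (Nat.eq_dec k n) as [->|]; auto.
        left. exists k. split; auto. lia.
      * intros [(k & Hk & Hx)|Hx]; [exists k|exists n]; split; auto.
    + intros x (k & Hk & Hx) Hx'. apply (D k n x); auto. lia.
Qed.

Section tail.
Context {O : Type} {Sig : (O -> Prop) -> Prop} {P : (O -> Prop) -> R} {St : Type} {M : Z -> O -> St}.
Context (HP : is_prob Sig P) (HM : forall n x, Sig (fun w => M n w = x)) (s : St).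

Let Hm : is_measure Sig P := prob_measure Sig P HP.
Let HS : is_sigma Sig := proj1 HP.

Lemma tail_measurable t :
  Sig (fun w => M 0%Z w = s /\ forall i : nat, (1 <= i < t)%nat -> M (Z.of_nat i) w <> s).
Proof. meas HS. Qed.

Lemma tail_mono t t' : (t <= t')%nat ->
  tail_prob (P := P) (M := M) s t' <= tail_prob (P := P) (M := M) s t.
Proof.
  intros Ht. apply (meas_mono Hm); try apply tail_measurable.
  intros w [H1 H2]. split; auto. intros i Hi. apply H2. lia.
Qed.

Lemma tail_succ t : (1 <= t)%nat ->
  tail_prob (P := P) (M := M) s t = first_prob (P := P) (M := M) s t + tail_prob (P := P) (M := M) s (S t).
Proof.
  intros Ht. unfold tail_prob at 1.
  rewrite (meas_split Hm _ (fun w => M (Z.of_nat t) w = s)) by (auto using tail_measurable).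
  unfold first_prob, tail_prob. cbv beta. f_equal. f_equal. apply ev_ext. intros w. split.
  - intros [[H0 H1] H2]. split; auto. intros i Hi. destruct (Nat.eq_dec i t); subst; auto. apply H1. lia.
  - intros [H0 H1]. split; [split; auto|]; intros; apply H1; lia.
Qed.

Lemma first_ge0 t : 0 <= first_prob (P := P) (M := M) s t.
Proof. apply (meas_ge0 Hm). apply (sig_and HS); auto using tail_measurable. Qed.

Lemma tail_ge0 t : 0 <= tail_prob (P := P) (M := M) s t.
Proof. apply (meas_ge0 Hm), tail_measurable. Qed.

Lemma tail_start t : (t <= 1)%nat -> tail_prob (P := P) (M := M) s t = P (fun w => M 0%Z w = s).
Proof.
  intros Ht. unfold tail_prob. f_equal. apply ev_ext. intros w. split; [tauto|].
  intros H; split; auto. intros; lia.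
Qed.
End tail.

(** * The chain paired with independent coins *)

Section thinning.
Context {O : Type} {Sig : (O -> Prop) -> Prop} {P : (O -> Prop) -> R} {St : Type} {M : Z -> O -> St}.
Context (HP : is_prob Sig P) (HM : forall n x, Sig (fun w => M n w = x)) (HcS : countable_type St).
Context (s : St) (pi : St -> R) (K : St -> St -> R) (Hlaw : path_law P M pi K) (pi_pos : 0 < pi s).

Context {A : Type} {SigA : (A -> Prop) -> Prop} {Q : ((Z -> A) -> Prop) -> R} {U : A -> R}.
Context (HSA : is_sigma SigA) (HQ : is_prob (prod_sigma SigA) Q).
Context (Q_indep : forall (D : Z -> Prop) n E C, ~ D n -> coord_sigma SigA D E -> SigA C ->
    Q (fun y => E y /\ C (y n)) = Q E * Q (fun y => C (y 0%Z))).
Context (HU : forall x, SigA (fun u => U u < x)).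
Context (U_uniform : forall x, 0 <= x <= 1 -> Q (fun y => U (y 0%Z) < x) = x).

Context (q : R) (Hq : 0 < q < 1).
Context {Sig2 : (O * (Z -> A) -> Prop) -> Prop} {P2 : (O * (Z -> A) -> Prop) -> R}.
Context (HP2 : is_prob Sig2 P2).
Context (rectangle : forall E1 E2, Sig E1 -> prod_sigma SigA E2 ->
      Sig2 (fun x => E1 (fst x) /\ E2 (snd x)) /\
      P2 (fun x => E1 (fst x) /\ E2 (snd x)) = P E1 * Q E2).

Let HSP : is_sigma Sig := proj1 HP.
Let HSQ : is_sigma (prod_sigma SigA) := proj1 HQ.
Let Hm : is_measure Sig2 P2 := prob_measure Sig2 P2 HP2.
Let HS : is_sigma Sig2 := proj1 HP2.

Definition coin (u : A) : bool := if Rlt_dec (U u) (1 - q) then true else false.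
Definition coin_weight (b : bool) : R := if b then 1 - q else q.

Lemma coin_event b : SigA (fun u => coin u = b).
Proof.
  assert (H : SigA (fun u => coin u = true)).
  { apply (sig_iff (fun u => U u < 1 - q)); auto. intros u. unfold coin.
    destruct (Rlt_dec _ _); split; (congruence || tauto). }
  destruct b; auto. apply (sig_iff (fun u => ~ coin u = true)).
  - intros u. destruct (coin u); split; congruence.
  - now apply (sig_not HSA).
Qed.

Lemma coin_prob b : Q (fun y => coin (y 0%Z) = b) = coin_weight b.
Proof.
  assert (H : Q (fun y => coin (y 0%Z) = true) = 1 - q).
  { rewrite <- (U_uniform (1 - q)) by lra. f_equal. apply ev_ext. intros y. unfold coin.
    destruct (Rlt_dec _ _); split; (congruence || tauto). }
  destruct b; auto. simpl.
  assert (Mc : forall b, prod_sigma SigA (fun y => coin (y 0%Z) = b)).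
  { intros b. apply generated_base. exists 0%Z, (fun u => coin u = b). split; [apply coin_event|tauto]. }
  assert (H1 := meas_or (prob_measure _ _ HQ) _ _ (Mc true) (Mc false) ltac:(intros; congruence)).
  rewrite H in H1. cbv beta in H1.
  replace (fun y => coin (y 0%Z) = true \/ coin (y 0%Z) = false) with (fun _ : Z -> A => True) in H1.
  - assert (HT : Q (fun _ => True) = 1) by apply HQ. lra.
  - apply ev_ext. intros y. destruct (coin (y 0%Z)); split; auto.
Qed.

Lemma coin_path_measurable D n L (m : nat -> bool) :
  (forall i, (n <= i < n + Z.of_nat L)%Z -> D i) ->
  coord_sigma SigA D (fun y => forall i, (i < L)%nat -> coin (y (n + Z.of_nat i)%Z) = m i).
Proof.
  intros HD. assert (HS' : is_sigma (coord_sigma SigA D)) by apply is_sigma_generated.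
  apply (sig_all HS'); [cty|]. intros i. apply (sig_guard HS'). intros Hi.
  apply generated_base. exists (n + Z.of_nat i)%Z, (fun u => coin u = m i).
  split; [apply HD; lia|]. split; [apply coin_event|tauto].
Qed.

Lemma coin_path n L (m : nat -> bool) :
  Q (fun y => forall i, (i < L)%nat -> coin (y (n + Z.of_nat i)%Z) = m i) =
  rprod (fun i => coin_weight (m i)) L.
Proof.
  induction L.
  - simpl. replace 1 with (Q (fun _ => True)) by apply HQ. f_equal. apply ev_ext.
    intros; split; auto. intros; lia.
  - simpl. rewrite <- IHL, <- coin_prob.
    rewrite <- (Q_indep (fun i => (i < n + Z.of_nat L)%Z) (n + Z.of_nat L) _ (fun u => coin u = m L)).
    + f_equal. apply ev_ext. intros y. split.
      * intros H. split; [intros i Hi|]; apply H; lia.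
      * intros [H1 H2] i Hi. destruct (Nat.eq_dec i L) as [->|]; auto. apply H1; lia.
    + lia.
    + apply coin_path_measurable. intros; lia.
    + apply coin_event.
Qed.

(** Every site carries a coin, whatever its state: the pair is then again a chain with a product
    kernel, and only the coins at visits to [s] matter. *)
Definition marked (n : Z) (x : O * (Z -> A)) : St * bool := (M n (fst x), coin (snd x n)).
Definition marked_pi (x : St * bool) : R := pi (fst x) * coin_weight (snd x).
Definition marked_K (x y : St * bool) : R := K (fst x) (fst y) * coin_weight (snd y).

Lemma marked_measurable n x : Sig2 (fun w => marked n w = x).
Proof.
  destruct x as [x b].
  apply (sig_iff (fun w : O * (Z -> A) => M n (fst w) = x /\ coin (snd w n) = b)).
  - intros w. unfold marked. split; [intros [-> ->]; auto|]. intros H. injection H. auto.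
  - apply (rectangle (fun w => M n w = x) (fun y => coin (y n) = b)); auto.
    apply generated_base. exists n, (fun u => coin u = b). split; [apply coin_event|tauto].
Qed.

Lemma marked_law : path_law P2 marked marked_pi marked_K.
Proof.
  intros n L x.
  transitivity (P2 (fun w => (forall i, (i <= L)%nat -> M (n + Z.of_nat i)%Z (fst w) = fst (x i)) /\
    (forall i, (i < S L)%nat -> coin (snd w (n + Z.of_nat i)%Z) = snd (x i)))).
  { f_equal. apply ev_ext. intros w. unfold marked. split.
    - intros H. split; intros i Hi; [rewrite <- H by lia|rewrite <- H by lia]; reflexivity.
    - intros [H1 H2] i Hi. rewrite H1, H2 by lia. now destruct (x i). }
  assert (S1 : Sig (fun w => forall i, (i <= L)%nat -> M (n + Z.of_nat i)%Z w = fst (x i))) by meas HSP.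
  assert (S2 : prod_sigma SigA (fun y => forall i, (i < S L)%nat -> coin (y (n + Z.of_nat i)%Z) = snd (x i))).
  { eapply coord_sigma_all, (coin_path_measurable (fun _ => True)). auto. }
  rewrite (proj2 (rectangle _ _ S1 S2)), (Hlaw n L (fun i => fst (x i))).
  rewrite (coin_path n (S L) (fun i => snd (x i))), rprod_head.
  unfold marked_pi, marked_K. rewrite rprod_mult. ring.
Qed.

Let HcS2 : countable_type (St * bool) := countable_prod St bool HcS countable_bool.

Definition mark : St * bool := (s, true).
Definition unmark : St * bool := (s, false).

Lemma unmark_pi : marked_pi unmark = pi s * q.
Proof. reflexivity. Qed.

Let unmark_pos : 0 < marked_pi unmark.
Proof. rewrite unmark_pi. nra. Qed.

Lemma marked_state n x : P2 (fun w => marked n w = x) = marked_pi x.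
Proof. apply (law_state marked_pi marked_K marked_law). Qed.

Lemma rectangle_prob E1 E2 F : Sig E1 -> prod_sigma SigA E2 ->
  (forall w y, F (w, y) <-> E1 w /\ E2 y) -> P2 F = P E1 * Q E2.
Proof.
  intros H1 H2 HF. rewrite <- (proj2 (rectangle E1 E2 H1 H2)). f_equal. apply ev_ext.
  intros [w y]. apply HF.
Qed.

Lemma coin_measurable n b : prod_sigma SigA (fun y => coin (y n) = b).
Proof. apply generated_base. exists n, (fun u => coin u = b). split; [apply coin_event|tauto]. Qed.

(** The probability that the return time to [s] is [k + 1]; the shift is the one of the renewal
    equation. *)
Definition gap_prob (k : nat) : R := first_prob (P := P) (M := M) s (S k) / pi s.

Lemma unmarked_gap k :
  P2 (fun w => (marked 0%Z w = unmark /\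
      forall i : nat, (1 <= i < S k)%nat -> fst (marked (Z.of_nat i) w) <> s) /\
    marked (Z.of_nat (S k)) w = unmark) = marked_pi unmark * (q * gap_prob k).
Proof.
  rewrite (rectangle_prob
    (fun w => (M 0%Z w = s /\ forall i : nat, (1 <= i < S k)%nat -> M (Z.of_nat i) w <> s) /\
      M (Z.of_nat (S k)) w = s)
    (fun y => coin (y 0%Z) = false /\ coin (y (Z.of_nat (S k))) = false)).
  - rewrite (Q_indep (fun i => (i = 0)%Z) (Z.of_nat (S k)) (fun y => coin (y 0%Z) = false)
      (fun u => coin u = false)); [|lia| |apply coin_event].
    + rewrite coin_prob, unmark_pi. unfold gap_prob, first_prob. simpl coin_weight. field. lra.
    + apply generated_base. exists 0%Z, (fun u => coin u = false). split; auto. split; [apply coin_event|tauto].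
  - meas HSP.
  - apply (sig_and HSQ); apply coin_measurable.
  - intros w y. unfold marked, unmark. cbn [fst snd]. split.
    + intros [[H1 H2] H3]. injection H1 as E1 E2. injection H3 as E3 E4.
      exact (conj (conj (conj E1 H2) E3) (conj E2 E4)).
    + intros [[[E1 H2] E3] [E2 E4]]. rewrite E1, E2, E3, E4. auto.
Qed.

Lemma unmarked_tail t :
  P2 (fun w => marked 0%Z w = unmark /\
      forall i : nat, (1 <= i < t)%nat -> fst (marked (Z.of_nat i) w) <> s) =
  q * tail_prob (P := P) (M := M) s t.
Proof.
  rewrite (rectangle_prob
    (fun w => M 0%Z w = s /\ forall i : nat, (1 <= i < t)%nat -> M (Z.of_nat i) w <> s)
    (fun y => coin (y 0%Z) = false)).
  - rewrite coin_prob. unfold tail_prob. simpl coin_weight. ring.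
  - meas HSP.
  - apply coin_measurable.
  - intros w y. unfold marked, unmark. cbn [fst snd]. split.
    + intros [H1 H2]. injection H1 as E1 E2. exact (conj (conj E1 H2) E2).
    + intros [[E1 H2] E2]. rewrite E1, E2. auto.
Qed.

(* Changing the coin at time 0, or at the last time, only changes the weight of that coin. *)
Lemma swap_start L F : finite_event L F ->
  P2 (fun w => F (fun i => marked (1 + Z.of_nat i)%Z w) /\ marked 0%Z w = mark) =
  (1 - q) / q * P2 (fun w => F (fun i => marked (1 + Z.of_nat i)%Z w) /\ marked 0%Z w = unmark).
Proof.
  intros HF.
  apply (finite_event_agree HcS2 mark (Sig1 := Sig2) (Sig2 := Sig2)
    (m1 := fun G => P2 (fun w => G w /\ marked 0%Z w = mark))
    (m2 := fun G => (1 - q) / q * P2 (fun w => G w /\ marked 0%Z w = unmark))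
    (fun i => marked (1 + Z.of_nat i)%Z) (fun i => marked (1 + Z.of_nat i)%Z) L F); auto.
  - apply (meas_restrict Hm _ (marked_measurable 0 mark)).
  - apply (meas_scale (meas_restrict Hm _ (marked_measurable 0 unmark))).
    left. apply Rdiv_lt_0_compat; lra.
  - intros; apply marked_measurable.
  - intros; apply marked_measurable.
  - intros x _. cbv beta.
    assert (Hx : forall z, P2 (fun w => (forall i, (i <= L)%nat -> marked (1 + Z.of_nat i)%Z w = x i) /\ marked 0%Z w = z) =
      marked_pi z * rprod (fun i => marked_K (match i with 0%nat => z | S i => x i end) (x i)) (S L)).
    { intros z. rewrite <- (marked_law 0%Z (S L) (fun i => match i with 0%nat => z | S i => x i end)).
      f_equal. apply ev_ext. intros w. split.
      - intros [H1 H2] [|i] Hi; auto. rewrite <- H1 by lia. f_equal. lia.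
      - intros H. split; [|apply (H 0%nat); lia]. intros i Hi.
        rewrite <- (H (S i)) by lia. f_equal. lia. }
    rewrite !Hx, !rprod_head. unfold marked_pi, marked_K, mark, unmark. cbn [fst snd].
    simpl coin_weight. field. lra.
Qed.

Lemma swap_end L E : finite_event L E ->
  P2 (fun w => E (fun i => marked (Z.of_nat i) w) /\ marked (Z.of_nat (S L)) w = mark) =
  (1 - q) / q * P2 (fun w => E (fun i => marked (Z.of_nat i) w) /\ marked (Z.of_nat (S L)) w = unmark).
Proof.
  intros HE.
  apply (finite_event_agree HcS2 mark (Sig1 := Sig2) (Sig2 := Sig2)
    (m1 := fun G => P2 (fun w => G w /\ marked (Z.of_nat (S L)) w = mark))
    (m2 := fun G => (1 - q) / q * P2 (fun w => G w /\ marked (Z.of_nat (S L)) w = unmark))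
    (fun i => marked (Z.of_nat i)) (fun i => marked (Z.of_nat i)) L E); auto.
  - apply (meas_restrict Hm _ (marked_measurable _ mark)).
  - apply (meas_scale (meas_restrict Hm _ (marked_measurable _ unmark))).
    left. apply Rdiv_lt_0_compat; lra.
  - intros; apply marked_measurable.
  - intros; apply marked_measurable.
  - intros x _. cbv beta.
    assert (Hx : forall z, P2 (fun w => (forall i, (i <= L)%nat -> marked (Z.of_nat i) w = x i) /\
        marked (Z.of_nat (S L)) w = z) =
      marked_pi (x 0%nat) * rprod (fun i => marked_K (x i) (x (S i))) L * marked_K (x L) z).
    { intros z. pose (x' := fun i => if le_lt_dec i L then x i else z).
      assert (Hx' : forall i, (i <= L)%nat -> x' i = x i) by (intros i Hi; unfold x'; destruct (le_lt_dec i L); auto; lia).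
      assert (HxL : x' (S L) = z) by (unfold x'; destruct (le_lt_dec (S L) L); auto; lia).
      transitivity (P2 (fun w => forall i, (i <= S L)%nat -> marked (0 + Z.of_nat i)%Z w = x' i)).
      - f_equal. apply ev_ext. intros w. split.
        + intros [H1 H2] i Hi. destruct (Nat.eq_dec i (S L)) as [->|]; [now rewrite HxL|].
          rewrite Hx' by lia. apply H1. lia.
        + intros H. split; [intros i Hi; rewrite <- Hx' by lia; apply (H i); lia|].
          rewrite <- HxL. apply (H (S L)). lia.
      - rewrite marked_law. simpl rprod. rewrite HxL, !Hx' by lia.
        rewrite (rprod_ext _ (fun i => marked_K (x i) (x (S i)))); [ring|].
        intros k Hk. rewrite !Hx'; auto; lia. }
    rewrite !Hx. unfold marked_K at 2 4. unfold mark, unmark. cbn [fst snd].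
    simpl coin_weight. field. lra.
Qed.

(** Renewal sequence of the visits to [s] killed at the first marked one. *)
Definition unmarked_return (t : nat) : R :=
  P2 (fun w => (marked 0%Z w = unmark /\ forall i : nat, (1 <= i < t)%nat -> marked (Z.of_nat i) w <> mark) /\
    marked (Z.of_nat t) w = unmark) / marked_pi unmark.

Definition unmarked_survival (t : nat) : R :=
  P2 (fun w => marked 0%Z w = unmark /\ forall i : nat, (1 <= i < S t)%nat -> marked (Z.of_nat i) w <> mark)
  / marked_pi unmark.

Lemma not_mark x : fst x = s -> x <> mark -> x = unmark.
Proof. destruct x as [x [|]]; unfold mark, unmark; simpl; intros ->; tauto. Qed.

Lemma unmarked_return_0 : unmarked_return 0 = 1.
Proof.
  unfold unmarked_return. rewrite <- (marked_state 0 unmark) at 1.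
  replace (fun w => _ /\ marked (Z.of_nat 0) w = unmark) with (fun w => marked 0%Z w = unmark).
  - rewrite marked_state. field. lra.
  - apply ev_ext. intros w. split; [|tauto]. intros H. split; auto. split; auto. intros; lia.
Qed.

Lemma first_visit_split (k : nat) L F : finite_event L F ->
  P2 (fun w => ((marked 0%Z w = unmark /\
      forall i : nat, (1 <= i < S k)%nat -> fst (marked (Z.of_nat i) w) <> s) /\
      marked (Z.of_nat (S k)) w = unmark) /\
      F (fun i => marked (Z.of_nat (S k) + Z.of_nat i)%Z w)) =
  q * gap_prob k * P2 (fun w => marked 0%Z w = unmark /\ F (fun i => marked (Z.of_nat i) w)).
Proof.
  intros HF.
  assert (HE : finite_event (S k) (fun x : nat -> St * bool => x 0%nat = unmark /\
    forall i : nat, (1 <= i < S k)%nat -> fst (x i) <> s)).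
  { intros x x' Hx [H1 H2]. split; [rewrite <- Hx by lia; auto|]. intros i Hi. rewrite <- Hx by lia. auto. }
  assert (H := law_split HP2 marked_measurable HcS2 mark marked_pi marked_K marked_law 0%Z (S k) L unmark _ _ HE HF).
  apply (Rmult_eq_reg_r (marked_pi unmark)); [|lra].
  etransitivity; [exact H|]. cbv beta. simpl Z.add. 
  rewrite (Rmult_comm (q * gap_prob k)), Rmult_assoc, (Rmult_comm (q * gap_prob k)), <- unmarked_gap.
  apply Rmult_comm.
Qed.

(** Split at the first visit to [s] after time 0: it is unmarked, and reaching it after [k + 1]
    steps has probability [q * gap_prob k]. *)
Lemma unmarked_return_renewal n : unmarked_return (S n) =
  rsum (fun k => q * gap_prob k * unmarked_return (n - k)) (S n).
Proof.
  pose (F := fun (l : nat) (x : nat -> St * bool) =>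
    (forall i : nat, (1 <= i < l)%nat -> x i <> mark) /\ x l = unmark).
  assert (HF : forall l, finite_event l (F l)).
  { intros l x x' Hx [H1 H2]. split; [|rewrite <- Hx by lia; auto]. intros i Hi. rewrite <- Hx by lia. auto. }
  pose (G := fun k w => ((marked 0%Z w = unmark /\
      forall i : nat, (1 <= i < S k)%nat -> fst (marked (Z.of_nat i) w) <> s) /\
      marked (Z.of_nat (S k)) w = unmark) /\
      F (n - k)%nat (fun i => marked (Z.of_nat (S k) + Z.of_nat i)%Z w)).
  assert (MM := marked_measurable).
  assert (SG : forall k, Sig2 (G k)).
  { intros k. unfold G, F. assert (Mf : forall i, Sig2 (fun w => fst (marked i w) = s)).
    { intros i. apply (sig_iff (fun w => exists b, marked i w = (s, b))); [|meas HS].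
      intros w. unfold marked. simpl. split; [intros [b H]; now injection H|intros ->; eauto]. }
    meas HS. }
  assert (DG : forall i j w, i <> j -> G i w -> G j w -> False).
  { intros i j w Hij [[[_ H1] H2] _] [[[_ H3] H4] _].
    destruct (Nat.lt_total i j) as [|[|]]; auto.
    - apply (H3 (S i)); [lia|]. now rewrite H2.
    - apply (H1 (S j)); [lia|]. now rewrite H4. }
  unfold unmarked_return at 1.
  replace (fun w => (marked 0%Z w = unmark /\
      forall i : nat, (1 <= i < S n)%nat -> marked (Z.of_nat i) w <> mark) /\
      marked (Z.of_nat (S n)) w = unmark)
    with (fun w => exists k, (k < S n)%nat /\ G k w).
  - rewrite (meas_rsum Hm G) by auto. unfold Rdiv. rewrite Rmult_comm, <- rsum_scal.
    apply rsum_ext. intros k Hk. unfold G. rewrite (first_visit_split k (n - k) (F (n - k)%nat)) by auto.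
    unfold unmarked_return, F.
    replace (fun w => marked 0%Z w = unmark /\
      (forall i : nat, (1 <= i < n - k)%nat -> marked (Z.of_nat i) w <> mark) /\ marked (Z.of_nat (n - k)) w = unmark)
      with (fun w => (marked 0%Z w = unmark /\
      forall i : nat, (1 <= i < n - k)%nat -> marked (Z.of_nat i) w <> mark) /\ marked (Z.of_nat (n - k)) w = unmark)
      by (apply ev_ext; intros; tauto).
    unfold Rdiv. ring.
  - apply ev_ext. intros w. unfold G, F. split.
    + intros (k & Hk & [[H1 H2] H3] & H4 & H5). split; [split; auto|].
      * intros i Hi Hm'. destruct (Nat.lt_total i (S k)) as [Hik|[->|Hik]].
        -- apply (H2 i); [lia|]. now rewrite Hm'.
        -- rewrite H3 in Hm'. discriminate.
        -- apply (H4 (i - S k)%nat); [lia|]. rewrite <- Hm'. f_equal. lia.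
      * rewrite <- H5. f_equal. lia.
    + intros [[H1 H2] H3].
      destruct (least_element
        (fun k => (k <= n)%nat /\ fst (marked (Z.of_nat (S k)) w) = s)) as (k & [(Hk & Hs) Hmin]).
      { exists n. rewrite H3. auto. }
      assert (Hun : marked (Z.of_nat (S k)) w = unmark).
      { apply not_mark; auto. destruct (Nat.eq_dec k n) as [->|]; [rewrite H3; discriminate|].
        apply H2. lia. }
      exists k. split; [lia|]. split; [split; [split|]|split]; auto.
      * intros i Hi Hi'. assert (k <= i - 1)%nat; [|lia]. apply Hmin. split; [lia|].
        now replace (S (i - 1)) with i by lia.
      * intros i Hi. replace (Z.of_nat (S k) + Z.of_nat i)%Z with (Z.of_nat (S k + i)) by lia.
        apply H2. lia.
      * replace (Z.of_nat (S k) + Z.of_nat (n - k))%Z with (Z.of_nat (S n)) by lia. auto.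
Qed.

Lemma survival_measurable t : Sig2 (fun w => marked 0%Z w = unmark /\
  forall i : nat, (1 <= i < t)%nat -> marked (Z.of_nat i) w <> mark).
Proof. assert (MM := marked_measurable). meas HS. Qed.

Lemma survival_ge0 t : 0 <= unmarked_survival t.
Proof.
  apply Rmult_le_pos; [|left; now apply Rinv_0_lt_compat]. apply (meas_ge0 Hm), survival_measurable.
Qed.

Lemma survival_mono t t' : (t <= t')%nat -> unmarked_survival t' <= unmarked_survival t.
Proof.
  intros Ht. apply Rmult_le_compat_r; [left; now apply Rinv_0_lt_compat|].
  apply (meas_mono Hm); try apply survival_measurable.
  intros w [H1 H2]. split; auto. intros i Hi. apply H2. lia.
Qed.

Lemma survival_le1 t : unmarked_survival t <= 1.
Proof.
  apply Rle_trans with (unmarked_survival 0); [apply survival_mono; lia|].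
  unfold unmarked_survival. apply (Rmult_le_reg_r (marked_pi unmark)); auto.
  unfold Rdiv. rewrite Rmult_assoc, Rinv_l, Rmult_1_r, Rmult_1_l by lra.
  rewrite <- (marked_state 0 unmark).
  apply (meas_mono Hm); [apply survival_measurable|apply marked_measurable|tauto].
Qed.

Lemma gap_ge0 k : 0 <= gap_prob k.
Proof.
  apply Rmult_le_pos; [|left; now apply Rinv_0_lt_compat]. apply (first_ge0 HP HM).
Qed.

Lemma gap_sum n : rsum gap_prob n = 1 - tail_prob (P := P) (M := M) s (S n) / pi s.
Proof.
  induction n.
  - simpl. rewrite tail_start by lia. rewrite (law_state pi K Hlaw). field. lra.
  - simpl. rewrite IHn. unfold gap_prob. rewrite (tail_succ HP HM s (S n)) by lia.
    field. lra.
Qed.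

Lemma gap_sum_le1 n : rsum gap_prob n <= 1.
Proof.
  rewrite gap_sum. assert (0 <= tail_prob (P := P) (M := M) s (S n) / pi s); [|lra].
  apply Rmult_le_pos; [apply (tail_ge0 HP HM)|left; now apply Rinv_0_lt_compat].
Qed.

(** Either [s] is not visited during the first [J] steps, or its first visit there is unmarked, at
    the cost of a factor [q], and at least [t - J] steps remain to be survived. *)
Lemma survival_step J t : (J <= t)%nat -> unmarked_survival t <=
  tail_prob (P := P) (M := M) s (S J) / pi s + q * unmarked_survival (t - J).
Proof.
  intros HJ.
  pose (F := fun (l : nat) (x : nat -> St * bool) => forall i : nat, (1 <= i < S l)%nat -> x i <> mark).
  assert (HF : forall l, finite_event l (F l)).
  { intros l x x' Hx H i Hi. rewrite <- Hx by lia. auto. }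
  pose (G := fun k w => ((marked 0%Z w = unmark /\
      forall i : nat, (1 <= i < S k)%nat -> fst (marked (Z.of_nat i) w) <> s) /\
      marked (Z.of_nat (S k)) w = unmark) /\
      F (t - S k)%nat (fun i => marked (Z.of_nat (S k) + Z.of_nat i)%Z w)).
  pose (B := fun w => marked 0%Z w = unmark /\
      forall i : nat, (1 <= i < S J)%nat -> fst (marked (Z.of_nat i) w) <> s).
  assert (MM := marked_measurable).
  assert (Mf : forall i, Sig2 (fun w => fst (marked i w) = s)).
  { intros i. apply (sig_iff (fun w => exists b, marked i w = (s, b))); [|meas HS].
    intros w. unfold marked. simpl. split; [intros [b H]; now injection H|intros ->; eauto]. }
  assert (SG : forall k, Sig2 (G k)) by (intros k; unfold G, F; meas HS).
  assert (SB : Sig2 B) by (unfold B; meas HS).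
  assert (DG : forall i j w, i <> j -> G i w -> G j w -> False).
  { intros i j w Hij [[[_ H1] H2] _] [[[_ H3] H4] _].
    destruct (Nat.lt_total i j) as [|[|]]; auto.
    - apply (H3 (S i)); [lia|]. now rewrite H2.
    - apply (H1 (S j)); [lia|]. now rewrite H4. }
  assert (HB : P2 B = q * tail_prob (P := P) (M := M) s (S J)) by apply unmarked_tail.
  assert (HG : forall k, (k < J)%nat -> P2 (G k) <= marked_pi unmark * (gap_prob k * (q * unmarked_survival (t - J)))).
  { intros k Hk. unfold G. rewrite (first_visit_split k (t - S k) (F _)) by auto.
    assert (H := survival_mono (t - J) (t - S k) ltac:(lia)).
    assert (E : P2 (fun w => marked 0%Z w = unmark /\ F (t - S k)%nat (fun i => marked (Z.of_nat i) w)) =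
      marked_pi unmark * unmarked_survival (t - S k)).
    { unfold unmarked_survival, F. field. lra. }
    rewrite E. assert (Hg := gap_ge0 k).
    replace (q * gap_prob k * (marked_pi unmark * unmarked_survival (t - S k)))
      with ((marked_pi unmark * (gap_prob k * q)) * unmarked_survival (t - S k)) by ring.
    replace (marked_pi unmark * (gap_prob k * (q * unmarked_survival (t - J))))
      with ((marked_pi unmark * (gap_prob k * q)) * unmarked_survival (t - J)) by ring.
    apply Rmult_le_compat_l; auto. apply Rmult_le_pos; [lra|]. apply Rmult_le_pos; lra. }
  assert (HU1 : P2 (fun w => exists k, (k < J)%nat /\ G k w) <=
    marked_pi unmark * (q * unmarked_survival (t - J))).
  { rewrite (meas_rsum Hm G) by auto. eapply Rle_trans; [apply rsum_le; exact HG|].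
    rewrite (rsum_ext _ (fun k => (marked_pi unmark * (q * unmarked_survival (t - J))) * gap_prob k))
      by (intros; ring).
    rewrite rsum_scal. assert (H := gap_sum_le1 J). assert (H1 := survival_ge0 (t - J)).
    rewrite <- (Rmult_1_r (marked_pi unmark * (q * unmarked_survival (t - J)))) at 2.
    apply Rmult_le_compat_l; auto. apply Rmult_le_pos; [lra|]. apply Rmult_le_pos; lra. }
  apply (Rmult_le_reg_r (marked_pi unmark)); auto. unfold unmarked_survival at 1.
  unfold Rdiv. rewrite Rmult_assoc, Rinv_l, Rmult_1_r by lra.
  apply Rle_trans with (P2 (fun w => B w \/ exists k, (k < J)%nat /\ G k w)).
  - apply (meas_mono Hm); [apply survival_measurable|apply (sig_or HS); auto; meas HS|].
    intros w [H1 H2].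
    destruct (classic (exists k, (k < J)%nat /\ fst (marked (Z.of_nat (S k)) w) = s)) as [Hex|Hno].
    + right. destruct (least_element
        (fun k => (k < J)%nat /\ fst (marked (Z.of_nat (S k)) w) = s)) as (k & [(Hk & Hs) Hmin]);
        [auto|].
      exists k. split; auto. split; [split; [split|]|]; auto.
      * intros i Hi Hi'. assert (k <= i - 1)%nat; [|lia]. apply Hmin. split; [lia|].
        now replace (S (i - 1)) with i by lia.
      * apply not_mark; auto. apply H2. lia.
      * intros i Hi. replace (Z.of_nat (S k) + Z.of_nat i)%Z with (Z.of_nat (S k + i)) by lia.
        apply H2. lia.
    + left. split; auto. intros i Hi Hi'. apply Hno. exists (i - 1)%nat. split; [lia|].
      now replace (S (i - 1)) with i by lia.
  - eapply Rle_trans; [apply (meas_union_le Hm); auto; meas HS|].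
    rewrite HB. rewrite unmark_pi in *. apply Rle_trans with
      (q * tail_prob (P := P) (M := M) s (S J) + pi s * q * (q * unmarked_survival (t - J))); [lra|].
    right. field. lra.
Qed.

(** Only the coin at time 0 distinguishes this tail from the survival after an unmarked visit, so
    [swap_start] compares the two. *)
Lemma tail_mark t : tail_prob (P := P2) (M := marked) mark (S t) =
  (1 - q) / q * (marked_pi unmark * unmarked_survival t).
Proof.
  assert (HF : finite_event t (fun x : nat -> St * bool => forall i, (i < t)%nat -> x i <> mark)).
  { intros x x' Hx H i Hi. rewrite <- Hx by lia. auto. }
  assert (H := swap_start t _ HF). cbv beta in H.
  assert (E : forall z, P2 (fun w => marked 0%Z w = z /\
      forall i : nat, (1 <= i < S t)%nat -> marked (Z.of_nat i) w <> mark) =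
    P2 (fun w => (forall i, (i < t)%nat -> marked (1 + Z.of_nat i)%Z w <> mark) /\ marked 0%Z w = z)).
  { intros z. f_equal. apply ev_ext. intros w. split.
    - intros [H1 H2]. split; auto. intros i Hi.
      replace (1 + Z.of_nat i)%Z with (Z.of_nat (S i)) by lia. apply H2. lia.
    - intros [H1 H2]. split; auto. intros i Hi.
      replace (Z.of_nat i) with (1 + Z.of_nat (i - 1))%Z by lia. apply H1. lia. }
  unfold tail_prob, unmarked_survival. rewrite !E, H. field. lra.
Qed.

(** Both end coins are swapped, hence the factor [(1 - q) / q] twice. *)
Lemma first_mark t : first_prob (P := P2) (M := marked) mark (S t) =
  (1 - q) / q * ((1 - q) / q * (marked_pi unmark * unmarked_return (S t))).
Proof.
  assert (HE : finite_event t (fun x : nat -> St * bool => x 0%nat = mark /\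
    forall i : nat, (1 <= i < S t)%nat -> x i <> mark)).
  { intros x x' Hx [H1 H2]. split; [rewrite <- Hx by lia; auto|]. intros i Hi. rewrite <- Hx by lia. auto. }
  assert (H1 := swap_end t _ HE). cbv beta in H1. change (Z.of_nat 0) with 0%Z in H1.
  assert (HF : finite_event t (fun x : nat -> St * bool => (forall i, (i < t)%nat -> x i <> mark) /\ x t = unmark)).
  { intros x x' Hx [H2 H3]. split; [|rewrite <- Hx by lia; auto]. intros i Hi. rewrite <- Hx by lia. auto. }
  assert (H2 := swap_start t _ HF). cbv beta in H2.
  assert (E : forall z, P2 (fun w => (marked 0%Z w = z /\
      forall i : nat, (1 <= i < S t)%nat -> marked (Z.of_nat i) w <> mark) /\
      marked (Z.of_nat (S t)) w = unmark) =
    P2 (fun w => ((forall i, (i < t)%nat -> marked (1 + Z.of_nat i)%Z w <> mark) /\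
      marked (1 + Z.of_nat t)%Z w = unmark) /\ marked 0%Z w = z)).
  { intros z. f_equal. apply ev_ext. intros w.
    replace (1 + Z.of_nat t)%Z with (Z.of_nat (S t)) by lia. split.
    - intros [[H3 H4] H5]. split; [split|]; auto. intros i Hi.
      replace (1 + Z.of_nat i)%Z with (Z.of_nat (S i)) by lia. apply H4. lia.
    - intros [[H3 H4] H5]. split; [split|]; auto. intros i Hi.
      replace (Z.of_nat i) with (1 + Z.of_nat (i - 1))%Z by lia. apply H3. lia. }
  unfold first_prob, unmarked_return. rewrite H1, !E, H2. field. lra.
Qed.

(** The difference is the probability of a first mark exactly at time [t + 1]; turning that coin
    over gives an unmarked return. *)
Lemma survival_succ t : unmarked_survival t - unmarked_survival (S t) =
  (1 - q) / q * unmarked_return (S t).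
Proof.
  assert (HE : finite_event t (fun x : nat -> St * bool => x 0%nat = unmark /\
    forall i : nat, (1 <= i < S t)%nat -> x i <> mark)).
  { intros x x' Hx [H1 H2]. split; [rewrite <- Hx by lia; auto|]. intros i Hi. rewrite <- Hx by lia. auto. }
  assert (H1 := swap_end t _ HE). cbv beta in H1. change (Z.of_nat 0) with 0%Z in H1.
  assert (H2 := meas_split Hm _ (fun w => marked (Z.of_nat (S t)) w = mark)
    (survival_measurable (S t)) (marked_measurable _ _)). cbv beta in H2.
  rewrite H1 in H2.
  assert (E : P2 (fun w => (marked 0%Z w = unmark /\
      forall i : nat, (1 <= i < S t)%nat -> marked (Z.of_nat i) w <> mark) /\
      marked (Z.of_nat (S t)) w <> mark) =
    P2 (fun w => marked 0%Z w = unmark /\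
      forall i : nat, (1 <= i < S (S t))%nat -> marked (Z.of_nat i) w <> mark)).
  { f_equal. apply ev_ext. intros w. split.
    - intros [[H3 H4] H5]. split; auto. intros i Hi.
      destruct (Nat.eq_dec i (S t)) as [->|]; auto. apply H4. lia.
    - intros [H3 H4]. split; [split; auto|]; intros; apply H4; lia. }
  rewrite E in H2. unfold unmarked_survival. rewrite H2. unfold unmarked_return. field. lra.
Qed.

Context (C c : R) (Hc : 0 < c)
  (Htail : forall n, tail_prob (P := P) (M := M) s n / pi s <= C * exp (- c * INR n)).

Lemma exp_small e : 0 < e -> exists n : nat, C * exp (- c * INR (S n)) < e.
Proof.
  intros He.
  assert (Hr : 0 < exp (- c) < 1).
  { split; [apply exp_pos|]. rewrite <- exp_0. apply exp_increasing. lra. }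
  destruct (pow_lt_1_zero (exp (- c))) with (y := e / (Rabs C + 1)) as [N HN].
  { rewrite Rabs_right; lra. }
  { assert (H := Rabs_pos C). apply Rdiv_lt_0_compat; lra. }
  exists N. specialize (HN (S N) ltac:(lia)).
  assert (E : exp (- c * INR (S N)) = exp (- c) ^ S N).
  { rewrite <- Rpower_pow by apply exp_pos. unfold Rpower. rewrite ln_exp. f_equal. ring. }
  rewrite E. rewrite Rabs_right in HN by (apply Rle_ge, pow_le; lra).
  assert (H := Rabs_pos C). assert (H' := Rle_abs C).
  assert (0 < exp (- c) ^ S N) by (apply pow_lt; lra).
  apply (Rmult_lt_compat_r (Rabs C + 1)) in HN; [|lra].
  unfold Rdiv in HN. rewrite Rmult_assoc, Rinv_l, Rmult_1_r in HN by lra. nra.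
Qed.

Lemma survival_small e : 0 < e -> exists t, unmarked_survival t < e.
Proof.
  (* This makes [e / 2] the fixed point of the affine recursion in [survival_step], so that
     iterating it only adds [q ^ k]. *)
  intros He. destruct (exp_small (e * (1 - q) / 2)) as [J HJ]; [nra|].
  assert (Hstep : forall k, unmarked_survival (k * S J) <= e / 2 + q ^ k).
  { induction k as [|k IH].
    - simpl. assert (H := survival_le1 0). lra.
    - assert (H := survival_step J (S k * S J) ltac:(nia)).
      assert (H1 := survival_mono (k * S J) (S k * S J - J) ltac:(nia)).
      assert (H2 := Htail (S J)). simpl pow.
      assert (H3 : q * unmarked_survival (S k * S J - J) <= q * (e / 2 + q ^ k))
        by (apply Rmult_le_compat_l; lra).
      lra. }
  destruct (pow_lt_1_zero q) with (y := e / 2) as [N HN]; [rewrite Rabs_right; lra|lra|].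
  exists (N * S J)%nat. specialize (HN N (Nat.le_refl _)).
  rewrite Rabs_right in HN by (apply Rle_ge, pow_le; lra).
  specialize (Hstep N). lra.
Qed.

Context (Hirr : forall z, 0 < pi z -> exists n : nat, 0 < P (fun w => M 0%Z w = s /\ M (Z.of_nat n) w = z)).

Lemma chain_hitting e : 0 < e -> exists b : nat, P (fun w => forall i, (i < b)%nat -> M (Z.of_nat i) w <> s) < e.
Proof.
  apply (hitting HP HM HcS s pi K Hlaw Hirr).
  intros e' He'. destruct (exp_small (e' / pi s)) as [n Hn]; [now apply Rdiv_lt_0_compat|].
  exists (S n). assert (H := Htail (S n)).
  change (tail_prob (P := P) (M := M) s (S n) < e').
  apply (Rmult_lt_reg_r (/ pi s)); [now apply Rinv_0_lt_compat|]. unfold Rdiv in *. lra.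
Qed.

(** A long stretch without [mark] either misses [s] in its first [b] sites, or its first visit to
    [s], at some [j < b], is unmarked and is followed by [t] sites without [mark]. The events [V j]
    are disjoint, so the second case costs at most one survival probability. *)
Lemma marked_recurrent e : 0 < e -> exists a : nat, forall n : Z,
  P2 (fun w => forall i, (i < a)%nat -> marked (n + Z.of_nat i)%Z w <> mark) < e.
Proof.
  intros He. destruct (chain_hitting (e / 2)) as [b Hb]; [lra|].
  destruct (survival_small (e / 2)) as [t Ht]; [lra|].
  exists (b + t + 1)%nat. intros n.
  assert (HL : finite_event (b + t + 1) (fun x : nat -> St * bool => forall i, (i < b + t + 1)%nat -> x i <> mark)).
  { intros x x' Hx H i Hi. rewrite <- Hx by lia. auto. }
  assert (Hsh := law_shift HP2 marked_measurable HcS2 mark marked_pi marked_K marked_law n _ _ HL).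
  cbv beta in Hsh. rewrite Hsh. clear Hsh n.
  assert (MM := marked_measurable).
  assert (Mf : forall i, Sig2 (fun w => fst (marked i w) = s)).
  { intros i. apply (sig_iff (fun w => exists b, marked i w = (s, b))); [|meas HS].
    intros w. unfold marked. simpl. split; [intros [b' H]; now injection H|intros ->; eauto]. }
  pose (V := fun (j : nat) w => (forall i, (i < j)%nat -> fst (marked (Z.of_nat i) w) <> s) /\
    marked (Z.of_nat j) w = unmark).
  pose (G := fun (j : nat) w => V j w /\
    forall i : nat, (1 <= i < S t)%nat -> marked (Z.of_nat j + Z.of_nat i)%Z w <> mark).
  assert (SV : forall j, Sig2 (V j)) by (intros j; unfold V; meas HS).
  assert (SG : forall j, Sig2 (G j)) by (intros j; unfold G; meas HS).
  assert (DV : forall i j w, i <> j -> V i w -> V j w -> False).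
  { intros i j w Hij [H1 H2] [H3 H4].
    destruct (Nat.lt_total i j) as [|[|]]; auto.
    - apply (H3 i); auto. now rewrite H2.
    - apply (H1 j); auto. now rewrite H4. }
  assert (HG : forall j, P2 (G j) = unmarked_survival t * P2 (V j)).
  { intros j.
    assert (HE : finite_event j (fun x : nat -> St * bool => forall i, (i < j)%nat -> fst (x i) <> s)).
    { intros x x' Hx H i Hi. rewrite <- Hx by lia. auto. }
    assert (HF : finite_event t (fun x : nat -> St * bool => forall i : nat, (1 <= i < S t)%nat -> x i <> mark)).
    { intros x x' Hx H i Hi. rewrite <- Hx by lia. auto. }
    assert (H := law_split HP2 marked_measurable HcS2 mark marked_pi marked_K marked_law 0%Z j t unmark _ _ HE HF).
    apply (Rmult_eq_reg_r (marked_pi unmark)); [|lra].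
    etransitivity; [exact H|]. unfold unmarked_survival.
    rewrite (Rmult_comm (_ / _)), Rmult_assoc. f_equal. unfold Rdiv.
    rewrite Rmult_assoc, Rinv_l, Rmult_1_r by lra. reflexivity. }
  set (B := fun w => forall i, (i < b)%nat -> fst (marked (Z.of_nat i) w) <> s).
  assert (SB : Sig2 B) by (unfold B; meas HS).
  assert (HB : P2 B < e / 2).
  { unfold B. rewrite (rectangle_prob (fun w => forall i, (i < b)%nat -> M (Z.of_nat i) w <> s) (fun _ => True)).
    - replace (Q (fun _ => True)) with 1 by (symmetry; apply HQ). lra.
    - meas HSP.
    - apply (sig_const HSQ).
    - intros w y. unfold marked. cbn [fst snd]. tauto. }
  apply Rle_lt_trans with (P2 (fun w => B w \/ exists j, (j < b)%nat /\ G j w)).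
  - apply (meas_mono Hm); [meas HS|apply (sig_or HS); auto; meas HS|]. intros w Hw.
    destruct (classic (exists j, (j < b)%nat /\ fst (marked (Z.of_nat j) w) = s)) as [Hex|Hno].
    + right. destruct (least_element
        (fun j => (j < b)%nat /\ fst (marked (Z.of_nat j) w) = s)) as (j & [(Hj & Hs) Hmin]);
        [auto|].
      exists j. split; auto. split; [split|].
      * intros i Hi Hi'. assert (j <= i)%nat; [|lia]. apply Hmin. split; [lia|auto].
      * apply not_mark; auto. apply Hw. lia.
      * intros i Hi. replace (Z.of_nat j + Z.of_nat i)%Z with (Z.of_nat (j + i)) by lia. apply Hw. lia.
    + left. intros i Hi Hi'. apply Hno. eauto.
  - eapply Rle_lt_trans; [apply (meas_union_le Hm); auto; meas HS|].
    rewrite (meas_rsum Hm G); auto.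
    2:{ intros i j w Hij [H1 _] [H2 _]. eapply DV; eauto. }
    rewrite (rsum_ext _ (fun j => unmarked_survival t * P2 (V j))) by (intros; apply HG).
    rewrite rsum_scal, <- (meas_rsum Hm V) by auto.
    assert (H1 : P2 (fun w => exists k, (k < b)%nat /\ V k w) <= 1).
    { replace 1 with (P2 (fun _ => True)) by apply HP2. apply (meas_mono Hm); auto; meas HS. }
    assert (H2 : 0 <= P2 (fun w => exists k, (k < b)%nat /\ V k w)) by (apply (meas_ge0 Hm); meas HS).
    assert (H3 := survival_ge0 t). nra.
Qed.

(** * The hazard of the marked return time *)

Context (lam : R) (Hlam : 0 < lam).
Let weight (k : nat) : R := q * gap_prob k * exp (lam * INR (S k)).
Context (weight_le1 : forall n, rsum weight n <= 1).
Context (weight_tail : exists C' r, 0 <= r < 1 /\ forall k, 1 - rsum weight k <= C' * r ^ k).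
Context (Haper : forall d, (forall n : nat, (1 <= n)%nat -> 0 < P (fun w => M 0%Z w = s /\ M (Z.of_nat n) w = s) ->
  Nat.divide d n) -> d = 1%nat).

(** With all coins from 0 to [n] equal to [false], which has positive probability independently of
    the chain, a return of the chain is an unmarked one. *)
Lemma unmarked_return_pos (n : nat) : 0 < P (fun w => M 0%Z w = s /\ M (Z.of_nat n) w = s) ->
  0 < unmarked_return n.
Proof.
  intros Hp. apply Rdiv_lt_0_compat; auto.
  apply Rlt_le_trans with (P2 (fun w => (M 0%Z (fst w) = s /\ M (Z.of_nat n) (fst w) = s) /\
    forall i, (i < S n)%nat -> coin (snd w (0 + Z.of_nat i)%Z) = false)).
  - assert (S1 : Sig (fun w => M 0%Z w = s /\ M (Z.of_nat n) w = s)) by meas HSP.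
    assert (S2 : prod_sigma SigA (fun y => forall i, (i < S n)%nat -> coin (y (0 + Z.of_nat i)%Z) = false)).
    { eapply coord_sigma_all, (coin_path_measurable (fun _ => True) 0 _ (fun _ => false)). auto. }
    rewrite (proj2 (rectangle _ _ S1 S2)), (coin_path 0 _ (fun _ => false)).
    apply Rmult_lt_0_compat; auto. clear -Hq. induction (S n); simpl; [lra|].
    apply Rmult_lt_0_compat; auto. lra.
  - assert (MM := marked_measurable).
    apply (meas_mono Hm).
    + assert (S1 : Sig (fun w => M 0%Z w = s /\ M (Z.of_nat n) w = s)) by meas HSP.
      assert (S2 : prod_sigma SigA (fun y => forall i, (i < S n)%nat -> coin (y (0 + Z.of_nat i)%Z) = false)).
      { eapply coord_sigma_all, (coin_path_measurable (fun _ => True) 0 _ (fun _ => false)). auto. }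
      apply (rectangle _ _ S1 S2).
    + meas HS.
    + intros w [[H1 H2] H3]. unfold marked, mark, unmark. split; [split|].
      * rewrite H1. f_equal. apply (H3 0%nat). lia.
      * intros i Hi E. injection E as _ E. specialize (H3 i ltac:(lia)). rewrite Z.add_0_l in H3. congruence.
      * rewrite H2. f_equal. apply (H3 n). lia.
Qed.

Let tilted (t : nat) : R := unmarked_return t * exp (lam * INR t).

Let tilted_0 : tilted 0 = 1.
Proof. unfold tilted. rewrite unmarked_return_0. simpl. rewrite Rmult_0_r, exp_0. ring. Qed.

Let weight_ge0 k : 0 <= weight k.
Proof.
  apply Rmult_le_pos; [apply Rmult_le_pos; [lra|apply gap_ge0]|]. left. apply exp_pos.
Qed.

Let tilted_renewal n : tilted (S n) = rsum (fun k => weight k * tilted (n - k)) (S n).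
Proof.
  unfold tilted at 1. rewrite unmarked_return_renewal, Rmult_comm, <- rsum_scal.
  apply rsum_ext. intros k Hk. unfold weight, tilted.
  replace (exp (lam * INR (S n))) with (exp (lam * INR (S k)) * exp (lam * INR (n - k))).
  - ring.
  - rewrite <- exp_plus. f_equal. rewrite minus_INR by lia. rewrite !S_INR. ring.
Qed.

Lemma marked_hazard : exists eps n0, 0 < eps /\ forall t : nat, (n0 < t)%nat ->
  0 < first_prob (P := P2) (M := marked) mark t /\
  eps * tail_prob (P := P2) (M := marked) mark t <= first_prob (P := P2) (M := marked) mark t.
Proof.
  destruct weight_tail as (C' & r' & Hr' & Hwt).
  (* Supermultiplicativity makes the times of possible unmarked returns an additive set;
     aperiodicity gives it greatest common divisor one. *)
  destruct (semigroup_cofinite (fun n => 0 < unmarked_return n)) as [N HN].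
  { intros m n Hm' Hn'. assert (H := renewal_supermult weight tilted weight_ge0 tilted_0 tilted_renewal m n).
    unfold tilted in H. rewrite plus_INR, Rmult_plus_distr_l, exp_plus in H.
    assert (E1 := exp_pos (lam * INR m)). assert (E2 := exp_pos (lam * INR n)).
    apply (Rmult_lt_reg_r (exp (lam * INR m) * exp (lam * INR n))); [nra|].
    rewrite Rmult_0_l. eapply Rlt_le_trans; [|exact H].
    apply Rmult_lt_0_compat; apply Rmult_lt_0_compat; auto. }
  { intros d Hd. apply Haper. intros n Hn Hp. apply Hd; auto. now apply unmarked_return_pos. }
  destruct (renewal_bounded_below weight tilted weight_ge0 tilted_0 tilted_renewal weight_le1 C' r' Hr' Hwt N)
    as (d & N' & Hd & Hlow).
  { intros n Hn. apply Rmult_lt_0_compat; [auto|apply exp_pos]. }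
  set (r := exp (- lam)).
  assert (Hr : 0 < r < 1).
  { split; [apply exp_pos|]. unfold r. rewrite <- exp_0. apply exp_increasing. lra. }
  assert (Hrk : forall k, exp (lam * INR k) * r ^ k = 1).
  { intros k. unfold r. rewrite <- (Rpower_pow k) by apply exp_pos. unfold Rpower.
    rewrite ln_exp, <- exp_plus, <- exp_0. f_equal. ring. }
  assert (Hu : forall t, unmarked_return t = tilted t * r ^ t).
  { intros t. unfold tilted. rewrite Rmult_assoc, Hrk. ring. }
  assert (Hup : forall t, unmarked_return t <= r ^ t).
  { intros t. rewrite Hu. assert (H := renewal_le1 weight tilted weight_ge0 tilted_0 tilted_renewal weight_le1 t).
    assert (0 < r ^ t) by (apply pow_lt; lra). nra. }
  set (rho := (1 - q) / q). assert (Hrho : 0 < rho) by (apply Rdiv_lt_0_compat; lra).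
  (* Sums [survival_succ] over [n] steps, each term being bounded through [Hup]. Letting the far
     survival vanish then gives [Hsurv]. *)
  assert (Htele : forall t n, unmarked_survival t <= unmarked_survival (t + n) +
    rho * (r ^ S t * rsum (fun k => r ^ k) n)).
  { intros t n. induction n.
    - simpl. rewrite Nat.add_0_r. lra.
    - rewrite Nat.add_succ_r. assert (H := survival_succ (t + n)). fold rho in H.
      assert (H1 := Hup (S (t + n))).
      replace (S (t + n)) with (S t + n)%nat in H1 at 2 by lia. rewrite pow_add in H1.
      simpl rsum. apply (Rmult_le_compat_l rho) in H1; [|lra]. lra. }
  assert (Hsurv : forall t, unmarked_survival t <= rho * (r ^ S t / (1 - r))).
  { intros t. apply Rnot_lt_le. intros Hlt.
    destruct (survival_small (unmarked_survival t - rho * (r ^ S t / (1 - r)))) as [T HT]; [lra|].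
    assert (H := Htele t T). assert (H1 := survival_mono T (t + T) ltac:(lia)).
    assert (H2 := rsum_geometric r T ltac:(lra)).
    assert (H3 : 0 < r ^ S t) by (apply pow_lt; lra).
    assert (H4 : rho * (r ^ S t * rsum (fun k => r ^ k) T) <= rho * (r ^ S t / (1 - r))).
    { apply Rmult_le_compat_l; [lra|]. apply Rmult_le_compat_l; lra. }
    lra. }
  (* Up to the common factor [rho * marked_pi unmark], at time [t + 1] the first-return probability
     is at least [rho * d * r^(t+1)] and the tail is at most [rho * r^(t+1) / (1 - r)]. *)
  exists (d * (1 - r)), N'. split; [nra|].
  intros [|t] Ht; [lia|].
  assert (Hlow' := Hlow (S t) ltac:(lia)).
  assert (Hrt : 0 < r ^ S t) by (apply pow_lt; lra).
  assert (Hur : d * r ^ S t <= unmarked_return (S t)).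
  { rewrite Hu. apply Rmult_le_compat_r; lra. }
  rewrite first_mark, tail_mark. fold rho.
  assert (Hdr : 0 < d * r ^ S t) by nra.
  split.
  - do 3 (apply Rmult_lt_0_compat; [assumption|]). lra.
  - replace (d * (1 - r) * (rho * (marked_pi unmark * unmarked_survival t)))
      with (rho * marked_pi unmark * (d * ((1 - r) * unmarked_survival t))) by ring.
    replace (rho * (rho * (marked_pi unmark * unmarked_return (S t))))
      with (rho * marked_pi unmark * (rho * unmarked_return (S t))) by ring.
    apply Rmult_le_compat_l; [apply Rmult_le_pos; lra|].
    apply Rle_trans with (rho * (d * r ^ S t)); [|apply Rmult_le_compat_l; lra].
    replace (rho * (d * r ^ S t)) with (d * (rho * r ^ S t)) by ring.
    apply Rmult_le_compat_l; [lra|].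
    assert (H := Hsurv t). apply (Rmult_le_compat_l (1 - r)) in H; [|lra].
    eapply Rle_trans; [exact H|]. right. field. lra.
Qed.

(** Arbitrarily late first returns have positive probability, and each is contained in the tail. *)
Lemma marked_tail_pos t : 0 < tail_prob (P := P2) (M := marked) mark t.
Proof.
  destruct marked_hazard as (eps & n0 & _ & H).
  destruct (H (t + n0 + 1)%nat ltac:(lia)) as [H1 _].
  eapply Rlt_le_trans; [|apply (tail_mono HP2 marked_measurable mark t (t + n0 + 1)); lia].
  rewrite (tail_succ HP2 marked_measurable mark) by lia.
  assert (H2 := tail_ge0 HP2 marked_measurable mark (S (t + n0 + 1))). lra.
Qed.
End thinning.

(** * Assembly of the factor *)

Lemma core_factor_exists {O : Type} {Sig : (O -> Prop) -> Prop} {P : (O -> Prop) -> R} {St : Type} {M : Z -> O -> St}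
  (HP : is_prob Sig P) (HM : forall n x, Sig (fun w => M n w = x)) (HcS : countable_type St)
  (o : St) (pi : St -> R) (K : St -> St -> R) (Hlaw : path_law P M pi K) (eps0 : R) (n0 : nat) :
  0 < pi o ->
  (forall e, 0 < e -> exists a : nat, forall n : Z,
    P (fun w => forall i, (i < a)%nat -> M (n + Z.of_nat i)%Z w <> o) < e) ->
  (forall t, 0 < tail_prob (P := P) (M := M) o t) -> 0 < eps0 ->
  (forall t, (n0 < t)%nat -> eps0 * tail_prob (P := P) (M := M) o t <= first_prob (P := P) (M := M) o t) ->
  finitary_iid_factor_exp P M.
Proof.
  intros Hpi Hrec Hpos He Hhaz.
  destruct uniform_sequence as (A & SigA & Q & U & HSA & HQ & Hsh & Hind & HU & HU0 & Hunif).
  destruct (countable_list St HcS) as [code Hcode].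
  assert (Hm := prob_measure _ _ HP).
  set (h := hazard (P := P) (M := M) o).
  (* Each hazard is below 1 because the next tail is positive, and only finitely many are
     involved. *)
  assert (Heta : forall N, exists eta, 0 < eta <= / 2 /\ forall t, (1 <= t <= N)%nat -> h t <= 1 - eta).
  { induction N as [|N (eta & He1 & He2)].
    - exists (/ 2). split; [lra|]. intros; lia.
    - assert (H := hazard_compl Hm HM o Hpos (S N) ltac:(lia)). fold h in H.
      assert (Hd : 0 < tail_prob (P := P) (M := M) o (S (S N)) /
        tail_prob (P := P) (M := M) o (S N)) by (apply Rdiv_lt_0_compat; auto).
      exists (Rmin eta (1 - h (S N))). split.
      + split; [apply Rmin_glb_lt; lra|]. eapply Rle_trans; [apply Rmin_l|lra].
      + intros t Ht. destruct (Nat.eq_dec t (S N)) as [->|].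
        * assert (H1 := Rmin_r eta (1 - h (S N))). lra.
        * assert (H1 := Rmin_l eta (1 - h (S N))). specialize (He2 t ltac:(lia)). lra. }
  destruct (Heta (2 * n0 + 1)%nat) as (eta & Heta1 & Heta2).
  (* Capping both [eps] and [eta] at one half ensures [eps <= 1 - eta]. *)
  assert (Hmin := Rmin_l eps0 (/ 2)). assert (Hmin' := Rmin_r eps0 (/ 2)).
  assert (Hminp : 0 < Rmin eps0 (/ 2)) by (apply Rmin_glb_lt; lra).
  apply (core_factor HP HM code Hcode o pi K Hlaw Hpi Hrec Hpos HSA HQ Hsh Hind HU HU0 Hunif
    n0 (Rmin eps0 (/ 2)) eta); auto; try lra.
  intros t Ht. specialize (Hhaz t Ht). specialize (Hpos t). eapply Rle_trans; [exact Hmin|].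
  unfold hazard. apply (Rmult_le_reg_r (tail_prob (P := P) (M := M) o t)); auto.
  unfold Rdiv. rewrite Rmult_assoc, Rinv_l, Rmult_1_r by lra. auto.
Qed.

Lemma factor_image {O O2 St S2 : Type} {P : (O -> Prop) -> R} {P2 : (O2 -> Prop) -> R}
  {M : Z -> O -> St} {M2 : Z -> O2 -> S2} (f : S2 -> St) :
  (forall B, prod_sigma (@discrete St) B ->
    P2 (fun w => B (fun n => f (M2 n w))) = P (fun w => B (fun n => M n w))) ->
  finitary_iid_factor_exp P2 M2 -> finitary_iid_factor_exp P M.
Proof.
  intros Hf (O' & Sig' & P' & A & SigA & Y & phi & Rw & C & c & H1 & H2 & H3 & H4 & H5 & H6 & H7 & H8).
  exists O', Sig', P', A, SigA, Y, (fun y => f (phi y)), Rw, C, c.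
  split; auto. split; auto. split; auto.
  split; [intros B _; exact (H4 (fun x => B (f x)) I)|].
  split; [|split; [auto|split; [|auto]]].
  - intros B HB. rewrite <- Hf by auto.
    apply (H5 (fun z => B (fun n => f (z n)))).
    revert HB. apply (generated_preimage (fun (z : Z -> S2) n => f (z n))); [apply is_sigma_generated|].
    intros E (n & D & _ & HE). apply generated_base. exists n, (fun x => D (f x)).
    split; [exact I|]. intros z. now rewrite HE.
  - intros B r. apply (H7 (fun x => B (f x))).
Qed.

Theorem theorem1 (O : Type) (Sig : (O -> Prop) -> Prop) (P : (O -> Prop) -> R)
  (S : Type) (M : Z -> O -> S) :
  countable_type S ->
  is_prob Sig P ->
  (forall n, measurable Sig (@discrete S) (M n)) ->
  stationary P M ->
  markov P M ->
  ergodic_chain P M ->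
  exp_return_times P M ->
  finitary_iid_factor_exp P M.
Proof.
  intros HcS HP HMd Hstat Hmarkov (Hirr & Haper & _) (s & C & c & HC & Hc & Hret).
  assert (HM := chain_state_measurable HMd).
  assert (Hlaw := chain_path_law HP HMd Hstat Hmarkov).
  set (pi := marginal (P := P) (M := M)) in *. set (K := kernel (P := P) (M := M)) in *.
  assert (Hm := prob_measure _ _ HP). assert (HS := proj1 HP).
  assert (Hpi0 : forall x, 0 <= pi x) by (intros x; apply (meas_ge0 Hm); auto).
  assert (Htrans : forall n x y, 0 < trans_prob P M n x y ->
    0 < pi x /\ 0 < P (fun w => M 0%Z w = x /\ M (Z.of_nat n) w = y)).
  { intros n x y H. unfold trans_prob in H. fold (pi x) in H.
    assert (Hxy : P (fun w => M 0%Z w = x /\ M (Z.of_nat n) w = y) <= pi x).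
    { apply (meas_mono Hm); [meas HS|auto|tauto]. }
    assert (Hge : 0 <= P (fun w => M 0%Z w = x /\ M (Z.of_nat n) w = y)) by (apply (meas_ge0 Hm); meas HS).
    destruct Hge as [Hge|Hge]; [split; lra|]. rewrite <- Hge in H. unfold Rdiv in H. lra. }
  assert (Hpi : 0 < pi s).
  { destruct (Hirr s s) as [n Hn]. now apply Htrans in Hn. }
  assert (Htail : forall n, tail_prob (P := P) (M := M) s n / pi s <= C * exp (- c * INR n)).
  { intros n. eapply Rle_trans; [|apply (Hret n)]. right. unfold ret_tail, tail_prob. fold (pi s).
    do 2 f_equal. apply ev_ext. intros w. split; intros [H1 H2]; split; auto. intros i []; auto. }
  pose (f := gap_prob (P := P) (M := M) s pi).
  assert (Hf0 : forall k, 0 <= f k) by (apply (gap_ge0 HP HM s pi Hpi)).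
  assert (Hfs : forall k, rsum f k = 1 - tail_prob (P := P) (M := M) s (Datatypes.S k) / pi s)
    by (apply (gap_sum HP HM s pi K Hlaw Hpi)).
  destruct (tilt f C c Hc) as (q & lam & Hq & Hlam & Hw1 & Hw2); auto.
  (* [f k] is a difference of two consecutive normalised tails, hence at most the first of them. *)
  { intros k. assert (H := Hfs (Datatypes.S k)). assert (H' := Hfs k). simpl in H.
    assert (H1 := Htail (Datatypes.S k)).
    assert (0 <= tail_prob (P := P) (M := M) s (Datatypes.S (Datatypes.S k)) / pi s).
    { apply Rmult_le_pos; [apply (tail_ge0 HP HM)|left; now apply Rinv_0_lt_compat]. }
    lra. }
  { intros k. rewrite Hfs. assert (H1 := Htail (Datatypes.S k)).
    assert (0 <= tail_prob (P := P) (M := M) s (Datatypes.S k) / pi s).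
    { apply Rmult_le_pos; [apply (tail_ge0 HP HM)|left; now apply Rinv_0_lt_compat]. }
    lra. }
  destruct uniform_sequence as (A & SigA & Q & U & HSA & HQ & Hsh & Hind & HU & HU0 & Hunif).
  (* The product is built on pointed types, so each factor needs a point; a space of total mass 1 is
     not empty. *)
  assert (Hne : forall (T : Type) (SigT : (T -> Prop) -> Prop) PT, is_prob SigT PT -> exists x : T, True).
  { intros T SigT PT HT. apply NNPP. intros Hno.
    assert (H0 := meas_empty (prob_measure _ _ HT)).
    replace (fun _ : T => False) with (fun _ : T => True) in H0 by (apply ev_ext; intros x; exfalso; eauto).
    destruct HT as (_ & _ & H1 & _). lra. }
  destruct (Hne _ _ _ HP) as [w0 _]. destruct (Hne _ _ _ HQ) as [y0 _].
  destruct (MC.product_prob Sig P (prod_sigma SigA) Q w0 y0 HP HQ) as (Sig2 & P2 & HP2 & Hrect).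
  assert (Hirr' : forall z, 0 < pi z -> exists n : nat, 0 < P (fun w => M 0%Z w = s /\ M (Z.of_nat n) w = z)).
  { intros z _. destruct (Hirr s z) as [n Hn]. exists n. now apply Htrans. }
  assert (Haper' : forall d, (forall n : nat, (1 <= n)%nat ->
    0 < P (fun w => M 0%Z w = s /\ M (Z.of_nat n) w = s) -> Nat.divide d n) -> d = 1%nat).
  { intros d Hd. apply (Haper s). intros n Hn Ht. apply Hd; auto. now apply Htrans. }
  pose (M2 := marked (M := M) (U := U) q).
  assert (HM2 : forall n x, Sig2 (fun w => M2 n w = x)) by (apply (marked_measurable HM HSA HU q Hq Hrect)).
  assert (Hlaw2 := marked_law HP HM pi K Hlaw HSA HQ Hind HU Hunif q Hq Hrect).
  destruct (marked_hazard HP HM HcS s pi K Hlaw Hpi HSA HQ Hind HU Hunif q Hq HP2 Hrect C c Hc Htail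
    lam Hlam Hw1 Hw2 Haper') as (eps & n0 & Heps & Hhaz).
  (* Forgetting the coins maps the marked chain to the original law, so it suffices to code the
     marked chain, with cycle state [mark s]. *)
  apply (factor_image (M2 := M2) (P2 := P2) fst).
  - intros B HB.
    assert (SB : Sig (fun w => B (fun n => M n w))).
    { revert HB. apply (generated_preimage (fun (w : O) n => M n w)); auto. intros E (n & D & _ & HE).
      apply (sig_iff (fun w => D (M n w))); [intros w; now rewrite HE|]. exact (HMd n D I). }
    assert (HT : Q (fun _ => True) = 1) by apply HQ.
    rewrite <- (Rmult_1_r (P _)), <- HT.
    rewrite <- (proj2 (Hrect _ _ SB (sig_const (proj1 HQ) True))).
    f_equal. apply ev_ext. intros w. unfold M2, marked. simpl. tauto.
  - apply (core_factor_exists HP2 HM2 (countable_prod S bool HcS countable_bool) (mark s)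
      (marked_pi pi q) (marked_K K q) Hlaw2 eps n0); auto.
    + unfold marked_pi, mark, coin_weight. simpl. nra.
    + exact (marked_recurrent HP HM HcS s pi K Hlaw Hpi HSA HQ Hind HU Hunif q Hq HP2 Hrect C c Hc Htail Hirr').
    + exact (marked_tail_pos HP HM HcS s pi K Hlaw Hpi HSA HQ Hind HU Hunif q Hq HP2 Hrect C c Hc Htail
        lam Hlam Hw1 Hw2 Haper').
    + intros t Ht. now apply Hhaz.
Qed.
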